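(* Let $1<p<\infty$, $L>0$, let $D\subset\mathbb R^{n-1}$ be a bounded open set, $\Omega=(-L,L)\times D\subset\mathbb R^n$, and $\theta(x)=x_1$. Fix levels $-L<a<b<c<L$ and define the interior plates \[ E=\{x\in\Omega:x_1\le a\},\qquad F=\{x\in\Omega:b\le x_1\le c\}, \] where $(E,F)$ is regarded as an interior condenser in $\Omega$. Then \[ \operatorname{Cap}_{p,\Omega}(E,F)=\mathcal H^{n-1}(D)\,(b-a)^{1-p}=\operatorname{cap}_{p,\theta}(a,b). \]
   Context: A pair $(E,F)$ of subsets of $\Omega$ is an interior condenser in $\Omega$ if $\overline E\subset\Omega$, $\overline F\subset\Omega$ and $\overline E\cap\overline F=\varnothing$. The source asserts, immediately before the result, that the pair $(E,F)$ of the claim is an interior condenser in $\Omega$. For an interior condenser $(E,F)$ in $\Omega$, \[\operatorname{Cap}_{p,\Omega}(E,F)=\inf_{u\in\mathcal A_{E,F}(\Omega)}\int_\Omega|\nabla u(x)|^p\,\mathrm{d}x,\qquad \mathcal A_{E,F}(\Omega)=\{u\in W^{1,p}(\Omega):u\le0\text{ q.e. on }E,\ u\ge1\text{ q.e. on }F\},\] where q.e. means quasi-everywhere with respect to the Sobolev $p$-capacity. For $t\in\mathbb R$ let $\Sigma_t=\{x\in\Omega:\theta(x)=t\}$. The energy weight is \[A_{p,\theta}(t)=\int_{\Sigma_t\cap\Omega}|\nabla\theta|^{p-1}\,\mathrm{d}\mathcal H^{n-1}\] for almost every $t$, where $\mathcal H^{n-1}$ is $(n-1)$-dimensional Hausdorff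 measure; here $A_{p,\theta}(t)=\mathcal H^{n-1}(D)$ for $t\in(-L,L)$. For $v\in W^{1,1}(a,b)$ (absolutely continuous representative on $[a,b]$) set $\mathcal E_{p,\theta}(v;a,b)=\int_a^b|v'(t)|^pA_{p,\theta}(t)\,\mathrm{d}t\in[0,+\infty]$, and \[\operatorname{cap}_{p,\theta}(a,b)=\inf\{\mathcal E_{p,\theta}(v;a,b): v\in W^{1,1}(a,b),\ v(a)=0,\ v(b)=1,\ \mathcal E_{p,\theta}(v;a,b)<\infty\}.\] *)

(* Defs.v *)
(* R^n is 'rV[R]_n, with the product topology it has in the library. *)
From HB Require Import structures.
From mathcomp Require Import all_boot all_order all_algebra.
From mathcomp Require Import all_classical all_reals all_analysis.

Set Implicit Arguments.
Unset Strict Implicit.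
Unset Printing Implicit Defensive.

Import Order.TTheory GRing.Theory Num.Theory.
Import numFieldTopology.Exports numFieldNormedType.Exports.

Local Open Scope classical_set_scope.
Local Open Scope ring_scope.

(* The Borel sigma-algebra of R^n, as the product of n copies of that of R. *)
Section measurable_rV.
Context (R : realType) (n : nat).

Let coords (i : 'I_n) (x : 'rV[R]_n) : measurableTypeR R := x ord0 i.

Let rV_set0 : g_sigma_preimage coords set0.
Proof. exact: sigma_algebra0. Qed.

Let rV_setC A : g_sigma_preimage coords A -> g_sigma_preimage coords (~` A).
Proof. exact: sigma_algebraC. Qed.

Let rV_bigcup (F : (set 'rV[R]_n)^nat) :
  (forall i, g_sigma_preimage coords (F i)) ->
  g_sigma_preimage coords (\bigcup_i (F i)).
Proof. exact: sigma_algebra_bigcup. Qed.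

HB.instance Definition _ :=
  @isMeasurable.Build default_measure_display
    'rV[R]_n (g_sigma_preimage coords) rV_set0 rV_setC rV_bigcup.
End measurable_rV.

Section Euclidean_space.
Context {R : realType}.
Implicit Types n : nat.

Definition cons_rV n (z : R * 'rV[R]_n) : 'rV[R]_n.+1 :=
  \row_i (if unlift ord0 i is Some j then z.2 ord0 j else z.1).

Definition behead_rV n (x : 'rV[R]_n.+1) : 'rV[R]_n :=
  \row_j x ord0 (lift ord0 j).

Fixpoint lebesgue_rV n : set 'rV[R]_n -> \bar R :=
  match n with
  | 0 => \d_(0 : 'rV[R]_0)
  | k.+1 =>
      pushforward (@lebesgue_measure R \x @lebesgue_rV k)%E (@cons_rV k)
  end.

(* The norm of the normed module 'rV[R]_n is the maximum norm. *)
Definition enorm n (x : 'rV[R]_n) : R := Num.sqrt (\sum_i (x ord0 i) ^+ 2).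

Definition ediam n (A : set 'rV[R]_n) : \bar R :=
  ereal_sup [set (enorm (z.1 - z.2))%:E | z in A `*` A].

(* diam(A)^m, with 0^0 = 1 for nonempty A and the value 0 for empty A, so that
   m = 0 gives the counting measure. *)
Definition diam_pow (m n : nat) (A : set 'rV[R]_n) : \bar R :=
  if `[< A = set0 >] then 0%E else (ediam A ^+ m)%E.

Definition hausdorff_content (m n : nat) (delta : R) (A : set 'rV[R]_n) :
    \bar R :=
  ereal_inf [set (\sum_(0 <= k <oo) diam_pow m (C k))%E | C in
    [set C : (set 'rV[R]_n)^nat |
      A `<=` \bigcup_k C k /\ forall k, (ediam (C k) <= delta%:E)%E]].

Definition hausdorff_unnormalized (m n : nat) (A : set 'rV[R]_n) : \bar R :=
  ereal_sup [set hausdorff_content m delta A | delta in [set r : R | 0 < r]].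

(* Normalised so that the unit cube of R^m has H^m
   measure 1, i.e. so that H^m on R^m is Lebesgue measure. *)
Definition hausdorff (m n : nat) (A : set 'rV[R]_n) : \bar R :=
  (((fine (hausdorff_unnormalized m
       [set x : 'rV[R]_m | forall i, 0 <= x ord0 i <= 1]))^-1)%:E
   * hausdorff_unnormalized m A)%E.

End Euclidean_space.

Arguments lebesgue_rV {R} n A.
Arguments hausdorff {R} m {n} A.

Section Sobolev.
Context {R : realType} {n : nat}.
Implicit Types (U A E F : set 'rV[R]_n) (u : 'rV[R]_n -> R)
  (g : 'rV[R]_n -> 'rV[R]_n) (p : R).

Definition partial (i : 'I_n) u : 'rV[R]_n -> R :=
  fun x => 'D_(delta_mx ord0 i) u x.

Definition gradient u : 'rV[R]_n -> 'rV[R]_n := fun x => \row_i partial i u x.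

Definition iter_partial (s : seq 'I_n) u : 'rV[R]_n -> R := foldr partial u s.

Definition smooth u := forall s : seq 'I_n,
  continuous (iter_partial s u) /\
  forall i x, derivable (iter_partial s u) x (delta_mx ord0 i).

Definition test_function U u :=
  [/\ smooth u, compact (closure [set x | u x != 0]) &
      closure [set x | u x != 0] `<=` U].

Definition weak_gradient U u g := forall (i : 'I_n) (phi : 'rV[R]_n -> R),
  test_function U phi ->
  (\int[lebesgue_rV n]_(x in U) (u x * partial i phi x)%:E =
   - \int[lebesgue_rV n]_(x in U) (g x ord0 i * phi x)%:E)%E.

(* u belongs to W^{1,p}(U) and g represents its weak gradient.  Functions are
   Borel: every class, also every quasicontinuous one, has such a member. *)
Definition sobolev p U u g :=
  [/\ measurable_fun U u /\ measurable_fun U g,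
      (\int[lebesgue_rV n]_(x in U) (`|u x| `^ p)%:E < +oo)%E,
      (\int[lebesgue_rV n]_(x in U) (enorm (g x) `^ p)%:E < +oo)%E &
      weak_gradient U u g].

Definition sobolev_capacity p A : \bar R :=
  ereal_inf [set e | exists u g G,
    [/\ sobolev p setT u g, open G, A `<=` G,
        {ae lebesgue_rV n, forall x, G x -> 1 <= u x} &
        e = (\int[lebesgue_rV n]_x (`|u x| `^ p + enorm (g x) `^ p)%:E)%E]].

Definition quasi_everywhere p A (P : 'rV[R]_n -> Prop) :=
  sobolev_capacity p (A `&` [set x | ~ P x]) = 0%E.

Definition quasicontinuous p U u := forall eps : R, 0 < eps ->
  exists G, [/\ open G, (sobolev_capacity p G < eps%:E)%E &
    {within U `\` G, continuous u}].

(* Pointwise conditions q.e. refer to the quasicontinuous representative. *)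
Definition admissible p U E F u g :=
  [/\ sobolev p U u g, quasicontinuous p U u,
      quasi_everywhere p E (fun x => u x <= 0) &
      quasi_everywhere p F (fun x => 1 <= u x)].

(* Defined for all pairs (E, F); that the closures of E and F are disjoint
   subsets of U is not part of the definition. *)
Definition condenser_capacity p U E F : \bar R :=
  ereal_inf [set e | exists u g, admissible p U E F u g /\
    e = (\int[lebesgue_rV n]_(x in U) (enorm (g x) `^ p)%:E)%E].

End Sobolev.

Section one_dimensional.
Context {R : realType}.
Implicit Types (a b p : R) (v w phi : R -> R).
Local Notation mu := (@lebesgue_measure R).

Definition absolutely_continuous a b v := forall eps : R, 0 < eps ->
  exists2 delta : R, 0 < delta &
    forall (k : nat) (s t : 'I_k -> R),
      (forall i, a <= s i /\ s i <= t i /\ t i <= b) ->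
      trivIset setT (fun i => `]s i, t i[%classic) ->
      \sum_i (t i - s i) < delta -> \sum_i `|v (t i) - v (s i)| < eps.

Definition test_function1 a b phi :=
  [/\ forall k x, derivable (derive1n k phi) x 1,
      compact (closure [set x | phi x != 0]) &
      closure [set x | phi x != 0] `<=` `]a, b[].

(* v belongs to W^{1,1}(a,b) and w represents its weak derivative *)
Definition sobolev11 a b v w :=
  [/\ mu.-integrable `]a, b[ (EFin \o v), mu.-integrable `]a, b[ (EFin \o w) &
      forall phi, test_function1 a b phi ->
        (\int[mu]_(t in `]a, b[) (v t * derive1 phi t)%:E =
         - \int[mu]_(t in `]a, b[) (w t * phi t)%:E)%E].

End one_dimensional.

Section energy.
Context {R : realType} {n : nat}.
Implicit Types (U : set 'rV[R]_n.+1) (theta : 'rV[R]_n.+1 -> R) (p a b t : R).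

Definition level_set U theta t := [set x | U x /\ theta x = t].

(* The ambient dimension is n.+1, so the measure is H^n. *)
Definition energy_weight p U theta t : \bar R :=
  (\int[@hausdorff R n n.+1]_(x in level_set U theta t)
     (enorm (gradient theta x) `^ (p - 1))%:E)%E.

(* w is the weak derivative of the competitor v. *)
Definition weighted_energy p U theta a b (w : R -> R) : \bar R :=
  (\int[@lebesgue_measure R]_(t in `]a, b[)
     ((`|w t| `^ p)%:E * energy_weight p U theta t))%E.

Definition weighted_capacity p U theta a b : \bar R :=
  ereal_inf [set e | exists v w : R -> R,
    [/\ sobolev11 a b v w, absolutely_continuous a b v, v a = 0 /\ v b = 1,
        (weighted_energy p U theta a b w < +oo)%E &
        e = weighted_energy p U theta a b w]].

Definition cylinder (L : R) (D : set 'rV[R]_n) : set 'rV[R]_n.+1 :=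
  [set x : 'rV[R]_n.+1 | - L < x ord0 ord0 < L /\ D (behead_rV x)].

End energy.

(* Main.v *)
(* Put [l = b - a].  The upper bound is the energy of the ramp [(x_1 - a) / l]
   clipped to [[0, 1]].  For the lower bound, convexity gives
   [|s|^p >= p k^(p-1) s - (p-1) k^p], used with [k = 1 / l] and integrated
   against a test function [psi(x_1) eta(x')], where [psi] is a plateau over
   [[a, b]] and [eta] a plateau over a cube [Q] of [D].  Conditions that hold
   quasi-everywhere hold almost everywhere, so a competitor with weak gradient
   [g] satisfies [- \int u psi' eta >= \int eta], that is,
   [\int g_1 psi eta >= \int eta].  Sharpening the plateaus yields at least
   [|Q| l^(1-p)] for the energy above [Q], and disjoint dyadic cubes exhaust [D].
   The same inequality in one variable computes the weighted capacity.  Hausdorff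
   measure is additive on Borel sets and scales like volume, hence agrees with
   Lebesgue measure on cubes and on open sets once the unit cube is known to have
   finite positive content; projecting the slices of the cylinder onto [D] is an
   isometry. *)
Require Import Defs.
From HB Require Import structures.
From mathcomp Require Import all_boot all_order all_algebra.
From mathcomp Require Import all_classical all_reals all_analysis.
From mathcomp Require Import measurable_realfun ring lra.

Set Implicit Arguments.
Unset Strict Implicit.
Unset Printing Implicit Defensive.

Import Order.TTheory GRing.Theory Num.Theory.
Import numFieldTopology.Exports numFieldNormedType.Exports.

Local Open Scope classical_set_scope.
Local Open Scope ring_scope.

(** * Lebesgue measure on row vectors *)

Section sigma_finite_copy.
Context d (T : measurableType d) (R : realType) (m : {measure set T -> \bar R}).
Hypothesis sf : sigma_finite setT m.

Definition sigma_finite_copy : set T -> \bar R := let _ := sf in m.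

HB.instance Definition _ := Measure.copy sigma_finite_copy m.
HB.instance Definition _ :=
  @Measure_isSigmaFinite.Build _ _ _ sigma_finite_copy sf.

End sigma_finite_copy.

Section row_vectors.
Context {R : realType}.
Implicit Types n : nat.

Lemma measurable_coord n (i : 'I_n) :
  measurable_fun [set: 'rV[R]_n] (fun x => x ord0 i).
Proof.
move=> _ Y mY; rewrite setTI; apply: sub_sigma_algebra.
rewrite -bigcup_seq/=; exists i; first by rewrite /= mem_index_enum.
by exists Y => //; rewrite setTI.
Qed.

Lemma measurable_fun_rV d (T : measurableType d) (D : set T) n
    (f : T -> 'rV[R]_n) :
  (forall i, measurable_fun D (fun x => f x ord0 i)) -> measurable_fun D f.
Proof.
move=> mf mD; apply: (@measurability _ _ _ _ _ _ (\big[setU/set0]_(i < n)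
  preimage_set_system setT (fun x : 'rV[R]_n => x ord0 i : measurableTypeR R)
    measurable)) => //.
move=> _ [A + <-].
rewrite -bigcup_seq/= => -[i _ [B mB <-]]; rewrite setTI.
exact: mf.
Qed.

Lemma cons_rV0 n (z : R * 'rV[R]_n) : cons_rV z ord0 ord0 = z.1.
Proof. by rewrite mxE unlift_none. Qed.

Lemma cons_rVS n (z : R * 'rV[R]_n) j : cons_rV z ord0 (lift ord0 j) = z.2 ord0 j.
Proof. by rewrite mxE liftK. Qed.

Lemma behead_cons_rV n (z : R * 'rV[R]_n) : behead_rV (cons_rV z) = z.2.
Proof. by apply/rowP => j; rewrite mxE cons_rVS. Qed.

Lemma cons_behead_rV n (x : 'rV[R]_n.+1) : cons_rV (x ord0 ord0, behead_rV x) = x.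
Proof. by apply/rowP => i; rewrite mxE; case: unliftP => [j|] -> //=; rewrite mxE. Qed.

Lemma measurable_cons_rV n :
  measurable_fun [set: measurableTypeR R * 'rV[R]_n] (@cons_rV R n).
Proof.
apply: measurable_fun_rV => i.
case: (unliftP ord0 i) => [j|] ->.
  rewrite (_ : (fun _ => _) = (fun x : 'rV[R]_n => x ord0 j) \o snd).
    by apply: measurableT_comp => //; exact: measurable_coord.
  by apply/funext => z /=; rewrite cons_rVS.
rewrite (_ : (fun _ => _) = fst) //.
by apply/funext => z /=; rewrite cons_rV0.
Qed.

Lemma measurable_behead_rV n : measurable_fun setT (@behead_rV R n).
Proof.
apply: measurable_fun_rV => i; under eq_fun do rewrite mxE.
exact: measurable_coord.
Qed.

Definition box n (S : 'I_n -> set R) : set 'rV[R]_n :=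
  [set x | forall i, S i (x ord0 i)].

Lemma measurable_box n (S : 'I_n -> set R) :
  (forall i, measurable (S i)) -> measurable (box S).
Proof.
move=> mS; rewrite (_ : box S =
    \bigcap_(i in [set: 'I_n]) ((fun x : 'rV[R]_n => x ord0 i) @^-1` S i)).
  apply: fin_bigcap_measurable => // i _; rewrite -[X in measurable X]setTI.
  exact: measurable_coord.
by apply/seteqP; split => x /= H i => [_|]; exact: H.
Qed.

Lemma preimage_cons_box n (S : 'I_n.+1 -> set R) :
  @cons_rV R n @^-1` box S = S ord0 `*` box (fun i => S (lift ord0 i)).
Proof.
apply/seteqP; split => [z /= H|z [/= H0 H1] i].
  split => [|j]; first by have := H ord0; rewrite cons_rV0.
  by have := H (lift ord0 j); rewrite cons_rVS.
by case: (unliftP ord0 i) => [j|] ->; rewrite ?cons_rV0 ?cons_rVS.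
Qed.

Local Open Scope ereal_scope.

Lemma lebesgue_rV_exists n :
  exists m : {sigma_finite_measure set 'rV[R]_n -> \bar R},
    (m : set _ -> _) = lebesgue_rV n /\
    (forall (S : 'I_n -> set R) (l : 'I_n -> R), (forall i, measurable (S i)) ->
      (forall i, (@lebesgue_measure R (S i)) = (l i)%:E) ->
      m (box S) = (\prod_(i < n) l i)%:E).
Proof.
elim: n => [|n [m [mE mbox]]].
  exists (@dirac _ 'rV[R]_0 0%R R); split => // S l mS _.
  rewrite big_ord0 /= diracE mem_set//.
  by case.
pose mu : {sigma_finite_measure set (measurableTypeR R) -> \bar R} :=
  @lebesgue_measure R.
pose P := [the {measure set _ -> \bar R} of (mu \x m)].
pose Q := pushforward P (@cons_rV R n).
have Qbox (S : 'I_n.+1 -> set R) (l : 'I_n.+1 -> R) :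
    (forall i, measurable (S i)) ->
    (forall i, (@lebesgue_measure R (S i)) = (l i)%:E) ->
    Q (box S) = (\prod_(i < n.+1) l i)%:E.
  move=> mS Sl; rewrite /Q /pushforward preimage_cons_box.
  rewrite /P/= product_measure1E//; last exact: measurable_box.
  rewrite (mbox _ (fun i => l (lift ord0 i)))// [X in X * _](Sl ord0).
    by rewrite big_ord_recl EFinM.
  exact: mS.
pose Q1 : {measure set 'rV[R]_n.+1 -> \bar R} :=
  measure_function_pushforward__canonical__measure_function_Measure P (@measurable_cons_rV n).
have Qsf : sigma_finite setT Q1.
  exists (fun k => box (fun _ : 'I_n.+1 => `[(- k%:R)%R, k%:R%R]%classic)).
    apply/esym/seteqP; split => // x _.
    exists (Num.bound `|x|%R) => //= i; rewrite /= in_itv/= -ler_norml.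
    apply: le_trans (ltW (archi_boundP _)) => //.
    rewrite [leRHS]mx_normrE.
    exact: (le_bigmax _ (fun ij => `|x ij.1 ij.2|%R) (ord0, i)).
  move=> k; split.
    by apply: measurable_box => i; exact: measurable_itv.
  rewrite [X in (X < _)%E](Qbox _ (fun=> (k%:R - - k%:R)%R)) ?ltry// => i.
  rewrite lebesgue_measure_itv/= lte_fin; case: ltP => // kk.
  by congr _%:E; have := ler0n R k; lra.
exists (sigma_finite_copy Qsf); split => //=.
by rewrite /sigma_finite_copy /Q1/= /P/= mE.
Qed.

End row_vectors.
Section lebesgue_rV_measure.
Context {R : realType}.
Local Open Scope ereal_scope.

Section instance.
Variable n : nat.
Local Notation mu := (@lebesgue_rV R n).

Let mu0 : mu set0 = 0.
Proof. by have [m [<- _]] := @lebesgue_rV_exists R n; rewrite measure0. Qed.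

Let mu_ge0 A : 0 <= mu A.
Proof. by have [m [<- _]] := @lebesgue_rV_exists R n; rewrite measure_ge0. Qed.

Let mu_sigma_additive : semi_sigma_additive mu.
Proof.
have [m [<- _]] := @lebesgue_rV_exists R n.
exact: measure_semi_sigma_additive.
Qed.

HB.instance Definition _ := isMeasure.Build _ _ _ mu mu0 mu_ge0 mu_sigma_additive.

Let mu_sigma_finite : sigma_finite setT mu.
Proof.
by have [m [<- _]] := @lebesgue_rV_exists R n; exact: sigma_finiteT.
Qed.

HB.instance Definition _ := @Measure_isSigmaFinite.Build _ _ _ mu mu_sigma_finite.

End instance.

Lemma lebesgue_rV_box n (S : 'I_n -> set R) (l : 'I_n -> R) :
  (forall i, measurable (S i)) ->
  (forall i, (@lebesgue_measure R (S i)) = (l i)%:E) ->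
  lebesgue_rV n (box S) = (\prod_(i < n) l i)%:E.
Proof. by have [m [<- h]] := @lebesgue_rV_exists R n; exact: h. Qed.

Lemma integrable_cons_rV n (f : 'rV[R]_n.+1 -> \bar R) :
  (lebesgue_rV n.+1).-integrable setT f ->
  (@lebesgue_measure R \x @lebesgue_rV R n).-integrable setT (f \o @cons_rV R n).
Proof.
move=> /integrableP[mf fi]; apply/integrableP; split.
  apply: measurableT_comp => //; exact: measurable_cons_rV.
move: fi; rewrite /= ge0_integral_pushforward//=; last 2 first.
  exact: measurable_cons_rV.
  exact: measurableT_comp.
Qed.

Lemma integral_rVS n (f : 'rV[R]_n.+1 -> \bar R) :
  (lebesgue_rV n.+1).-integrable setT f ->
  \int[lebesgue_rV n.+1]_x f x =
  \int[@lebesgue_measure R]_t \int[lebesgue_rV n]_y f (cons_rV (t, y)).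
Proof.
move=> fi; have fc := integrable_cons_rV fi.
have /integrableP[mf _] := fi.
rewrite /= integral_pushforward//=; last exact: measurable_cons_rV.
by rewrite preimage_setT -integral12_prod_meas1.
Qed.

Lemma integral_rVS_swap n (f : 'rV[R]_n.+1 -> \bar R) :
  (lebesgue_rV n.+1).-integrable setT f ->
  \int[lebesgue_rV n.+1]_x f x =
  \int[lebesgue_rV n]_y \int[@lebesgue_measure R]_t f (cons_rV (t, y)).
Proof.
move=> fi; have fc := integrable_cons_rV fi.
have /integrableP[mf _] := fi.
rewrite /= integral_pushforward//=; last exact: measurable_cons_rV.
by rewrite preimage_setT -integral21_prod_meas1.
Qed.

End lebesgue_rV_measure.

(** * Dyadic cubes *)

Section dyadic.
Context {R : realType} {n : nat}.
Implicit Types (x y c : 'rV[R]_n) (D : set 'rV[R]_n).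

Definition cube c (r : R) : set 'rV[R]_n :=
  box (fun i => `[c ord0 i, c ord0 i + r[%classic).

Lemma measurable_cube c r : measurable (cube c r).
Proof. by apply: measurable_box => i; exact: measurable_itv. Qed.

Definition dyadic_index k x : 'rV[int]_n := \row_i Num.floor (2 ^+ k * x ord0 i).

Definition dyadic_cube k (z : 'rV[int]_n) : set 'rV[R]_n :=
  [set x | dyadic_index k x = z].

Lemma dyadic_cubeE k z :
  dyadic_cube k z = cube (\row_i ((z ord0 i)%:~R / 2 ^+ k)) (2 ^- k).
Proof.
have k0 : (0 : R) < 2 ^+ k by rewrite exprn_gt0.
have H x i : (((z ord0 i)%:~R / 2 ^+ k <= x ord0 i) &&
    (x ord0 i < (z ord0 i)%:~R / 2 ^+ k + 2 ^- k)) =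
    (Num.floor (2 ^+ k * x ord0 i) == z ord0 i).
  rewrite -[X in _ + X]mul1r -mulrDl ler_pdivrMr// ltr_pdivlMr//.
  by rewrite ![x ord0 i * _]mulrC floor_eq // intrD1.
apply/seteqP; split => x /= xz.
  by move=> i /=; rewrite in_itv/= mxE H -xz mxE.
apply/rowP => i; have := xz i; rewrite /= in_itv/= !mxE H.
by move/eqP.
Qed.

Lemma dyadic_index_pred k x y :
  dyadic_index k.+1 x = dyadic_index k.+1 y -> dyadic_index k x = dyadic_index k y.
Proof.
move=> /rowP xy; apply/rowP => i; have := xy i; rewrite !mxE !exprS -!mulrA.
move: (2 ^+ k * x ord0 i) (2 ^+ k * y ord0 i) => s t st.
have le_floor (u v : R) : Num.floor (2 * u) = Num.floor (2 * v) ->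
    (Num.floor u <= Num.floor v)%R.
  move=> uv; rewrite floor_ge_int.
  have : ((Num.floor u * 2)%:~R : R) <= 2 * v.
    rewrite -floor_ge_int -uv floor_ge_int.
    by rewrite intrM mulrC ler_pM2l//; exact: floor_le.
  by rewrite intrM mulrC ler_pM2l.
by apply/eqP; rewrite eq_le !le_floor.
Qed.

Lemma dyadic_index_le j k x y : (j <= k)%N ->
  dyadic_index k x = dyadic_index k y -> dyadic_index j x = dyadic_index j y.
Proof.
move=> /subnKC <-; elim: (k - j)%N => [|m ih]; first by rewrite addn0.
by rewrite addnS => /dyadic_index_pred.
Qed.

Lemma dyadic_cube_sub D x : open D -> D x ->
  exists k, dyadic_cube k (dyadic_index k x) `<=` D.
Proof.
move=> oD Dx; have /nbhs_ballP[e /= e0 eD] : nbhs x D by exact: open_nbhs_nbhs.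
have [k ke] : exists k, 2 ^- k < e.
  have [k _ /(_ _ (leqnn k))] := near_infty_natSinv_expn_lt (PosNum e0).
  by move=> /= ke; exists k; rewrite div1r in ke.
exists k => y /= /rowP yx; apply: eD; split => // i0 i; rewrite (ord1 i0).
have k0 : (0 : R) < 2 ^+ k by rewrite exprn_gt0.
apply: lt_trans ke; rewrite -[ltRHS]mul1r ltr_pdivlMr// -[X in _ * X]gtr0_norm//.
rewrite -normrM mulrBl.
have := yx i; rewrite !mxE ![2 ^+ k * _]mulrC => yxi.
have /andP[] := floor_itv (x ord0 i * 2 ^+ k).
have /andP[] := floor_itv (y ord0 i * 2 ^+ k).
rewrite yxi !intrD => a1 a2 a3 a4.
by rewrite ltr_norml; apply/andP; split; lra.
Qed.

(* The maximal dyadic cubes contained in [D]. *)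
Lemma open_dyadic_partition D : open D -> exists A : nat -> set 'rV[R]_n,
  [/\ trivIset setT A, D = \bigcup_m A m &
      forall m, A m = set0 \/ exists c r, 0 < r /\ A m = cube c r].
Proof.
move=> oD.
pose P k x := dyadic_cube k (dyadic_index k x) `<=` D.
pose B (q : nat * 'rV[int]_n) := [set x | [/\ dyadic_index q.1 x = q.2,
  P q.1 x & forall j, (j < q.1)%N -> ~ P j x]].
have BD q x : B q x -> D x by case=> _ + _; exact.
have Binj q q' x : B q x -> B q' x -> q = q'.
  case: q q' => [k z] [k' z'] [/= xz Pk nk] [/= xz' Pk' nk'].
  case: (ltngtP k k') => [kk|kk|kk]; [by have := nk' _ kk | by have := nk _ kk|].
  by move: xz xz'; rewrite kk => -> ->.
exists (fun m => if pickle_inv m is Some q then B q else set0); split.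
- apply/trivIsetP => i j _ _ ij; apply/seteqP; split => // x [].
  case ei: (pickle_inv i) => [q|//] Bq; case ej: (pickle_inv j) => [q'|//] Bq'.
  move/eqP: ij; apply.
  have := @pickle_invK (nat * 'rV[int]_n)%type i; rewrite ei /= => <-.
  have := @pickle_invK (nat * 'rV[int]_n)%type j; rewrite ej /= => <-.
  by rewrite (Binj _ _ _ Bq Bq').
- apply/seteqP; split => x; last by case=> m _; case: pickle_inv => // q /BD.
  move=> Dx; have [k0 Pk0] := dyadic_cube_sub oD Dx.
  have exP : exists k, `[< P k x >] by exists k0; exact/asboolP.
  case: (ex_minnP exP) => k /asboolP Pk kmin.
  exists (pickle (k, dyadic_index k x)) => //; rewrite pickleK_inv; split => //=.
  by move=> j jk /asboolP /kmin; rewrite leqNgt jk.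
- move=> m; case: pickle_inv => [[k z]|]; last by left.
  have [->|/set0P[x [/= xz Pk nk]]] := eqVneq (B (k, z)) set0; first by left.
  right; exists (\row_i ((z ord0 i)%:~R / 2 ^+ k)), (2 ^- k); split.
    by rewrite invr_gt0 exprn_gt0.
  rewrite -dyadic_cubeE; apply/seteqP; split => [y []//|y /= yz].
  have yx : dyadic_index k y = dyadic_index k x by rewrite yz xz.
  split => //=; first by rewrite /P yx.
  move=> j jk; rewrite /P (dyadic_index_le (ltnW jk) yx); exact: nk.
Qed.

Lemma open_measurable_rV D : open D -> measurable D.
Proof.
move=> /open_dyadic_partition[A [_ -> Ac]]; apply: bigcupT_measurable => m.
by have [->|[c [r [_ ->]]]] := Ac m; [exact: measurable0|exact: measurable_cube].
Qed.

Local Open Scope ereal_scope.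

Lemma le_measure_cubes (m1 m2 : {measure set 'rV[R]_n -> \bar R}) D : open D ->
  (forall c r, (0 < r)%R -> cube c r `<=` D -> m1 (cube c r) <= m2 (cube c r)) ->
  m1 D <= m2 D.
Proof.
move=> /open_dyadic_partition[A [tA DE Ac]] m12.
have mA m : measurable (A m).
  by have [->|[c [r [_ ->]]]] := Ac m; [exact: measurable0|exact: measurable_cube].
rewrite DE !measure_bigcup//; apply: lee_nneseries => // m _.
have [->|[c [r [r0 Ecr]]]] := Ac m; first by rewrite !measure0.
by rewrite Ecr m12// -Ecr DE; exact: bigcup_sup.
Qed.

Lemma continuous_measurable_rV (f : 'rV[R]_n -> R) :
  continuous f -> measurable_fun setT f.
Proof.
move=> /continuousP cf; apply: (measurability _ (RGenOpens.measurableE R)).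
move=> _ [_ [a [b ->]] <-]; rewrite setTI; apply: open_measurable_rV.
exact/cf/interval_open.
Qed.

End dyadic.

(** * Hausdorff measure *)

Section Euclidean_norm.
Context {R : realType}.
Implicit Types n : nat.

Lemma enorm_ge0 n (x : 'rV[R]_n) : 0 <= enorm x.
Proof. exact: sqrtr_ge0. Qed.

Lemma enorm0 n : enorm (0 : 'rV[R]_n) = 0.
Proof.
rewrite /enorm big1 ?sqrtr0// => i _.
by rewrite mxE expr0n.
Qed.

Lemma ler_enorm n (x : 'rV[R]_n) (r : R) :
  0 <= r -> (enorm x <= r) = (\sum_i x ord0 i ^+ 2 <= r ^+ 2).
Proof.
move=> r0; rewrite /enorm -[X in _ <= X]ger0_norm// -sqrtr_sqr ler_sqrt//.
by rewrite sqr_ge0.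
Qed.

Lemma coord_le_enorm n (x : 'rV[R]_n) i : `|x ord0 i| <= enorm x.
Proof.
rewrite -sqrtr_sqr /enorm ler_sqrt ?sumr_ge0//; last by move=> j _; exact: sqr_ge0.
by rewrite (bigD1 i)//= lerDl sumr_ge0// => j _; exact: sqr_ge0.
Qed.

Lemma enorm_le_cube n (x : 'rV[R]_n) (r : R) :
  0 <= r -> (forall i, `|x ord0 i| <= r) -> enorm x <= n%:R * r.
Proof.
move=> r0 xr; rewrite ler_enorm ?mulr_ge0//.
apply: (@le_trans _ _ (\sum_(i < n) r ^+ 2)).
  apply: ler_sum => i _; rewrite -real_normK ?num_real//.
  by rewrite lerXn2r ?nnegrE//; exact: xr.
rewrite sumr_const card_ord exprMn -[leLHS]mulr_natl ler_wpM2r ?sqr_ge0//.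
rewrite -natrX ler_nat; case: n {x xr} => // n.
by rewrite -[leqLHS]expn1 leq_pexp2l.
Qed.

Lemma enormZ n (r : R) (x : 'rV[R]_n) : enorm (r *: x) = `|r| * enorm x.
Proof.
rewrite /enorm -sqrtr_sqr -sqrtrM ?sqr_ge0//; congr Num.sqrt.
by rewrite mulr_sumr; apply: eq_bigr => i _; rewrite mxE exprMn.
Qed.

Lemma enorm_behead n (x y : 'rV[R]_n.+1) :
  enorm (behead_rV x - behead_rV y) <= enorm (x - y).
Proof.
rewrite /enorm ler_sqrt ?sumr_ge0//; last by move=> j _; exact: sqr_ge0.
rewrite [leRHS]big_ord_recl -[leLHS]add0r lerD ?sqr_ge0//.
by apply: ler_sum => i _; rewrite !mxE.
Qed.

Lemma enorm_cons n t (x y : 'rV[R]_n) :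
  enorm (cons_rV (t, x) - cons_rV (t, y)) = enorm (x - y).
Proof.
rewrite /enorm big_ord_recl !mxE !unlift_none/= subrr expr0n/= add0r.
by congr Num.sqrt; apply: eq_bigr => i _; rewrite !mxE !liftK.
Qed.

End Euclidean_norm.

Section diameter.
Context {R : realType} {n : nat}.
Implicit Types (A B C : set 'rV[R]_n) (r delta : R).
Local Open Scope ereal_scope.

Lemma ediam_leP A (e : \bar R) :
  (ediam A <= e) <-> (forall x y, A x -> A y -> (enorm (x - y)%R)%:E <= e).
Proof.
split=> [Ae x y Ax Ay|H].
  by apply: le_trans Ae; apply: ereal_sup_ubound; exists (x, y).
by apply: ge_ereal_sup => _ [[x y] [/= Ax Ay] <-]; exact: H.
Qed.

Lemma le_ediam A B : A `<=` B -> ediam A <= ediam B.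
Proof.
move=> AB; apply/ediam_leP => x y /AB Bx /AB By.
by move: x y Bx By; apply/ediam_leP.
Qed.

Lemma ediam_fin A delta x : ediam A <= delta%:E -> A x ->
  exists r, [/\ (0 <= r)%R, (r <= delta)%R & ediam A = r%:E].
Proof.
move=> Ad Ax; have A0 : 0 <= ediam A.
  by have /ediam_leP/(_ x x Ax Ax) := lexx (ediam A); rewrite subrr enorm0.
by case: (ediam A) A0 Ad => // r r0 rd; exists r.
Qed.

Lemma diam_pow0 m : diam_pow m (set0 : set 'rV[R]_n) = 0.
Proof. by rewrite /diam_pow; case: asboolP. Qed.

Lemma diam_powE m A delta : ediam A <= delta%:E -> A !=set0 ->
  exists r, [/\ (0 <= r)%R, (r <= delta)%R, ediam A = r%:E &
    diam_pow m A = (r ^+ m)%:E].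
Proof.
move=> Ad [x Ax]; have [r [r0 rd Ar]] := ediam_fin Ad Ax.
exists r; split => //; rewrite /diam_pow; case: asboolP => [A0|_].
  by rewrite A0 in Ax.
by rewrite Ar EFin_expe.
Qed.

Lemma diam_pow_ge0 m A : 0 <= diam_pow m A.
Proof.
rewrite /diam_pow; case: asboolP => // /eqP/set0P[x Ax].
apply: expe_ge0; have /ediam_leP/(_ x x Ax Ax) := lexx (ediam A).
by rewrite subrr enorm0.
Qed.

Lemma le_diam_pow m A B delta : ediam B <= delta%:E -> A `<=` B ->
  diam_pow m A <= diam_pow m B.
Proof.
move=> Bd AB; have [->|/set0P A0] := eqVneq A set0.
  by rewrite diam_pow0 diam_pow_ge0.
have [s [s0 _ Bs ->]] : exists s, [/\ (0 <= s)%R, (s <= delta)%R,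
    ediam B = s%:E & diam_pow m B = (s ^+ m)%:E].
  by apply: diam_powE => //; case: A0 => x /AB; exists x.
have [|r [r0 rs _ ->]] := @diam_powE m A s _ A0.
  by rewrite -Bs; exact: le_ediam.
by rewrite lee_fin lerXn2r.
Qed.

End diameter.
Section Hausdorff_content.
Context {R : realType} {m n : nat}.
Implicit Types (A B C : set 'rV[R]_n) (delta : R).
Local Open Scope ereal_scope.

Lemma hausdorff_content_ge0 delta A : 0 <= hausdorff_content m delta A.
Proof.
apply: le_ereal_inf_tmp => _ [C _ <-]; apply: nneseries_ge0 => k _ _.
exact: diam_pow_ge0.
Qed.

Lemma le_hausdorff_content delta A B : A `<=` B ->
  hausdorff_content m delta A <= hausdorff_content m delta B.
Proof.
move=> AB; apply: ereal_inf_le_tmp => _ [C [BC Cd] <-]; exists C => //; split=> //.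
exact: subset_trans BC.
Qed.

Lemma hausdorff_content_scale delta delta' A : (delta <= delta')%R ->
  hausdorff_content m delta' A <= hausdorff_content m delta A.
Proof.
move=> dd; apply: ereal_inf_le_tmp => _ [C [AC Cd] <-]; exists C => //; split=> // k.
by apply: le_trans (Cd k) _; rewrite lee_fin.
Qed.

Let gauge delta C : \bar R := if ediam C <= delta%:E then diam_pow m C else +oo.

(* The content is the outer measure induced by [gauge] when every set is
   regarded as measurable, which gives its countable subadditivity. *)
Let content_mu_ext delta A :
  hausdorff_content m delta A =
  @mu_ext _ (g_sigma_algebraType [set: set 'rV[R]_n]) R (gauge delta) A.
Proof.
apply/eqP; rewrite eq_le; apply/andP; split; apply: le_ereal_inf_tmp.
- move=> _ [C [_ AC] <-].
  have [[k Ck]|Cd] := pselect (exists k, ~~ (ediam (C k) <= delta%:E)).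
    rewrite (@eseries_pinfty _ _ _ k) ?leey//.
      by move=> i _; rewrite /gauge; case: ifP => // _; rewrite gt_eqF//
        (lt_le_trans _ (diam_pow_ge0 _ _)).
    by rewrite /gauge (negbTE Ck).
  have {}Cd k : ediam (C k) <= delta%:E by apply/negPn/negP => h; apply: Cd; exists k.
  apply: ereal_inf_lbound; exists C => //.
  by apply: eq_eseriesr => k _; rewrite /gauge Cd.
- move=> _ [C [AC Cd] <-]; apply: ereal_inf_lbound; exists C.
    split=> // i; exact: sub_sigma_algebra.
  by apply: eq_eseriesr => k _; rewrite /gauge Cd.
Qed.

Let gauge_ge0 delta C : 0 <= gauge delta C.
Proof. by rewrite /gauge; case: ifP => // _; exact: diam_pow_ge0. Qed.

Lemma hausdorff_content_sigma_subadditive delta :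
  sigma_subadditive (hausdorff_content m delta : set 'rV[R]_n -> _).
Proof.
move=> F; rewrite content_mu_ext.
under eq_eseriesr do rewrite content_mu_ext.
exact: mu_ext_sigma_subadditive.
Qed.

Lemma hausdorff_content_le_diam_pow delta C : (0 <= delta)%R ->
  ediam C <= delta%:E -> hausdorff_content m delta C <= diam_pow m C.
Proof.
move=> d0 Cd; apply: ereal_inf_lbound; exists (fun k => if k == 0%N then C else set0).
  split => [x Cx|[|k]//]; first by exists 0%N.
  by apply/ediam_leP.
rewrite (nneseries_split 0 1); last by move=> k _; exact: diam_pow_ge0.
rewrite big_nat1/= [X in _ + X]eseries0 ?adde0// => -[|k] // _ _.
by rewrite diam_pow0.
Qed.

Lemma hausdorff_content0 delta : (0 <= delta)%R ->
  hausdorff_content m delta (set0 : set 'rV[R]_n) = 0.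
Proof.
move=> d0; apply/eqP; rewrite eq_le hausdorff_content_ge0 andbT.
rewrite -(diam_pow0 (R := R) (n := n) m).
by apply: hausdorff_content_le_diam_pow => //; apply/ediam_leP.
Qed.

(* A set of diameter less than [q' - q] meets at most one of the half-spaces. *)
Lemma hausdorff_content_separated (i : 'I_n) (q q' delta : R) A B :
  (delta < q' - q)%R ->
  A `<=` [set x | x ord0 i <= q]%R -> B `<=` [set x | q' <= x ord0 i]%R ->
  hausdorff_content m delta A + hausdorff_content m delta B <=
  hausdorff_content m delta (A `|` B).
Proof.
move=> dq Aq Bq; apply: le_ereal_inf_tmp => _ [C [ABC Cd] <-].
pose CA k := C k `&` [set x | x ord0 i <= q]%R.
pose CB k := C k `&` [set x | q' <= x ord0 i]%R.
have CAC k : CA k `<=` C k by move=> x [].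
have CBC k : CB k `<=` C k by move=> x [].
apply: (@le_trans _ _ (\sum_(0 <= k <oo) (diam_pow m (CA k) + diam_pow m (CB k)))).
  rewrite nneseriesD//; [|by move=> *; exact: diam_pow_ge0..].
  apply: leeD; apply: ereal_inf_lbound.
    exists CA => //; split=> [x Ax|k]; last exact: le_trans (le_ediam (CAC k)) (Cd k).
    have [k _ Ckx] := ABC x (or_introl Ax).
    by exists k => //; split => //; exact: Aq.
  exists CB => //; split=> [x Bx|k]; last exact: le_trans (le_ediam (CBC k)) (Cd k).
  have [k _ Ckx] := ABC x (or_intror Bx).
  by exists k => //; split => //; exact: Bq.
apply: lee_nneseries => k _; first by rewrite adde_ge0 ?diam_pow_ge0.
have [->|/set0P[x [Cx xq]]] := eqVneq (CA k) set0.
  by rewrite diam_pow0 add0e (le_diam_pow _ (Cd k)).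
rewrite (_ : CB k = set0) ?diam_pow0 ?adde0 ?(le_diam_pow _ (Cd k))//.
apply/seteqP; split => // y [Cy yq].
have := Cd k => /ediam_leP/(_ y x Cy Cx); rewrite lee_fin.
apply/negP; rewrite -ltNge; apply: lt_le_trans dq _.
apply: le_trans (coord_le_enorm _ i); rewrite !mxE.
apply: le_trans (ler_norm _); rewrite /= in xq yq; lra.
Qed.

End Hausdorff_content.

Section Hausdorff_outer_measure.
Context {R : realType} {m n : nat}.
Implicit Types (A B C : set 'rV[R]_n) (delta : R).
Local Open Scope ereal_scope.
Local Notation H := (@hausdorff_unnormalized R m n).

Lemma hausdorff_content_le delta A : (0 < delta)%R ->
  hausdorff_content m delta A <= H A.
Proof. by move=> d0; apply: ereal_sup_ubound; exists delta. Qed.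

Lemma hausdorff_unnormalized_leP A (e : \bar R) :
  (forall delta, (0 < delta)%R -> hausdorff_content m delta A <= e) -> H A <= e.
Proof. by move=> Ae; apply: ge_ereal_sup => _ [delta d0 <-]; exact: Ae. Qed.

Let H_ge0 A : 0 <= H A.
Proof. exact: le_trans (hausdorff_content_ge0 1 A) (hausdorff_content_le _ _). Qed.

Let H0 : H set0 = 0.
Proof.
apply/eqP; rewrite eq_le H_ge0 andbT; apply: hausdorff_unnormalized_leP => d d0.
by rewrite hausdorff_content0// ltW.
Qed.

Let H_subadditive A (F : (set 'rV[R]_n)^nat) : subset_sigma_subadditive H A F.
Proof.
move=> AF; apply: hausdorff_unnormalized_leP => d d0.
apply: le_trans (le_hausdorff_content d AF) _.
apply: le_trans (hausdorff_content_sigma_subadditive d F) _.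
apply: lee_nneseries => k _; first by rewrite hausdorff_content_ge0.
exact: hausdorff_content_le.
Qed.

HB.instance Definition _ := isSubsetOuterMeasure.Build R _ H H0 H_ge0 H_subadditive.

Lemma hausdorff_unnormalized_separated (i : 'I_n) (q q' : R) A B : (q < q')%R ->
  A `<=` [set x | x ord0 i <= q]%R -> B `<=` [set x | q' <= x ord0 i]%R ->
  H A + H B <= H (A `|` B).
Proof.
move=> qq Aq Bq.
have key (d1 d2 : R) : (0 < d1)%R -> (0 < d2)%R ->
    hausdorff_content m d1 A + hausdorff_content m d2 B <= H (A `|` B).
  move=> d10 d20; pose d := Num.min d1 (Num.min d2 ((q' - q) / 2)%R).
  have d0 : (0 < d)%R by rewrite !lt_min d10 d20/= divr_gt0 ?subr_gt0.
  apply: le_trans (hausdorff_content_le _ d0).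
  apply: le_trans (hausdorff_content_separated _ Aq Bq).
    apply: leeD; apply: hausdorff_content_scale; rewrite /d !ge_min ?lexx//=.
    by rewrite orbT.
  have : (d <= (q' - q) / 2)%R by rewrite /d !ge_min lexx !orbT.
  by move=> ?; lra.
have [->|HABoo] := eqVneq (H (A `|` B)) +oo; first exact: leey.
have HBfin : H B \is a fin_num.
  rewrite ge0_fin_numE// (le_lt_trans (le_outer_measure H _ (A `|` B) _))//.
  by rewrite ltey.
rewrite -leeBrDr//; apply: hausdorff_unnormalized_leP => d d0.
have Afin : hausdorff_content m d A \is a fin_num.
  rewrite ge0_fin_numE ?hausdorff_content_ge0//.
  apply: le_lt_trans (hausdorff_content_le _ d0) _.
  rewrite (le_lt_trans (le_outer_measure H _ (A `|` B) _))//.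
  by rewrite ltey.
rewrite leeBrDr// addeC -leeBrDr//; apply: hausdorff_unnormalized_leP => d' d'0.
by rewrite leeBrDr// addeC key.
Qed.

End Hausdorff_outer_measure.
Section Caratheodory_criterion.
Context {R : realType} {T : Type} (mu : {outer_measure set T -> \bar R}).
Variable f : T -> R.
Hypothesis mu_sep : forall (q q' : R) A B, (q < q')%R ->
  A `<=` [set x | f x <= q]%R -> B `<=` [set x | q' <= f x]%R ->
  (mu A + mu B <= mu (A `|` B))%E.

(* With [V_k = X `&` [set x | u k <= f x]] for [u] decreasing to [q] and [S_k]
   the slab between the levels [u (k + 2)] and [u (k + 1)], separation gives
   [mu S_k <= mu V_(k+2) - mu V_k]; these bounds telescope. *)
Lemma separated_caratheodory q : mu.-caratheodory [set x | q < f x].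
Proof.
apply: le_caratheodory_measurable => X.
have [->|Xoo] := eqVneq (mu X) +oo%E; first exact: leey.
have muXE Y : Y `<=` X -> mu Y = (fine (mu Y))%:E.
  move=> YX; rewrite fineK// ge0_fin_numE ?outer_measure_ge0//.
  by rewrite (le_lt_trans (le_outer_measure mu _ _ YX))// ltey.
pose u k : R := q + k.+1%:R^-1.
have uS k : u k.+1 < u k by rewrite ltrD2l ltf_pV2 ?posrE// ltr_nat.
pose V k := X `&` [set x | u k <= f x].
pose S k := X `&` [set x | u k.+2 <= f x <= u k.+1].
have TX k : V k `<=` X by move=> x [].
have SX k : S k `<=` X by move=> x [].
pose m k := fine (mu (V k)); pose r k := fine (mu (S k)).
have r0 k : 0 <= r k by rewrite fine_ge0 ?outer_measure_ge0.
have leT k : V k `<=` V k.+1.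
  by move=> x [Xx /= ux]; split => //=; apply: le_trans ux; exact: ltW.
have mS k : m k <= m k.+1.
  by rewrite -lee_fin -!muXE//; exact: le_outer_measure.
have rm k : r k + m k <= m k.+2.
  rewrite -lee_fin EFinD -!muXE//.
  apply: (@le_trans _ _ (mu (S k `|` V k))).
    by apply: (mu_sep (uS k)) => x [Xx] //= /andP[].
  apply: le_outer_measure => x [[Xx /= /andP[ux _]]|/leT/leT//].
  by split.
have mX k : m k <= fine (mu X).
  by rewrite -lee_fin -!muXE//; exact: le_outer_measure.
pose M := sup (range m).
have ubM : has_sup (range m).
  by split; [exists (m 0%N), 0%N|exists (fine (mu X)) => _ [k _ <-]].
have mM k : m k <= M by apply: ub_le_sup; [case: ubM|exists k].
have sum_r N K : \sum_(N <= k < N + K) r k <= m (N + K).+1 + m (N + K)%N - m N.+1 - m N.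
  elim: K => [|K ih]; first by rewrite addn0 big_geq//; lra.
  rewrite addnS big_nat_recr ?leq_addr//=.
  by have := rm (N + K)%N; lra.
pose P := X `&` [set x | q < f x]; pose Q := X `&` ~` [set x | q < f x].
have PX : P `<=` X by move=> x [].
have QX : Q `<=` X by move=> x [].
have mP N : fine (mu P) <= 2 * M - m N.
  have cover : P `<=` V N.+1 `|` \bigcup_(k in ~` `I_N) S k.
    move=> x [Xx /= qx].
    have exk : exists k, u k <= f x.
      exists (Num.trunc (f x - q)^-1); rewrite /u -lerBrDl.
      rewrite -[leRHS]invrK lef_pV2 ?posrE ?invr_gt0 ?subr_gt0//.
      by apply/ltW; rewrite truncnS_gt.
    case: (ex_minnP exk) => j uj jmin.
    have [jN|Nj] := leqP j N.+1.
      left; split => //=; elim: (N.+1 - j)%N {-2}j uj (subnK jN) => [|e ih] i ui.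
        by rewrite add0n => <-.
      rewrite addSnnS; apply: ih; apply: le_trans ui; exact/ltW.
    case: j Nj uj jmin => [|[|j]]// Nj uj jmin; right; exists j.
      by apply/negP; rewrite -leqNgt.
    split => //=; rewrite uj/=.
    by rewrite leNgt; apply/negP => /ltW /jmin; rewrite ltnn.
  rewrite -lee_fin -muXE//; apply: (le_trans (le_outer_measure mu _ _ cover)).
  apply: le_trans (outer_measureU2 mu _ _) _.
  rewrite (muXE (V N.+1))//.
  have tail : (\sum_(N <= k <oo) mu (S k) <= (2 * M - m N - m N.+1)%:E)%E.
    apply: lime_le.
      by apply: is_cvg_nneseries => k _ _; exact: outer_measure_ge0.
    apply: nearW => K; have [KN|/ltnW NK] := leqP K N.
      rewrite big_geq// lee_fin.
      by have := mM N; have := mM N.+1; lra.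
    rewrite (eq_bigr (fun k => (r k)%:E)); last by move=> k _; rewrite -muXE.
    rewrite sumEFin lee_fin -(subnKC NK).
    apply: le_trans (sum_r _ _) _.
    by have := mM (N + (K - N))%N; have := mM (N + (K - N)).+1; lra.
  apply: (@le_trans _ _ ((m N.+1)%:E + (2 * M - m N - m N.+1)%:E)%E).
    apply: leeD2l; apply: le_trans tail.
    exact: outer_measure_sigma_subadditive_tail.
  by rewrite -EFinD lee_fin; lra.
have mQ N : m N <= fine (mu X) - fine (mu Q).
  rewrite lerBrDr addrC -lee_fin EFinD -!muXE//.
  apply: (@le_trans _ _ (mu (Q `|` V N))).
    apply: (mu_sep (q := q) (q' := u N)).
    - by rewrite /u ltrDl invr_gt0.
    - by move=> x [_ /=] /negP; rewrite -leNgt.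
    - by move=> x [].
  by apply: le_outer_measure => x [[]|[]].
have MP : M <= 2 * M - fine (mu P).
  by apply: ge_sup => [|_ [N _ <-]]; [exists (m 0%N), 0%N|have := mP N; lra].
have MQ : M <= fine (mu X) - fine (mu Q).
  by apply: ge_sup => [|_ [N _ <-]]; [exists (m 0%N), 0%N|have := mQ N; lra].
by rewrite (muXE P)// (muXE Q)// (muXE X)// -EFinD lee_fin; lra.
Qed.

End Caratheodory_criterion.

Section Hausdorff_measure.
Context {R : realType} {m n : nat}.
Local Notation H := (@hausdorff_unnormalized R m n).
Local Open Scope ereal_scope.

Lemma measurable_caratheodory_hausdorff (A : set 'rV[R]_n) :
  measurable A -> H.-caratheodory A.
Proof.
suff coord (i : 'I_n) :
    @measurable_fun _ _ (caratheodory_type H) (measurableTypeR R) setT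
      (fun x => (x : 'rV[R]_n) ord0 i).
  have gen : (\big[setU/set0]_(i < n) preimage_set_system setT
      (fun x : 'rV[R]_n => x ord0 i : measurableTypeR R) measurable) `<=`
      (measurable : set (set (caratheodory_type H))).
    move=> B; rewrite -bigcup_seq => -[i _ [C mC <-]].
    exact: coord.
  move: A; apply: (smallest_sub _ gen); exact: (@sigma_algebra_measurable _ (caratheodory_type H)).
apply: (measurability _ (RGenOInfty.measurableE R)) => _ [_ [q ->] <-].
rewrite setTI (_ : _ @^-1` _ = [set x : 'rV[R]_n | q < x ord0 i]%R); last first.
  by apply/seteqP; split => x /=; rewrite in_itv/= andbT.
apply: separated_caratheodory => q1 q2 B C q12.
exact: hausdorff_unnormalized_separated.
Qed.

Let H_sigma_additive : semi_sigma_additive (H : set 'rV[R]_n -> _).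
Proof.
move=> F mF tF mUF; apply: caratheodory_measure_sigma_additive => //.
- by move=> k; exact: measurable_caratheodory_hausdorff.
- exact: measurable_caratheodory_hausdorff.
Qed.

HB.instance Definition _ := isMeasure.Build _ _ _ H
  (outer_measure0 H) (outer_measure_ge0 H) H_sigma_additive.

End Hausdorff_measure.
Section Hausdorff_Lipschitz.
Context {R : realType} {m n n' : nat}.
Variables (f : 'rV[R]_n -> 'rV[R]_n') (r : R).
Hypothesis r0 : 0 < r.
Hypothesis fr : forall x y, enorm (f x - f y) <= r * enorm (x - y).
Implicit Types (A : set 'rV[R]_n).
Local Open Scope ereal_scope.

Lemma ediam_lipschitz A delta :
  ediam A <= delta%:E -> ediam (f @` A) <= (r * delta)%:E.
Proof.
move=> /ediam_leP Ad; apply/ediam_leP => _ _ [x Ax <-] [y Ay <-].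
rewrite lee_fin (le_trans (fr x y))// ler_pM2l// -lee_fin; exact: Ad.
Qed.

Lemma diam_pow_lipschitz A delta : ediam A <= delta%:E ->
  diam_pow m (f @` A) <= (r ^+ m)%:E * diam_pow m A.
Proof.
move=> Ad; have [->|/set0P[x Ax]] := eqVneq A set0.
  by rewrite image_set0 !diam_pow0 mule0.
have [|s [s0 sd As ->]] := @diam_powE _ _ m A _ Ad; first by exists x.
have fA : ediam (f @` A) <= (r * s)%:E by apply: ediam_lipschitz; rewrite As.
have [|t [t0 ts _ ->]] := @diam_powE _ _ m (f @` A) _ fA; first by exists (f x), x.
by rewrite -EFinM lee_fin -exprMn lerXn2r// nnegrE mulr_ge0// ltW.
Qed.

Lemma hausdorff_content_lipschitz A delta :
  hausdorff_content m (r * delta) (f @` A) <=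
  (r ^+ m)%:E * hausdorff_content m delta A.
Proof.
have rm0 : (0 < r ^+ m)%R by rewrite exprn_gt0.
rewrite -lee_pdivrMl//; apply: le_ereal_inf_tmp => _ [C [AC Cd] <-].
rewrite lee_pdivrMl// -nneseriesZl; last by move=> k _; exact: diam_pow_ge0.
apply: (@le_trans _ _ (\sum_(0 <= k <oo) diam_pow m (f @` C k))).
  apply: ereal_inf_lbound; exists (fun k => f @` C k) => //; split.
    by move=> _ [x /AC[k _ Ckx] <-]; exists k => //; exists x.
  by move=> k; exact: ediam_lipschitz.
apply: lee_nneseries => k _; first by rewrite diam_pow_ge0.
exact: diam_pow_lipschitz (Cd k).
Qed.

Lemma hausdorff_unnormalized_lipschitz A :
  hausdorff_unnormalized m (f @` A) <= (r ^+ m)%:E * hausdorff_unnormalized m A.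
Proof.
apply: hausdorff_unnormalized_leP => d d0.
have -> : d = (r * (d / r))%R by rewrite mulrC divfK// gt_eqF.
apply: le_trans (hausdorff_content_lipschitz _ _) _.
apply: lee_wpmul2l; first by rewrite lee_fin exprn_ge0// ltW.
by apply: hausdorff_content_le; rewrite divr_gt0.
Qed.

End Hausdorff_Lipschitz.

Section Hausdorff_cubes.
Context {R : realType} {d : nat}.
Local Notation H := (@hausdorff_unnormalized R d d).
Local Notation unit_cube := (cube (0 : 'rV[R]_d) 1).
Local Notation closed_unit_cube := [set x : 'rV[R]_d | forall i, 0 <= x ord0 i <= 1].
Local Open Scope ereal_scope.

Let scale (c : 'rV[R]_d) (r : R) (x : 'rV[R]_d) := (c + r *: x)%R.

Let scale_lipschitz c r : (0 < r)%R -> forall x y,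
  (enorm (scale c r x - scale c r y) <= r * enorm (x - y))%R.
Proof. by move=> r0 x y; rewrite /scale opprD addrACA subrr add0r -scalerBr enormZ gtr0_norm. Qed.

Let scaleK c r : (0 < r)%R -> cancel (scale c r) (scale (- (r^-1 *: c)) r^-1).
Proof.
move=> r0 x; rewrite /scale scalerDr addrA addNr add0r scalerA mulVf ?scale1r//.
by rewrite gt_eqF.
Qed.

Lemma hausdorff_unnormalized_scale c r (A : set 'rV[R]_d) : (0 < r)%R ->
  H ((fun x => c + r *: x)%R @` A) = (r ^+ d)%:E * H A.
Proof.
move=> r0; have rd0 : (0 < r ^+ d)%R by rewrite exprn_gt0.
apply/eqP; rewrite eq_le; apply/andP; split.
  exact: hausdorff_unnormalized_lipschitz (scale_lipschitz c r0) A.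
rewrite -lee_pdivlMl// -exprVn.
have r'0 : (0 < r^-1)%R by rewrite invr_gt0.
rewrite -[A in leLHS](_ : scale (- (r^-1 *: c)) r^-1 @` (scale c r @` A) = A).
  exact: hausdorff_unnormalized_lipschitz (scale_lipschitz _ r'0) _.
apply/seteqP; split => [_ [_ [x Ax <-] <-]|x Ax]; first by rewrite scaleK.
by exists (scale c r x); [exists x|rewrite scaleK].
Qed.

Lemma cube_scale c r : (0 < r)%R -> cube c r = (fun x => c + r *: x)%R @` unit_cube.
Proof.
move=> r0; apply/seteqP; split => [x xc|_ [x xc <-] i].
  exists (r^-1 *: (x - c)).
    move=> i; have := xc i; rewrite /= !in_itv/= !mxE add0r => /andP[h1 h2].
    by rewrite mulrC ler_pdivlMr// ltr_pdivrMr// mul0r mul1r subr_ge0 h1/= ltrBlDl.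
  by rewrite scalerA divff ?gt_eqF// scale1r addrC subrK.
have := xc i; rewrite /= !in_itv/= !mxE add0r => /andP[h1 h2].
by rewrite lerDl mulr_ge0 ?(ltW r0)//= ltrD2l -[ltRHS]mulr1 ltr_pM2l.
Qed.

Lemma hausdorff_unnormalized_cube c r : (0 < r)%R ->
  H (cube c r) = (r ^+ d)%:E * H unit_cube.
Proof. by move=> r0; rewrite cube_scale// hausdorff_unnormalized_scale. Qed.

Lemma lebesgue_rV_cube (c : 'rV[R]_d) r : (0 <= r)%R ->
  lebesgue_rV d (cube c r) = (r ^+ d)%:E.
Proof.
move=> r0; rewrite (@lebesgue_rV_box _ _ _ (fun=> r)).
- by rewrite prodr_const card_ord.
- by move=> i; exact: measurable_itv.
move=> i; rewrite lebesgue_measure_itv/= lte_fin ltrDl.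
case: ltP => [_|rn]; first by rewrite -EFinB addrC addKr.
by congr _%:E; apply/eqP; rewrite eq_le r0.
Qed.

Lemma unit_cube_content_le (delta : R) : (0 < delta)%R ->
  hausdorff_content d delta unit_cube <= (d%:R ^+ d)%:E.
Proof.
move=> d0; pose N := Num.trunc (d%:R / delta).
have Nd : (d%:R * N.+1%:R^-1 <= delta)%R.
  by rewrite ler_pdivrMr// -ler_pdivrMl// mulrC ltW// truncnS_gt.
pose I := {ffun 'I_d -> 'I_N.+1}.
pose Q (g : I) : set 'rV[R]_d := cube (\row_i ((g i)%:R / N.+1%:R))%R (N.+1%:R^-1)%R.
pose F k := if insub k : option 'I_#|I| is Some i then Q (enum_val i) else set0.
have diamQ g : ediam (Q g) <= (d%:R * N.+1%:R^-1)%:E.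
  apply/ediam_leP => x y Qx Qy; rewrite lee_fin enorm_le_cube// => i.
  have := Qx i; have := Qy i; rewrite /= !in_itv/= !mxE => /andP[a1 a2] /andP[a3 a4].
  have aux (s t u v : R) : (s <= v -> v < s + t -> s <= u -> u < s + t ->
      `|u - v| <= t)%R.
    by move=> *; rewrite ler_norml; apply/andP; split; lra.
  exact: aux a1 a2 a3 a4.
have diamF k : ediam (F k) <= (d%:R * N.+1%:R^-1)%:E.
  by rewrite /F; case: insubP => [i _ _|_]; [exact: diamQ|apply/ediam_leP].
have contF k : hausdorff_content d delta (F k) <= ((d%:R * N.+1%:R^-1) ^+ d)%:E.
  apply: (@le_trans _ _ (diam_pow d (F k))).
    apply: hausdorff_content_le_diam_pow; first exact: ltW.
    by apply: le_trans (diamF k) _; rewrite lee_fin.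
  have [->|/set0P F0] := eqVneq (F k) set0.
    by rewrite diam_pow0 lee_fin exprn_ge0// mulr_ge0.
  have [s [s0 sd _ ->]] := diam_powE d (diamF k) F0.
  by rewrite lee_fin lerXn2r// nnegrE mulr_ge0.
have cover : unit_cube `<=` \bigcup_k F k.
  move=> x x01.
  pose g : I := [ffun i => inord (Num.trunc (N.+1%:R * x ord0 i))].
  exists (enum_rank g : nat) => //; rewrite /F.
  case: insubP => [i _ /val_inj ->|]; last by rewrite ltn_ord.
  rewrite enum_rankK => i0; have := x01 i0.
  rewrite /= !in_itv/= !mxE add0r => /andP[x0 x1].
  have Nx : (0 <= N.+1%:R * x ord0 i0)%R by rewrite mulr_ge0.
  have /andP[t1 t2] := truncn_itv Nx.
  rewrite ffunE inordK; last first.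
    rewrite -(ltr_nat R); apply: le_lt_trans t1 _.
    by rewrite -[ltRHS]mulr1 ltr_pM2l.
  rewrite -[X in (_ < _ + X)%R]mul1r -mulrDl ler_pdivrMr// ltr_pdivlMr//.
  by rewrite ![(x ord0 i0 * _)%R]mulrC t1 natr1.
apply: le_trans (le_hausdorff_content delta cover) _.
apply: le_trans (hausdorff_content_sigma_subadditive delta F) _.
rewrite (nneseries_split 0 #|I|); last by move=> k _; exact: hausdorff_content_ge0.
rewrite [X in _ + X]eseries0 ?adde0; last first.
  move=> k Ik _; rewrite /F; case: insubP => [i _ ik|_].
    by have := ltn_ord i; rewrite ik ltnNge Ik.
  by rewrite hausdorff_content0// ltW.
apply: (@le_trans _ _ (\sum_(0 <= k < 0 + #|I|) ((d%:R * N.+1%:R^-1) ^+ d)%:E)).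
  by apply: lee_sum => k _; exact: contF.
rewrite sumEFin lee_fin big_const_nat subn0 add0n iter_addr_0 card_ffun !card_ord.
by rewrite exprMn -[leLHS]mulr_natr -mulrA natrX -exprMn mulVf ?expr1n ?mulr1.
Qed.

Lemma lebesgue_rV_le_content (delta : R) (A : set 'rV[R]_d) : measurable A ->
  lebesgue_rV d A <= (2 ^+ d)%:E * hausdorff_content d delta A.
Proof.
move=> mA; have d20 : (0 < 2 ^+ d :> R)%R by rewrite exprn_gt0.
rewrite -lee_pdivrMl//; apply: le_ereal_inf_tmp => _ [C [AC Cd] <-].
rewrite lee_pdivrMl// -nneseriesZl; last by move=> k _; exact: diam_pow_ge0.
have [B BP] : {B : nat -> set 'rV[R]_d & forall k, [/\ measurable (B k),
    C k `<=` B k & lebesgue_rV d (B k) <= (2 ^+ d)%:E * diam_pow d (C k)]}.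
  apply: (@choice _ _ (fun k B => [/\ measurable B,
    C k `<=` B & lebesgue_rV d B <= (2 ^+ d)%:E * diam_pow d (C k)])) => k.
  have [->|/set0P C0] := eqVneq (C k) set0.
    by exists set0; split => //; rewrite measure0 diam_pow0 mule0.
  have [s [s0 sd Cs ->]] := diam_powE d (Cd k) C0.
  have [x Cx] := C0.
  exists (box (fun i => `[(x ord0 i - s)%R, (x ord0 i + s)%R]%classic)); split.
  - by apply: measurable_box => i; exact: measurable_itv.
  - move=> y Cy i; rewrite /= in_itv/= -ler_distlC.
    have /ediam_leP/(_ y x Cy Cx) : ediam (C k) <= s%:E by rewrite Cs.
    rewrite lee_fin; apply: le_trans; rewrite distrC.
    by have := coord_le_enorm (y - x)%R i; rewrite !mxE.
  rewrite (@lebesgue_rV_box _ _ _ (fun=> (2 * s)%R)).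
  - by rewrite prodr_const card_ord exprMn EFinM.
  - by move=> i; exact: measurable_itv.
  move=> i; rewrite lebesgue_measure_itv/= lte_fin; case: ltP => h.
    by rewrite -EFinB; congr _%:E; ring.
  by congr _%:E; lra.
apply: (@le_trans _ _ (\sum_(0 <= k <oo) lebesgue_rV d (B k))).
  apply: measure_sigma_subadditive => //; first by move=> k; case: (BP k).
  by apply: subset_trans AC _ => x [k _ Ckx]; exists k => //; case: (BP k) => _ + _; exact.
apply: lee_nneseries => k _; first by rewrite measure_ge0.
by case: (BP k).
Qed.

Lemma closed_unit_cubeE : H closed_unit_cube = H unit_cube.
Proof.
have ufin : H unit_cube < +oo.
  apply: (@le_lt_trans _ _ (d%:R ^+ d)%:E); last exact: ltry.
  by apply: hausdorff_unnormalized_leP => e; exact: unit_cube_content_le.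
have sub r : (0 < r < 1)%R -> (r ^+ d)%:E * H closed_unit_cube <= H unit_cube.
  move=> /andP[r0 r1]; rewrite -(hausdorff_unnormalized_scale 0)//.
  apply: le_outer_measure => _ [x x01 <-] i; rewrite /= in_itv/= !mxE !add0r.
  have /andP[x0 x1] := x01 i; rewrite mulr_ge0 ?(ltW r0)//=.
  by apply: le_lt_trans r1; rewrite ler_piMr// ltW.
apply/eqP; rewrite eq_le; apply/andP; split; last first.
  apply: le_outer_measure => x x01 i; have := x01 i.
  by rewrite /= in_itv/= mxE add0r => /andP[-> /ltW ->].
have bernoulli k (e : R) : (0 <= e <= 1)%R -> (1 - k%:R * e <= (1 - e) ^+ k)%R.
  move=> /andP[e0 e1]; elim: k => [|k ih]; first by rewrite mul0r subr0.
  rewrite exprS; apply: (@le_trans _ _ ((1 - e) * (1 - k%:R * e))%R).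
    by rewrite -natr1; have : (0 <= k%:R * e ^+ 2)%R; [rewrite mulr_ge0 ?sqr_ge0|nra].
  by rewrite ler_wpM2l// subr_ge0.
have cfin : H closed_unit_cube < +oo.
  have := sub 2^-1%R; rewrite invr_gt0 invf_lt1// ltr1n ltr0n => /(_ isT).
  rewrite -lee_pdivlMl ?exprn_gt0 ?invr_gt0// => /le_lt_trans; apply.
  by apply: lte_mul_pinfty => //; rewrite lee_fin invr_ge0 exprn_ge0 ?invr_ge0.
have H0 A : 0 <= H A by exact: outer_measure_ge0.
move: sub ufin cfin (H0 unit_cube) (H0 closed_unit_cube).
case: (H unit_cube) => // u; case: (H _) => // c sub _ _; rewrite !lee_fin => u0 c0.
apply/ler_addgt0Pr => e e0.
pose s := Num.min (2^-1)%R (e / (d%:R * c + 1))%R.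
have dc0 : (0 < d%:R * c + 1)%R by rewrite ltr_wpDl// mulr_ge0.
have s0 : (0 < s)%R by rewrite lt_min invr_gt0 ltr0n/= divr_gt0.
have s1 : (s <= 2^-1)%R by rewrite /s ge_min lexx.
have se : (s * (d%:R * c + 1) <= e)%R by rewrite -ler_pdivlMr// /s ge_min lexx orbT.
have sb : (0 < 1 - s < 1)%R by apply/andP; split; lra.
have : ((1 - s) ^+ d * c <= u)%R by have := sub _ sb; rewrite -EFinM lee_fin.
have : (1 - d%:R * s <= (1 - s) ^+ d)%R by apply: bernoulli; apply/andP; split; lra.
by move=> /(ler_wpM2r c0); nra.
Qed.

Lemma hausdorff_unit_cube_fin : exists h, (0 < h)%R /\ H unit_cube = h%:E.
Proof.
have ufin : H unit_cube < +oo.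
  apply: (@le_lt_trans _ _ (d%:R ^+ d)%:E); last exact: ltry.
  by apply: hausdorff_unnormalized_leP => e; exact: unit_cube_content_le.
have : (1%:E : \bar R) <= (2 ^+ d)%:E * H unit_cube.
  rewrite -[X in X%:E](expr1n _ d) -(lebesgue_rV_cube 0)//.
  apply: le_trans (lebesgue_rV_le_content 1 (measurable_cube _ _)) _.
  apply: lee_wpmul2l; first by rewrite lee_fin exprn_ge0.
  exact: hausdorff_content_le.
have : 0 <= H unit_cube by exact: outer_measure_ge0.
case: (H unit_cube) ufin => // h _; rewrite -EFinM !lee_fin => h0 h1.
exists h; split => //; rewrite lt_neqAle h0 andbT.
by apply/negP => /eqP h00; move: h1; rewrite -h00 mulr0 ler10.
Qed.

End Hausdorff_cubes.

Section normalized_Hausdorff_measure.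
Context {R : realType}.
Local Open Scope ereal_scope.

Section measure.
Context {m n : nat}.
Local Notation H := (@hausdorff_unnormalized R m n).
Local Notation c := (fine (@hausdorff_unnormalized R m m
  [set x | forall i, 0 <= x ord0 i <= 1]%R))^-1%R.

Let c_ge0 : (0 <= c)%R.
Proof. by rewrite invr_ge0 fine_ge0 ?outer_measure_ge0. Qed.

Let hausdorffE : @hausdorff R m n = mscale (NngNum c_ge0) H.
Proof. by []. Qed.

Let hausdorff0 : @hausdorff R m n set0 = 0.
Proof. by rewrite hausdorffE measure0. Qed.

Let hausdorff_ge0 A : 0 <= @hausdorff R m n A.
Proof. by rewrite mule_ge0 ?lee_fin// outer_measure_ge0. Qed.

Let hausdorff_sigma_additive : semi_sigma_additive (@hausdorff R m n).
Proof. by rewrite hausdorffE; exact: measure_semi_sigma_additive. Qed.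

HB.instance Definition _ := isMeasure.Build _ _ _ (@hausdorff R m n)
  hausdorff0 hausdorff_ge0 hausdorff_sigma_additive.

End measure.

Lemma hausdorff_cube d (x : 'rV[R]_d) r : (0 < r)%R ->
  hausdorff d (cube x r) = (r ^+ d)%:E.
Proof.
move=> r0; rewrite /hausdorff closed_unit_cubeE (hausdorff_unnormalized_cube x r0).
have [h [h0 ->]] := @hausdorff_unit_cube_fin R d.
by rewrite /= -!EFinM mulrCA mulVf ?mulr1// gt_eqF.
Qed.

Lemma hausdorff_open d (D : set 'rV[R]_d) : open D ->
  hausdorff d D = lebesgue_rV d D.
Proof.
move=> oD; apply/eqP; rewrite eq_le; apply/andP; split; apply: le_measure_cubes => // c r r0 _.
  by rewrite [leLHS](hausdorff_cube c r0) [leRHS](lebesgue_rV_cube c (ltW r0)).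
by rewrite [leRHS](hausdorff_cube c r0) [leLHS](lebesgue_rV_cube c (ltW r0)).
Qed.

Lemma hausdorff_slice d (t : R) (A : set 'rV[R]_d) :
  hausdorff d [set x : 'rV[R]_d.+1 | x ord0 ord0 = t /\ A (behead_rV x)] =
  hausdorff d A.
Proof.
rewrite /hausdorff; congr (_ * _); apply/eqP; rewrite eq_le; apply/andP; split.
  have cons_lip (x y : 'rV[R]_d) :
      (enorm (cons_rV (t, x) - cons_rV (t, y)) <= 1 * enorm (x - y))%R.
    by rewrite enorm_cons mul1r.
  have := hausdorff_unnormalized_lipschitz (m := d) ltr01 cons_lip A.
  rewrite expr1n mul1e; apply: le_trans; apply: le_outer_measure.
  by move=> x [/= xt Ax]; exists (behead_rV x) => //; rewrite -xt cons_behead_rV.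
have behead_lip (x y : 'rV[R]_d.+1) :
    (enorm (behead_rV x - behead_rV y) <= 1 * enorm (x - y))%R.
  by rewrite mul1r enorm_behead.
have := hausdorff_unnormalized_lipschitz (m := d) ltr01 behead_lip
  [set x : 'rV[R]_d.+1 | x ord0 ord0 = t /\ A (behead_rV x)].
rewrite expr1n mul1e; apply: le_trans; apply: le_outer_measure => y Ay.
exists (cons_rV (t, y)); last by rewrite behead_cons_rV.
by split; [rewrite cons_rV0|rewrite behead_cons_rV].
Qed.

Lemma gradient_coord0 n (x : 'rV[R]_n.+1) :
  gradient (fun x : 'rV[R]_n.+1 => x ord0 ord0) x = delta_mx ord0 ord0.
Proof.
apply/rowP => i; rewrite !mxE /partial/=.
apply: cvg_lim => //; apply: cvg_near_cst; near=> h.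
rewrite /= !mxE addrK.
have h0 : h != 0%R by near: h; exact: nbhs_dnbhs_neq.
rewrite eqxx/= [ord0 == i]eq_sym /GRing.scale/=.
by case: eqP => _; rewrite ?mulr1 ?mulr0 ?mulVf.
Unshelve. all: by end_near. Qed.

Lemma enorm_delta n : enorm (delta_mx ord0 ord0 : 'rV[R]_n.+1) = 1%R.
Proof.
rewrite /enorm (bigD1 ord0)//= big1 ?addr0 ?mxE ?eqxx ?expr1n ?sqrtr1//.
by move=> i i0; rewrite mxE (negbTE i0) andbF expr0n.
Qed.

Lemma energy_weight_cylinder d (p L : R) (D : set 'rV[R]_d) t : open D ->
  (- L < t < L)%R ->
  energy_weight p (cylinder L D) (fun x : 'rV[R]_d.+1 => x ord0 ord0) t = hausdorff d D.
Proof.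
move=> oD tL; rewrite /energy_weight.
have -> : level_set (cylinder L D) (fun x : 'rV[R]_d.+1 => x ord0 ord0) t =
    [set x : 'rV[R]_d.+1 | x ord0 ord0 = t /\ D (behead_rV x)].
  by apply/seteqP; split => x /=; [case=> -[_ Dx] <-|case=> xt Dx; split=> //; split=> //; rewrite xt].
under eq_integral do rewrite gradient_coord0 enorm_delta powR1.
rewrite integral_cst; first by rewrite mul1e; exact: hausdorff_slice.
apply: (@measurableI _ _ ((fun x : 'rV[R]_d.+1 => x ord0 ord0) @^-1` [set t])
  (@behead_rV R d @^-1` D)); last first.
  rewrite -[X in measurable X]setTI; apply: measurable_behead_rV => //.
  exact: open_measurable_rV.
rewrite -[X in measurable X]setTI; exact: measurable_coord.
Qed.

End normalized_Hausdorff_measure.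

(** * Smooth cutoff functions *)

Section iterated_differentiability.
Context {R : realType}.
Implicit Types f g : R -> R.

Fixpoint derivable_n (k : nat) f : Prop :=
  if k is k'.+1 then (forall x, derivable f x 1) /\ derivable_n k' (derive1 f) else True.

Definition smooth1 f := forall k, derivable_n k f.

Lemma derivable_nW k f : derivable_n k.+1 f -> derivable_n k f.
Proof. by elim: k f => // k ih f [df /ih]. Qed.

Lemma smooth1P f : smooth1 f <-> forall k x, derivable (derive1n k f) x 1.
Proof.
split=> [sf k|].
  elim: k f sf => [|k ih] f sf x; first by have [] := sf 1.
  by rewrite derive1Sn; apply: ih => j; have [] := sf j.+1.
move=> df k; elim: k f df => // k ih f df; split; first exact: df 0%N.
by apply: ih => j x; rewrite -derive1Sn; exact: df.
Qed.

Lemma smooth1_derive f : smooth1 f -> smooth1 (derive1 f).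
Proof. by move=> sf k; have [] := sf k.+1. Qed.

Lemma smooth1_derivable f x : smooth1 f -> derivable f x 1.
Proof. by move=> /(_ 1)[]. Qed.

Lemma smooth1_continuous f : smooth1 f -> continuous f.
Proof.
move=> sf x; apply: differentiable_continuous; apply/derivable1_diffP.
exact: smooth1_derivable.
Qed.

Lemma derivable_n_cst k (c : R) : derivable_n k (cst c).
Proof.
elim: k c => // k ih c; split; first by move=> x; exact: derivable_cst.
rewrite (_ : derive1 (cst c) = cst 0); first exact: ih.
by apply/funext => x; rewrite derive1_cst.
Qed.

Lemma derivable_nD k f g :
  derivable_n k f -> derivable_n k g -> derivable_n k (fun x => f x + g x).
Proof.
elim: k f g => // k ih f g [df kf] [dg kg]; split.
  by move=> x; exact: derivableD.
rewrite (_ : derive1 (fun x => f x + g x) = fun x => derive1 f x + derive1 g x); first exact: ih.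
by apply/funext => x; rewrite !derive1E deriveD.
Qed.

Lemma derivable_nM k f g :
  derivable_n k f -> derivable_n k g -> derivable_n k (fun x => f x * g x).
Proof.
elim: k f g => // k ih f g [df kf] [dg kg]; split.
  by move=> x; exact: derivableM.
rewrite (_ : derive1 (fun x => f x * g x) = fun x => f x * derive1 g x + derive1 f x * g x).
  apply: derivable_nD; apply: ih => //; first by apply: derivable_nW; split.
  by apply: derivable_nW; split.
by apply/funext => x; rewrite !derive1E deriveM// [X in _ + X]mulrC.
Qed.

Lemma derivable_n_comp k f g :
  derivable_n k f -> derivable_n k g -> derivable_n k (fun x => f (g x)).
Proof.
elim: k f g => // k ih f g [df kf] [dg kg].
have dfg x : derivable (f \o g) x 1.
  by apply/derivable1_diffP/differentiable_comp; exact/derivable1_diffP.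
split => //; rewrite (_ : derive1 (fun x => f (g x)) = fun x => derive1 f (g x) * derive1 g x).
  apply: derivable_nM => //; apply: ih => //.
  by apply: derivable_nW; split.
by apply/funext => x; rewrite (derive1_comp (dg x) (df (g x))).
Qed.

Lemma smooth1M f g : smooth1 f -> smooth1 g -> smooth1 (fun x => f x * g x).
Proof. by move=> sf sg k; exact: derivable_nM. Qed.

Lemma smooth1_comp f g : smooth1 f -> smooth1 g -> smooth1 (fun x => f (g x)).
Proof. by move=> sf sg k; exact: derivable_n_comp. Qed.

Lemma smooth1_affine (s t : R) : smooth1 (fun x => s * x + t).
Proof.
case=> // k; have d (x : R) : is_derive x (1 : R) (fun x => s * x + t) s.
  have -> : (fun x : R => s * x + t) = s \*: id + cst t by [].
  by apply: is_derive_eq; rewrite addr0 /GRing.scale/= mulr1.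
split => [x|]; first exact: ex_derive.
rewrite (_ : derive1 _ = cst s); first exact: derivable_n_cst.
by apply/funext => x; rewrite derive1E; exact: derive_val.
Qed.

Lemma nondecreasing_derive1_ge0 f x :
  derivable f x 1 -> {homo f : y z / y <= z} -> 0 <= derive1 f x.
Proof.
move=> df fle; rewrite derive1E; apply: limr_ge => //; near=> h.
have h0 : h != 0 by near: h; exact: nbhs_dnbhs_neq.
rewrite /GRing.scale/= mulr1; case: (ltgtP h 0) h0 => // hlt _.
  apply: mulr_le0; first by rewrite invr_le0 ltW.
  by rewrite subr_le0 fle// -[leRHS]add0r lerD2r ltW.
apply: mulr_ge0; first by rewrite invr_ge0 ltW.
by rewrite subr_ge0 fle// -[leLHS]add0r lerD2r ltW.
Unshelve. all: by end_near. Qed.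

End iterated_differentiability.

Section smooth_step.
Context {R : realType}.

Definition flat_exp (P : {poly R}) (x : R) : R :=
  if 0 < x then P.[x^-1] * expR (- x^-1) else 0.

Lemma horner_expR_bound (P : {poly R}) :
  exists2 C, 0 <= C & forall y, 0 <= y -> `|P.[y]| <= C * expR y.
Proof.
have pow_bound n y : 0 <= y -> y ^+ n <= (n`!)%:R * expR y :> R.
  move=> y0; case: n => [|n].
    by rewrite expr0 fact0 mul1r; apply: le_trans (expR_ge1Dx y); rewrite lerDl.
  rewrite mulrC -ler_pdivrMr ?ltr0n ?fact_gt0//.
  by apply: le_trans (expR_ge1Dxn n y0); rewrite lerDr.
exists (\sum_(i < size P) `|P`_i| * (i`!)%:R).
  by apply: sumr_ge0 => i _; rewrite mulr_ge0.
move=> y y0; rewrite horner_coef mulr_suml; apply: le_trans (ler_norm_sum _ _ _) _.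
apply: ler_sum => i _; rewrite normrM -mulrA ler_wpM2l//.
by rewrite normrX ger0_norm// pow_bound.
Qed.

Lemma flat_exp_bound P : exists2 C, 0 <= C & forall x, `|flat_exp P x| <= C * `|x|.
Proof.
have [C C0 CP] := horner_expR_bound (P * 'X); exists C => // x.
rewrite /flat_exp; case: ltP => x0; last by rewrite normr0 mulr_ge0.
have y0 : 0 < x^-1 by rewrite invr_gt0.
have := CP _ (ltW y0); rewrite hornerM hornerX normrM !(gtr0_norm y0) => h.
rewrite normrM (gtr0_norm (expR_gt0 _)) (gtr0_norm x0) expRN.
by rewrite ler_pdivrMr ?expR_gt0// mulrAC -ler_pdivrMr.
Qed.

(* The chain rule for [P(1/x) exp(-1/x)]: the class is stable under derivation. *)
Lemma is_derive_flat_exp P (x : R) :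
  is_derive x (1 : R) (flat_exp P) (flat_exp ('X^2 * (P - P^`())) x).
Proof.
have [x0|x0|->] := ltgtP x 0.
- rewrite {2}/flat_exp ltNge (ltW x0)/=.
  apply: (near_eq_is_derive (f := cst 0)).
    by near=> y; rewrite /flat_exp ltNge ltW//; near: y; exact: lt_nbhsl.
- rewrite {2}/flat_exp x0.
  apply: (@near_eq_is_derive _ R R (fun y : R => P.[y^-1] * expR (- y^-1))).
    by near=> y; rewrite /flat_exp ifT//; near: y; exact: lt_nbhsr.
  have xn : x != 0 by rewrite gt_eqF.
  have dV : is_derive x (1 : R) (fun y : R => y^-1) (- x ^- 2).
    apply: DeriveDef; first exact: derivableV.
    by rewrite deriveV// derive_id /GRing.scale/= mulr1.
  have dP := is_derive1_comp (is_derive_poly P x^-1) dV.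
  have dN := is_deriveN dV.
  have dE := @is_derive1_comp _ expR (- (fun y : R => y^-1)) x _ _
    (is_derive_expR (- x^-1)) dN.
  have dPE := is_deriveM dP dE; apply: (@is_derive_eq _ _ _ _ _ _ _ _ dPE).
  rewrite hornerM hornerXn hornerD hornerN.
  change (P.[x^-1] * (expR (- x^-1) * - - x ^- 2) +
    expR (- x^-1) * (P^`().[x^-1] * - x ^- 2) =
    (x^-1) ^+ 2 * (P.[x^-1] - P^`().[x^-1]) * expR (- x^-1)).
  by rewrite -exprVn; ring.
have fP0 : flat_exp P 0 = 0 by rewrite /flat_exp ltxx.
have [C C0 CP] := flat_exp_bound (P * 'X).
have lim0 : (fun h : R => h^-1 *: ((flat_exp P \o shift 0) (h *: (1 : R)) - flat_exp P 0))
    @ 0^' --> (0 : R).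
  apply: norm_cvg0; apply: (@squeeze_cvgr _ _ _ _ (cst 0) (fun h => C * `|h|)).
  - near=> h; rewrite normr_ge0/= fP0 subr0 addr0 /GRing.scale/= mulr1.
    apply: le_trans (CP h); rewrite le_eqVlt; apply/orP; left; apply/eqP; congr `|_|.
    rewrite /flat_exp; case: ltP => _; last by rewrite mulr0.
    by rewrite hornerM hornerX mulrA [h^-1 * _]mulrC.
  - exact: cvg_cst.
  - rewrite -[X in _ --> X](mulr0 C); apply: cvgMr.
    rewrite -[X in _ --> X](normr0 R); apply: cvg_norm; exact: cvg_within.
rewrite [X in is_derive _ _ _ X](_ : _ = 0); last by rewrite /flat_exp ltxx.
by apply: DeriveDef; [exact: cvgP lim0|exact: cvg_lim lim0].
Unshelve. all: by end_near. Qed.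

Lemma smooth1_flat_exp P : smooth1 (flat_exp P).
Proof.
move=> k; elim: k P => // k ih P; split.
  by move=> x; have [] := is_derive_flat_exp P x.
rewrite (_ : derive1 _ = flat_exp ('X^2 * (P - P^`()))) //.
by apply/funext => x; rewrite derive1E; have [_ ->] := is_derive_flat_exp P x.
Qed.

Definition bump (x : R) := flat_exp 1 x.

Lemma bumpE x : bump x = if 0 < x then expR (- x^-1) else 0.
Proof. by rewrite /bump /flat_exp hornerC mul1r. Qed.

Lemma bump_gt0 x : 0 < x -> 0 < bump x.
Proof. by rewrite bumpE => ->; exact: expR_gt0. Qed.

Lemma bump_eq0 x : x <= 0 -> bump x = 0.
Proof. by rewrite bumpE ltNge => ->. Qed.

Lemma bump_ge0 x : 0 <= bump x.
Proof. by rewrite bumpE; case: ifP => // _; exact: expR_ge0. Qed.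

Lemma bump_nondecreasing : {homo bump : x y / x <= y}.
Proof.
move=> x y xy; have [x0|x0] := leP x 0; first by rewrite bump_eq0// bump_ge0.
have y0 := lt_le_trans x0 xy.
by rewrite !bumpE x0 y0 ler_expR lerN2 lef_pV2.
Qed.

(* For [x <= 0] the argument of the outer [bump] is nonpositive, and for
   [1 <= x] it is constant, so no quotient of functions is needed. *)
Definition step (x : R) := bump (bump 1 - bump (1 - x)) * (bump (bump 1))^-1.

Let bb_gt0 : 0 < bump (bump 1).
Proof. by rewrite !bump_gt0. Qed.

Lemma smooth1_step : smooth1 step.
Proof.
have sb : smooth1 bump by exact: smooth1_flat_exp.
have s1 : smooth1 (fun x => bump (-1 * x + 1)).
  by apply: smooth1_comp => //; exact: smooth1_affine.
have s2 : smooth1 (fun x => bump (-1 * bump (-1 * x + 1) + bump 1)).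
  apply: (@smooth1_comp _ bump (fun x => -1 * bump (-1 * x + 1) + bump 1)) => //.
  apply: (@smooth1_comp _ (fun y => -1 * y + bump 1)) => //; exact: smooth1_affine.
have -> : step = fun x => (bump (bump 1))^-1 * bump (-1 * bump (-1 * x + 1) + bump 1) + 0.
  by apply/funext => x; rewrite /step addr0 mulrC !mulN1r [- x + 1]addrC [- bump _ + _]addrC.
apply: (@smooth1_comp _ (fun y => (bump (bump 1))^-1 * y + 0)) => //.
exact: smooth1_affine.
Qed.

Lemma step_eq0 x : x <= 0 -> step x = 0.
Proof.
move=> x0; rewrite /step bump_eq0 ?mul0r// subr_le0 bump_nondecreasing//.
by rewrite lerBrDl gerDr.
Qed.

Lemma step_eq1 x : 1 <= x -> step x = 1.
Proof. by move=> x1; rewrite /step (@bump_eq0 (1 - x)) ?subr_le0// subr0 divff// gt_eqF. Qed.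

Lemma step_nondecreasing : {homo step : x y / x <= y}.
Proof.
move=> x y xy; rewrite ler_pM2r ?invr_gt0// bump_nondecreasing//.
by rewrite lerD2l lerN2 bump_nondecreasing// lerD2l lerN2.
Qed.

Lemma step_ge0 x : 0 <= step x.
Proof. by rewrite mulr_ge0 ?bump_ge0// invr_ge0 bump_ge0. Qed.

Lemma step_le1 x : step x <= 1.
Proof.
rewrite ler_pdivrMr// mul1r bump_nondecreasing// gerBl.
exact: bump_ge0.
Qed.

End smooth_step.

Section plateau.
Context {R : realType}.
Variables l r e : R.
Hypotheses (e0 : 0 < e) (lr : l <= r).

Let up t : R := step (e^-1 * t + (1 - e^-1 * l)).
Let down t : R := step (- e^-1 * t + (1 + e^-1 * r)).

Definition plateau (t : R) := up t * down t.

Let smooth1_up : smooth1 up.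
Proof. by apply: smooth1_comp; [exact: smooth1_step|exact: smooth1_affine]. Qed.

Let smooth1_down : smooth1 down.
Proof. by apply: smooth1_comp; [exact: smooth1_step|exact: smooth1_affine]. Qed.

Lemma smooth1_plateau : smooth1 plateau.
Proof. exact: smooth1M. Qed.

Lemma plateau_ge0 t : 0 <= plateau t.
Proof. by rewrite mulr_ge0// step_ge0. Qed.

Lemma plateau_le1 t : plateau t <= 1.
Proof. by rewrite mulr_ile1// ?step_ge0 ?step_le1. Qed.

Let up_eq1 t : l <= t -> up t = 1.
Proof.
move=> lt; apply: step_eq1; rewrite addrCA lerDl -mulrBr.
by rewrite mulr_ge0// ?invr_ge0 ?subr_ge0// ltW.
Qed.

Let down_eq1 t : t <= r -> down t = 1.
Proof.
move=> tr; apply: step_eq1; rewrite addrCA lerDl mulNr addrC -mulrBr.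
by rewrite mulr_ge0// ?invr_ge0 ?subr_ge0// ltW.
Qed.

Let up_eq0 t : t <= l - e -> up t = 0.
Proof.
move=> tl; apply: step_eq0; rewrite addrCA -mulrBr -lerBrDl sub0r.
by rewrite ler_pdivrMl// mulrN1; lra.
Qed.

Let down_eq0 t : r + e <= t -> down t = 0.
Proof.
move=> tl; apply: step_eq0; rewrite addrCA mulNr [- _ + _]addrC -mulrBr -lerBrDl sub0r.
by rewrite ler_pdivrMl// mulrN1; lra.
Qed.

Lemma plateau_eq1 t : l <= t <= r -> plateau t = 1.
Proof. by move=> /andP[lt tr]; rewrite /plateau up_eq1// down_eq1// mulr1. Qed.

Lemma plateau_eq0 t : ~~ (l - e < t < r + e) -> plateau t = 0.
Proof.
rewrite negb_and -!leNgt => /orP[h|h]; rewrite /plateau.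
  by rewrite up_eq0// mul0r.
by rewrite down_eq0// mulr0.
Qed.

Lemma plateau_derive1_ge0 t : t < r -> 0 <= derive1 plateau t.
Proof.
move=> tr; have -> : derive1 plateau t = derive1 up t.
  rewrite !derive1E; apply: near_eq_derive; near=> s.
  rewrite /plateau down_eq1 ?mulr1//; near: s.
  by near do apply: ltW; exact: lt_nbhsl.
apply: nondecreasing_derive1_ge0; first exact: smooth1_derivable.
move=> x y xy; apply: step_nondecreasing.
by rewrite lerD2r ler_pM2l// invr_gt0.
Unshelve. all: by end_near. Qed.

Lemma plateau_derive1_le0 t : l < t -> derive1 plateau t <= 0.
Proof.
move=> tr; have -> : derive1 plateau t = derive1 down t.
  rewrite !derive1E; apply: near_eq_derive; near=> s.
  rewrite /plateau up_eq1 ?mul1r//; near: s.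
  by near do apply: ltW; exact: lt_nbhsr.
rewrite -oppr_ge0.
have <- : derive1 (fun x => - down x) t = - derive1 down t.
  by rewrite !derive1E deriveN//; exact: smooth1_derivable.
apply: nondecreasing_derive1_ge0; first by apply: derivableN; exact: smooth1_derivable.
move=> x y xy; rewrite lerN2; apply: step_nondecreasing.
by rewrite lerD2r !mulNr lerN2 ler_pM2l// invr_gt0.
Unshelve. all: by end_near. Qed.

Lemma plateau_derive1_eq0 t : ~~ (l - e <= t <= r + e) -> derive1 plateau t = 0.
Proof.
rewrite negb_and -!ltNge => h; rewrite derive1E.
rewrite (near_eq_derive (g := cst 0)) ?derive_cst//.
case/orP : h => h; near=> s; apply: plateau_eq0; rewrite negb_and -!leNgt; apply/orP.
  by left; apply: ltW; near: s; exact: lt_nbhsl.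
by right; apply: ltW; near: s; exact: lt_nbhsr.
Unshelve. all: by end_near. Qed.

End plateau.

(** * The one-dimensional capacity *)

Section test_inequality.
Context {R : realType}.
Implicit Types p k l s : R.

Lemma powR_inv_sub1 l p : 0 < l -> (l^-1) `^ (p - 1) = l `^ (1 - p).
Proof.
by move=> l0; rewrite -powR_inv1 ?ltW// -powRrM; congr (_ `^ _); ring.
Qed.

Lemma powR_inv_mul l p : 0 < l -> (l^-1) `^ p * l = l `^ (1 - p).
Proof.
move=> l0; rewrite -[X in _ * X]powRr1 ?ltW// -powR_inv1 ?ltW// -powRrM -powRD.
  by congr (_ `^ _); ring.
by apply/implyP => _; rewrite gt_eqF.
Qed.

Lemma powR_tangent p k s : 1 < p -> 0 < k ->
  p * k `^ (p - 1) * s - (p - 1) * k `^ p <= `|s| `^ p.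
Proof.
move=> p1 k0; have p0 : 0 < p by lra.
have p10 : 0 < p - 1 by lra.
pose q := p / (p - 1).
have q0 : 0 < q by rewrite divr_gt0.
have pq : p^-1 + q^-1 = 1.
  by rewrite /q invf_div; field; rewrite gt_eqF.
have := conjugate_powR (normr_ge0 s) (powR_ge0 k (p - 1)) p0 q0 pq.
rewrite -powRrM (_ : (p - 1) * q = p); last by rewrite /q; field; rewrite gt_eqF.
rewrite (_ : k `^ p / q = (p - 1) / p * k `^ p); last first.
  by rewrite /q invf_div mulrC.
rewrite -(ler_pM2l p0).
rewrite (_ : p * (_ + _) = `|s| `^ p + (p - 1) * k `^ p); last by field; rewrite gt_eqF.
move=> h; rewrite lerBlDr; apply: le_trans h.
by rewrite -mulrA ler_pM2l// mulrC ler_wpM2r ?powR_ge0// ler_norm.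
Qed.

Lemma bounded_by (T : Type) (D : set T) (h : T -> R) (M : R) :
  (forall x, D x -> `|h x| <= M) -> [bounded h x | x in D].
Proof.
move=> hM; exists M; split; rewrite ?num_real// => y My x Dx.
by apply: le_trans (hM x Dx) _; exact: ltW.
Qed.

Local Open Scope ereal_scope.

Lemma integrableM_bounded d (T : measurableType d) (mu : {measure set T -> \bar R})
    (D : set T) (f h : T -> R) (M : R) : measurable D ->
  mu.-integrable D (EFin \o f) -> measurable_fun D h ->
  (forall x, D x -> (`|h x| <= M)%R) ->
  mu.-integrable D (fun x => (f x * h x)%:E).
Proof.
move=> mD fi mh hM.
by have := integrableMl mD fi mh (bounded_by hM).
Qed.

(* [powR_tangent] at [s = w], weighted by [phi]. *)
Lemma energy_test d (T : measurableType d) (mu : {measure set T -> \bar R})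
    (D : set T) (F w phi : T -> R) (p k I J : R) :
  measurable D -> (1 < p)%R -> (0 < k)%R ->
  measurable_fun D F -> measurable_fun D phi ->
  mu.-integrable D (EFin \o phi) ->
  mu.-integrable D (fun x => (w x * phi x)%:E) ->
  (forall x, D x -> (`|w x| <= F x)%R) ->
  (forall x, D x -> (0 <= phi x <= 1)%R) ->
  I%:E <= \int[mu]_(x in D) (w x * phi x)%:E ->
  \int[mu]_(x in D) (phi x)%:E <= J%:E ->
  (p * k `^ (p - 1) * I - (p - 1) * k `^ p * J)%:E <=
  \int[mu]_(x in D) (F x `^ p)%:E.
Proof.
move=> mD p1 k0 mF mphi phii wphii wF phi01 II JJ.
have [->|Foo] := eqVneq (\int[mu]_(x in D) (F x `^ p)%:E) +oo; first exact: leey.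
have mFp : measurable_fun D (fun x => (F x `^ p)%:E).
  by apply/measurable_EFinP; apply: (measurableT_comp (measurable_powR p)).
have Fi : mu.-integrable D (fun x => (F x `^ p)%:E).
  apply/integrableP; split => //.
  under eq_integral do rewrite abse_EFin ger0_norm ?powR_ge0//.
  by rewrite ltey.
pose c1 := (p * k `^ (p - 1))%R; pose c2 := ((p - 1) * k `^ p)%R.
have c10 : (0 <= c1)%R by rewrite mulr_ge0 ?powR_ge0//; lra.
have c20 : (0 <= c2)%R by rewrite mulr_ge0 ?powR_ge0//; lra.
have c1E : 0 <= c1%:E by rewrite lee_fin.
have c2E : 0 <= c2%:E by rewrite lee_fin.
have i1 := integrableZl mD c1 wphii.
have i2 := integrableZl mD c2 phii.
apply: (@le_trans _ _ (\int[mu]_(x in D) (c1%:E * (w x * phi x)%:E - c2%:E * (phi x)%:E))).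
  rewrite integralB// !integralZl// EFinB; apply: leeB.
    by rewrite -/c1 EFinM; exact (lee_wpmul2l c1E II).
  by rewrite -/c2 EFinM; exact (lee_wpmul2l c2E JJ).
apply: le_integral => //; first exact: integrableB.
move=> x /set_mem Dx; rewrite -!EFinM -EFinB lee_fin.
have /andP[h0 h1] := phi01 x Dx.
apply: (@le_trans _ _ (`|w x| `^ p * phi x))%R.
  rewrite mulrA -mulrBl ler_wpM2r//; exact: powR_tangent.
rewrite -[leRHS]mulr1; rewrite ler_pM ?powR_ge0//.
have F0 : (0 <= F x)%R by apply: le_trans (wF x Dx).
by rewrite ge0_ler_powR ?nnegrE ?wF//; lra.
Qed.

End test_inequality.

Section calculus.
Context {R : realType}.
Local Notation mu := (@lebesgue_measure R).
Local Open Scope ereal_scope.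

Lemma derivable_LRcontinuous (F : R -> R) (a b : R) :
  (forall x, derivable F x 1) -> derivable_oo_LRcontinuous F a b.
Proof.
move=> dF; have cF : continuous F.
  by move=> x; apply: differentiable_continuous; apply/derivable1_diffP.
by split => [x _||]; [exact: dF|exact/cvg_at_right_filter/cF|exact/cvg_at_left_filter/cF].
Qed.

Lemma integral_derive1 (F : R -> R) (a b : R) : (a <= b)%R ->
  (forall x, derivable F x 1) -> continuous (derive1 F) ->
  \int[mu]_(x in `[a, b]) (derive1 F x)%:E = (F b - F a)%:E.
Proof.
rewrite le_eqVlt => /orP[/eqP <-|ab] dF cF.
  by rewrite set_itv1 integral_set1 subrr.
rewrite EFinB; apply: (@continuous_FTC2 _ (derive1 F) F a b ab).
- exact: continuous_subspaceT.
- exact: derivable_LRcontinuous.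
- by [].
Qed.

Lemma integral_affine_derive1 (s r : R) (F : R -> R) (a b : R) : (a < b)%R ->
  (forall x, derivable F x 1) -> continuous (derive1 F) ->
  \int[mu]_(x in `[a, b]) ((s * x + r) * derive1 F x)%:E =
  ((s * b + r) * F b - (s * a + r) * F a)%:E -
  \int[mu]_(x in `[a, b]) (s * F x)%:E.
Proof.
move=> ab dF cF; pose G (x : R) := (s * x + r)%R.
have sG : smooth1 G by exact: smooth1_affine.
have G' : derive1 G = cst s.
  apply/funext => x; rewrite derive1E.
  have -> : G = (s \*: (@id R) + cst r)%R by [].
  by rewrite deriveD// deriveZ// derive_id derive_cst addr0 /GRing.scale/= mulr1.
apply: (@integration_by_parts _ G F (cst s) (derive1 F) a b ab).
- by apply: continuous_subspaceT => x; exact: cst_continuous.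
- by apply: derivable_LRcontinuous => x; exact: smooth1_derivable.
- by move=> x _; rewrite G'.
- exact: continuous_subspaceT.
- exact: derivable_LRcontinuous.
- by [].
Qed.

End calculus.

Section weighted_capacity.
Context {R : realType}.
Implicit Types (a b p : R) (v w phi : R -> R).
Local Notation mu := (@lebesgue_measure R).
Local Open Scope ereal_scope.

Lemma closure_support_sub (T : topologicalType) (f : T -> R) (A : set T) :
  closed A -> (forall x, ~ A x -> f x = 0%R) -> closure [set x | f x != 0%R] `<=` A.
Proof.
move=> cA fA; rewrite closureE; apply: smallest_sub => // x /= fx.
by apply: contrapT => /fA /eqP; rewrite (negbTE fx).
Qed.

Lemma plateau_support (l r e : R) : (0 < e)%R ->
  closure [set x | plateau l r e x != 0%R] `<=` `[(l - e)%R, (r + e)%R].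
Proof.
move=> e0; apply: closure_support_sub; first exact: interval_closed.
move=> x /= xI; apply: plateau_eq0 => //; apply/negP => /andP[lx xr]; apply: xI.
by rewrite /= in_itv/= !ltW.
Qed.

Lemma test_function1_plateau a b (l r e : R) : (0 < e)%R -> (l <= r)%R ->
  (a < l - e)%R -> (r + e < b)%R -> test_function1 a b (plateau l r e).
Proof.
move=> e0 lr al rb; split.
- exact/smooth1P/smooth1_plateau.
- apply: subclosed_compact (plateau_support (l := l) (r := r) e0).
    exact: closed_closure.
  exact: segment_compact.
- move=> x /(plateau_support e0); rewrite /= !in_itv/= => /andP[lx xr].
  by rewrite (lt_le_trans al lx) (le_lt_trans xr rb).
Qed.

Lemma continuous_segment_bounded a b (f : R -> R) : continuous f ->
  exists M, forall x, x \in `[a, b]%R -> (`|f x| <= M)%R.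
Proof.
move=> cf.
have /compact_bounded[M [_ MP]] : compact (f @` `[a, b]%classic).
  by apply: continuous_compact; [exact: continuous_subspaceT|exact: segment_compact].
exists (M + 1)%R => x xab; apply: (MP (M + 1)%R); first by rewrite ltrDl.
by exists x.
Qed.

Lemma absolutely_continuous_modulus a b v (eta : R) : (0 < eta)%R ->
  absolutely_continuous a b v -> exists2 delta, (0 < delta)%R &
  forall s t, (a <= s)%R -> (s <= t)%R -> (t <= b)%R -> (t - s < delta)%R ->
    (`|v t - v s| < eta)%R.
Proof.
move=> e0 /(_ _ e0)[delta d0 H]; exists delta => // s t as_ st tb std.
have := H 1%N (fun=> s) (fun=> t); rewrite !big_ord1; apply => //.
by move=> i j _ _ _; rewrite (ord1 i) (ord1 j).
Qed.

Lemma energy1_lower_bound p a b v w : (1 < p)%R -> (a < b)%R ->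
  sobolev11 a b v w -> absolutely_continuous a b v -> v a = 0%R -> v b = 1%R ->
  ((b - a) `^ (1 - p))%:E <= \int[mu]_(t in `]a, b[) (`|w t| `^ p)%:E.
Proof.
move=> p1 ab [vi wi vw] vac va vb.
pose l := (b - a)%R; have l0 : (0 < l)%R by rewrite subr_gt0.
pose C := (l `^ (1 - p))%R; have C0 : (0 <= C)%R by exact: powR_ge0.
have mab : measurable `]a, b[%classic by exact: measurable_itv.
suff key (eta : R) : (0 < eta)%R ->
    (C - 2 * p * C * eta)%:E <= \int[mu]_(t in `]a, b[) (`|w t| `^ p)%:E.
  apply/lee_addgt0Pr => e e0.
  have c0 : (0 < 2 * p * C + 1)%R by rewrite ltr_wpDl// !mulr_ge0//; lra.
  rewrite -leeBlDr//; apply: le_trans (key (e / (2 * p * C + 1))%R _); last by rewrite divr_gt0.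
  rewrite -EFinB lee_fin lerB// mulrA ler_pdivrMr// mulrDr mulr1 [(e * _)%R]mulrC.
  by rewrite lerDl ltW.
move=> eta0.
have [delta d0 vd] := absolutely_continuous_modulus eta0 vac.
pose e := (Num.min delta l / 8)%R.
have e0 : (0 < e)%R by rewrite divr_gt0// lt_min d0.
have ed : (8 * e <= delta)%R by rewrite mulrC divfK// ge_min lexx.
have el : (8 * e <= b - a)%R by rewrite mulrC divfK// ge_min lexx orbT.
have [m [am mb am2 mb2]] : exists m, [/\ a < m, m < b, a + 2 * e < m & m < b - 2 * e]%R.
  by exists ((a + b) / 2)%R; split; clear - ab el e0; lra.
pose phi := plateau (a + 2 * e) (b - 2 * e) e.
have lr : (a + 2 * e <= b - 2 * e)%R by exact/ltW/(lt_trans am2 mb2).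
have tphi : test_function1 a b phi by apply: test_function1_plateau => //; clear - e0; lra.
have sphi : smooth1 phi by exact: smooth1_plateau.
pose psi : R -> R := derive1 phi.
have dphi x : derivable phi x 1 by exact: smooth1_derivable.
have cphi' : continuous (psi) by exact/smooth1_continuous/smooth1_derive.
have mphi : measurable_fun setT phi.
  by apply: continuous_measurable_fun; apply: smooth1_continuous.
have mphi' : measurable_fun setT (psi) by exact: continuous_measurable_fun.
have [M phi'M] := continuous_segment_bounded a b cphi'.
have phi01 x : (0 <= phi x <= 1)%R by rewrite plateau_ge0 plateau_le1.
have phi_norm x : (`|phi x| <= 1)%R.
  by rewrite ger0_norm; [exact: plateau_le1|exact: plateau_ge0].
have sub x : `]a, b[%classic x -> x \in `[a, b]%R.
  by rewrite /= !in_itv/= => /andP[h1 h2]; rewrite !ltW.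
have vphi'i : mu.-integrable `]a, b[ (fun t => (v t * psi t)%:E).
  apply: (integrableM_bounded (M := M)) => //; first exact: measurable_funTS.
  by move=> x /sub; exact: phi'M.
have lab : mu `]a, b[%classic = (b - a)%:E.
  by rewrite lebesgue_measure_itv/= lte_fin ab EFinB.
have onei : mu.-integrable `]a, b[ (EFin \o (cst 1%R : R -> R)).
  apply: measurable_bounded_integrable => //; first by rewrite [X in X < _]lab ltry.
  by apply: (bounded_by (M := 1%R)) => x _; rewrite normr1.
have phii : mu.-integrable `]a, b[ (EFin \o phi).
  apply: measurable_bounded_integrable => //.
  - by rewrite [X in X < _]lab ltry.
  - exact: measurable_funTS.
  - exact: (bounded_by (M := 1%R)).
have wphii : mu.-integrable `]a, b[ (fun t => (w t * phi t)%:E).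
  by apply: (integrableM_bounded (M := 1%R)) => //; exact: measurable_funTS.
have phia : phi a = 0%R by apply: plateau_eq0 => //; rewrite negb_and -!leNgt; apply/orP; left; clear - e0; lra.
have phib : phi b = 0%R by apply: plateau_eq0 => //; rewrite negb_and -!leNgt; apply/orP; right; clear - e0; lra.
have phim : phi m = 1%R by apply: plateau_eq1 => //; rewrite !ltW.
have intphi' x y (b0 b1 : bool) : (x < y)%R ->
    \int[mu]_(t in [set` Interval (BSide b0 x) (BSide b1 y)]) (psi t)%:E =
    (phi y - phi x)%:E.
  move=> xy; have mphi'xy : measurable_fun `]x, y[ (EFin \o psi).
    by apply/measurable_EFinP; exact: measurable_funTS.
  rewrite (integral_itv_bndoo _ _ mphi'xy) -(integral_itv_bndoo true false mphi'xy).
  by apply: integral_derive1 => //; exact: ltW.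
have phi'i : mu.-integrable `]a, b[ (EFin \o psi).
  apply: measurable_bounded_integrable => //.
  - by rewrite [X in X < _]lab ltry.
  - exact: measurable_funTS.
  - by apply: (bounded_by (M := M)) => x /sub; exact: phi'M.
have vleft t : (a < t)%R -> (t < m)%R -> (v t * psi t <= eta * psi t)%R.
  move=> at_ tm; have tb2 := lt_trans tm mb2.
  have [ta|ta] := leP t (a + 2 * e)%R.
    rewrite ler_wpM2r//; first exact: plateau_derive1_ge0.
    apply: le_trans (ler_norm _) _; rewrite -[v t]subr0 -va; apply/ltW/vd => //.
    - exact: ltW.
    - by clear - tb2 e0; lra.
    - by clear - ta ed e0; lra.
  suff -> : psi t = 0%R by rewrite !mulr0.
  apply/eqP; rewrite eq_le; apply/andP; split; first exact: plateau_derive1_le0.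
  exact: plateau_derive1_ge0.
have vright t : (m <= t)%R -> (t < b)%R ->
    (v t * psi t <= (1 - eta) * psi t)%R.
  move=> mt tb; have at2 := lt_le_trans am2 mt.
  have p0 : (psi t <= 0)%R by exact: plateau_derive1_le0.
  have [tb2|tb2] := ltP t (b - 2 * e)%R.
    suff -> : psi t = 0%R by rewrite !mulr0.
    apply/eqP; rewrite eq_le p0; exact: plateau_derive1_ge0.
  rewrite ler_wnM2r//.
  have : (`|v b - v t| < eta)%R.
    apply: vd => //; [|exact: ltW|].
    - by clear - at2 e0; lra.
    - by clear - tb2 ed e0; lra.
  by rewrite vb ltr_norml => /andP[_]; clear; lra.
have int_vphi' : \int[mu]_(t in `]a, b[) (v t * psi t)%:E <= (2 * eta - 1)%:E.
  have ab_split : `]a, b[%classic = `]a, m[%classic `|` `[m, b[%classic.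
    by rewrite -itv_bndbnd_setU// bnd_simp; exact: ltW.
  have am_sub : `]a, m[%classic `<=` `]a, b[%classic by rewrite ab_split; exact: subsetUl.
  have mb_sub : `[m, b[%classic `<=` `]a, b[%classic by rewrite ab_split; exact: subsetUr.
  have le_part (D : set R) (c : R) : measurable D -> D `<=` `]a, b[%classic ->
      (forall t, D t -> (v t * psi t <= c * psi t)%R) ->
      \int[mu]_(t in D) (v t * psi t)%:E <=
      c%:E * \int[mu]_(t in D) (psi t)%:E.
    move=> mD Dab vc; have Di : mu.-integrable D (EFin \o psi).
      exact: integrableS phi'i.
    rewrite -integralZl//; apply: le_integral => //.
    - exact: integrableS vphi'i.
    - exact: integrableZl.
    - by move=> t /set_mem Dt; rewrite -EFinM lee_fin vc.
  rewrite [in leLHS]ab_split integral_setU//; last 2 first.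
  - by rewrite -ab_split; case/integrableP : vphi'i.
  - apply/disj_setPS => x [] /=; rewrite !in_itv/= => /andP[_ xm] /andP[mx _].
    by have := lt_le_trans xm mx; rewrite ltxx.
  have H1 : \int[mu]_(t in `]a, m[) (v t * psi t)%:E <= eta%:E.
    apply: le_trans (le_part _ eta _ am_sub _) _ => //.
      by move=> t; rewrite /= in_itv/= => /andP[]; exact: vleft.
    by rewrite intphi'// phim phia subr0 mule1.
  have H2 : \int[mu]_(t in `[m, b[) (v t * psi t)%:E <= (- (1 - eta))%:E.
    apply: le_trans (le_part _ (1 - eta)%R _ mb_sub _) _ => //.
      by move=> t; rewrite /= in_itv/= => /andP[]; exact: vright.
    by rewrite intphi'// phim phib sub0r -EFinM mulrN1.
  apply: le_trans (leeD H1 H2) _; rewrite -EFinD lee_fin; clear; lra.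
have young := @energy_test R _ _ mu `]a, b[%classic (fun t => `|w t|%R) w phi p
  l^-1%R (1 - 2 * eta)%R l mab p1.
rewrite (_ : (C - 2 * p * C * eta)%R = (p * l^-1 `^ (p - 1) * (1 - 2 * eta) -
    (p - 1) * l^-1 `^ p * l)%R); last first.
  rewrite powR_inv_sub1// -[((p - 1) * _ * l)%R]mulrA powR_inv_mul// -/C.
  by clear; ring.
apply: young => //.
- by rewrite invr_gt0.
- by apply: measurableT_comp => //; case/integrableP : wi => /measurable_EFinP.
- exact: measurable_funTS.
- have := vw _ tphi; rewrite -[X in X = _ -> _]oppeK => /oppe_inj <-.
  by rewrite leeNr -EFinN; apply: le_trans int_vphi' _; rewrite lee_fin; clear; lra.
- rewrite -lab -[leRHS]mul1e -(integral_cst mu mab 1).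
  by apply: le_integral => // t _; rewrite lee_fin; exact: plateau_le1.
Qed.

Lemma absolutely_continuous_affine a b (s r : R) :
  absolutely_continuous a b (fun t => s * t + r)%R.
Proof.
move=> e e0; exists (e / (`|s| + 1))%R; first by rewrite divr_gt0// ltr_wpDl.
move=> k x y xy _; rewrite ltr_pdivlMr ?ltr_wpDl// => H.
apply: le_lt_trans H; rewrite mulr_suml; apply: ler_sum => i _.
have [_ [xyi _]] := xy i.
rewrite opprD addrACA subrr addr0 -mulrBr normrM [leRHS]mulrC.
by rewrite [`|y i - x i|%R]ger0_norm ?subr_ge0// ler_wpM2r ?subr_ge0// lerDl.
Qed.

Lemma sobolev11_affine a b (s r : R) : (a < b)%R ->
  sobolev11 a b (fun t => s * t + r)%R (cst s).
Proof.
move=> ab; have mab : measurable `]a, b[%classic by exact: measurable_itv.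
have lab : mu `]a, b[%classic = (b - a)%:E.
  by rewrite lebesgue_measure_itv/= lte_fin ab EFinB.
have cf : continuous (fun t : R => s * t + r)%R.
  exact/smooth1_continuous/smooth1_affine.
split.
- have [M fM] := continuous_segment_bounded a b cf.
  apply: measurable_bounded_integrable => //.
  + by rewrite [X in X < _]lab ltry.
  + by apply: measurable_funTS; exact: continuous_measurable_fun.
  + apply: (bounded_by (M := M)) => x; rewrite /= in_itv/= => /andP[ax xb].
    by apply: fM; rewrite in_itv/= !ltW.
- apply: measurable_bounded_integrable => //.
  + by rewrite [X in X < _]lab ltry.
  + by apply: (bounded_by (M := `|s|%R)).
move=> phi [dphi _ supp].
have sphi : smooth1 phi by apply/smooth1P.
have phi0 x : ~ `]a, b[%classic x -> phi x = 0%R.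
  move=> xab; apply: contrapT => /eqP phix; apply/xab/supp.
  exact: subset_closure.
have phia : phi a = 0%R by apply: phi0; rewrite /= in_itv/= ltxx.
have phib : phi b = 0%R by apply: phi0; rewrite /= in_itv/= ltxx andbF.
have mphi : measurable_fun setT phi.
  by apply: continuous_measurable_fun; exact: smooth1_continuous.
have mphi' : measurable_fun setT (derive1 phi : R -> R).
  by apply: continuous_measurable_fun; exact/smooth1_continuous/smooth1_derive.
have m1 : measurable_fun `]a, b[ (fun t => ((s * t + r) * derive1 phi t)%:E).
  apply/measurable_EFinP/measurable_funTS; apply: measurable_funM => //.
  exact: continuous_measurable_fun.
have m2 : measurable_fun `]a, b[ (fun t => (s * phi t)%:E).
  by apply/measurable_EFinP/measurable_funTS; exact: measurable_funM.
rewrite -(integral_itv_bndoo true false m1) -(integral_itv_bndoo true false m2).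
rewrite integral_affine_derive1//.
- by rewrite phia phib !mulr0 subrr sub0e.
- by move=> x; exact: smooth1_derivable.
- exact/smooth1_continuous/smooth1_derive.
Qed.

Lemma weighted_capacityE n (p : R) (U : set 'rV[R]_n.+1) theta a b (h : R) :
  (1 < p)%R -> (a < b)%R -> (0 <= h)%R ->
  (forall t, (a < t < b)%R -> energy_weight p U theta t = h%:E) ->
  weighted_capacity p U theta a b = h%:E * ((b - a) `^ (1 - p))%:E.
Proof.
move=> p1 ab h0 wh; have mab : measurable `]a, b[%classic by exact: measurable_itv.
have ba : (0 < b - a)%R by rewrite subr_gt0.
have wE (w : R -> R) : measurable_fun `]a, b[ w -> weighted_energy p U theta a b w =
    h%:E * \int[mu]_(t in `]a, b[) (`|w t| `^ p)%:E.
  move=> mw; rewrite /weighted_energy -ge0_integralZl_EFin//.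
  - apply: eq_integral => t /set_mem; rewrite /= in_itv/= => tab.
    by rewrite wh// muleC.
  - apply/measurable_EFinP; apply: (measurableT_comp (measurable_powR p)).
    exact: measurableT_comp.
apply/eqP; rewrite eq_le; apply/andP; split; last first.
  apply: le_ereal_inf_tmp => _ [v [w [vw vac [va vb] _ ->]]].
  have mw : measurable_fun `]a, b[ w.
    by have [_ /integrableP[/measurable_EFinP + _] _] := vw.
  rewrite (wE _ mw); apply: lee_wpmul2l; first by rewrite lee_fin.
  exact: energy1_lower_bound vw vac va vb.
pose k := (b - a)^-1%R.
have kE : weighted_energy p U theta a b (cst k) = h%:E * ((b - a) `^ (1 - p))%:E.
  rewrite wE//; congr (_ * _).
  have lab : mu `]a, b[%classic = (b - a)%:E.
    by rewrite lebesgue_measure_itv/= lte_fin ab EFinB.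
  rewrite (@integral_cst _ _ _ mu _ mab (`|k| `^ p)%:E) [X in _ * X]lab.
  by rewrite -EFinM ger0_norm ?invr_ge0 ?(ltW ba)// powR_inv_mul.
rewrite -kE; apply: ereal_inf_lbound; exists (fun t => k * t + - (k * a))%R, (cst k); split => //.
- exact: sobolev11_affine.
- exact: absolutely_continuous_affine.
- by rewrite subrr -mulrBr mulVf ?gt_eqF.
- by rewrite kE -EFinM ltry.
Qed.

End weighted_capacity.

(** * Integration by parts in several variables *)

Section compactly_supported.
Context {R : realType}.
Implicit Types n : nat.
Local Notation mu := (@lebesgue_measure R).
Local Open Scope ereal_scope.

Definition vanishes_off n (N : R) (f : 'rV[R]_n -> R) :=
  forall (x : 'rV[R]_n) i, (N < `|x ord0 i|)%R -> f x = 0%R.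

Definition segment_box n (N : R) : set 'rV[R]_n := box (fun=> `[(- N)%R, N]%classic).

Lemma vanishes_offP n N (f : 'rV[R]_n -> R) x :
  vanishes_off N f -> ~ segment_box N x -> f x = 0%R.
Proof.
move=> fN xN; apply: contrapT => fx; apply: xN => i; rewrite /= in_itv/= -ler_norml.
by rewrite leNgt; apply/negP => /fN.
Qed.

Lemma coord_le_norm n (x : 'rV[R]_n) i : (`|x ord0 i| <= `|x|)%R.
Proof.
by rewrite [leRHS]mx_normrE; exact: (le_bigmax _ (fun ij => `|x ij.1 ij.2|%R) (ord0, i)).
Qed.

Lemma measurable_segment_box n N : measurable (@segment_box n N).
Proof. by apply: measurable_box => i; exact: measurable_itv. Qed.

Lemma segment_box_fin n N : lebesgue_rV n (segment_box N) < +oo.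
Proof.
have [N0|N0] := leP 0%R N.
  rewrite (@lebesgue_rV_box _ _ _ (fun=> (N - - N)%R)) ?ltry//.
  move=> i; rewrite lebesgue_measure_itv/= lte_fin; case: ltP => h.
    by rewrite EFinB.
  by congr _%:E; lra.
rewrite (@lebesgue_rV_box _ _ _ (fun=> 0%R)) ?ltry//.
move=> i; rewrite lebesgue_measure_itv/= lte_fin; case: ltP => // h.
by exfalso; lra.
Qed.

Lemma bounded_set_segment_box n (A : set 'rV[R]_n) :
  bounded_set A -> exists2 N, (0 < N)%R & A `<=` segment_box N.
Proof.
move=> [M [_ MP]]; exists (`|M| + 1)%R; first by rewrite ltr_wpDl.
move=> x Ax i; rewrite /= in_itv/= -ler_norml; apply: le_trans (coord_le_norm x i) _.
by apply: (MP _ _ x Ax); rewrite ltr_pwDr// ler_norm.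
Qed.

Lemma bounded_set_fin n (A : set 'rV[R]_n) : measurable A -> bounded_set A ->
  lebesgue_rV n A < +oo.
Proof.
move=> mA /bounded_set_segment_box[N _ AN].
apply: le_lt_trans (segment_box_fin n N); apply: le_measure => //; rewrite inE//.
exact: measurable_segment_box.
Qed.

Lemma vanishes_off_bounded n N (f : 'rV[R]_n -> R) :
  continuous f -> vanishes_off N f -> exists2 M, (0 <= M)%R & forall x, (`|f x| <= M)%R.
Proof.
move=> cf fN.
have /compact_bounded[M [_ MP]] : compact (f @` @segment_box n N).
  apply: continuous_compact; first exact: continuous_subspaceT.
  by apply: (@rV_compact _ _ (fun=> `[(- N)%R, N]%classic)) => i; exact: segment_compact.
exists (`|M| + 1)%R => [|x]; first by rewrite addr_ge0.
have [xN|xN] := pselect (segment_box N x).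
  apply: (MP (`|M| + 1)%R); first by rewrite ltr_pwDr// ler_norm.
  by exists x.
by rewrite (vanishes_offP fN xN) normr0 addr_ge0.
Qed.

Lemma integral_subset_vanishing d (T : measurableType d) (nu : {measure set T -> \bar R})
    (A B : set T) (f : T -> \bar R) : A `<=` B ->
  (forall x, B x -> ~ A x -> f x = 0) -> \int[nu]_(x in B) f x = \int[nu]_(x in A) f x.
Proof.
move=> AB fA; rewrite integral_mkcond [RHS]integral_mkcond; apply: eq_integral => x _.
rewrite !patchE; case: (boolP (x \in A)) => [/set_mem Ax|/negP xA].
  by rewrite mem_set//; exact: AB.
case: ifPn => // /set_mem Bx; apply: fA => // Ax; apply: xA; exact: mem_set.
Qed.

Lemma integral_vanishing d (T : measurableType d) (nu : {measure set T -> \bar R})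
    (A : set T) (f : T -> \bar R) :
  (forall x, ~ A x -> f x = 0) -> \int[nu]_x f x = \int[nu]_(x in A) f x.
Proof.
by move=> fA; apply: integral_subset_vanishing => // x _; exact: fA.
Qed.

Lemma integrable_vanishing d (T : measurableType d) (nu : {measure set T -> \bar R})
    (A : set T) (f : T -> \bar R) : measurable A ->
  (forall x, ~ A x -> f x = 0) -> nu.-integrable A f -> nu.-integrable setT f.
Proof.
move=> mA fA /(integrable_mkcond _ mA); congr (is_true (integrable _ _ _)).
apply/funext => x; rewrite patchE; case: ifPn => // /negP xA.
by rewrite fA// => Ax; apply: xA; rewrite inE.
Qed.

Lemma vanishes_off_integrable n N (f : 'rV[R]_n -> R) (D : set 'rV[R]_n) :
  measurable D -> continuous f -> vanishes_off N f ->
  (lebesgue_rV n).-integrable D (EFin \o f).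
Proof.
move=> mD cf fN; have [M M0 fM] := vanishes_off_bounded cf fN.
apply: (@integrableS _ _ _ _ setT) => //.
apply: (@integrable_vanishing _ _ _ (@segment_box n N)).
- exact: measurable_segment_box.
- by move=> x xN /=; rewrite (vanishes_offP fN xN).
- apply: measurable_bounded_integrable.
  + exact: measurable_segment_box.
  + exact: segment_box_fin.
  + by apply: measurable_funTS; exact: continuous_measurable_rV.
  + exact: (bounded_by (M := M)).
Qed.

Lemma vanishes_off_partial n N (f : 'rV[R]_n -> R) i :
  vanishes_off N f -> vanishes_off N (partial i f).
Proof.
move=> fN x j xj; rewrite /partial.
rewrite (near_eq_derive (g := cst 0%R)); first by rewrite derive_cst.
have : \forall y \near nbhs x, (N < `|(y : 'rV[R]_n) ord0 j|)%R.
  have /cvg_norm h := @coord_continuous R 1 n ord0 j x.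
  exact: (cvgr_gt _ h).
by apply: filterS => y; exact: fN.
Qed.

Lemma continuous_rV (T : topologicalType) n (f : T -> 'rV[R]_n) :
  (forall j, continuous (fun x => f x ord0 j)) -> continuous f.
Proof.
move=> cf x A [P xP PA].
have FF : Filter (nbhs x) by exact: nbhs_filter.
have H := @filter_forall _ _ (fun j => [set y | P ord0 j (f y ord0 j)]) (nbhs x) FF
  (fun j => cf j x _ (xP ord0 j)).
apply: (@filterS _ _ FF _ _ _ H) => y yP; apply: PA => i j.
by rewrite (ord1 i); exact: yP.
Qed.

Lemma cons_rV_continuous_r n (t : R) : continuous (fun y : 'rV[R]_n => cons_rV (t, y)).
Proof.
apply: continuous_rV => j; case: (unliftP ord0 j) => [k|] ->.
  under eq_fun do rewrite cons_rVS; exact: (@coord_continuous R 1 n ord0 k).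
under eq_fun do rewrite cons_rV0/=; exact: cst_continuous.
Qed.

Lemma cons_rV_continuous_l n (y : 'rV[R]_n) : continuous (fun t : R => cons_rV (t, y)).
Proof.
apply: continuous_rV => j; case: (unliftP ord0 j) => [k|] ->.
  under eq_fun do rewrite cons_rVS/=; exact: cst_continuous.
by under eq_fun do rewrite cons_rV0/=; move=> t.
Qed.

Let cons_rVD_l n (h t : R) (y : 'rV[R]_n) :
  (h *: delta_mx ord0 ord0 + cons_rV (t, y))%R = cons_rV ((h + t)%R, y).
Proof.
apply/rowP => i; rewrite !mxE eqxx/=; case: unliftP => [j|] ->.
  by rewrite mulr0 add0r.
by rewrite eqxx mulr1.
Qed.

Let cons_rVD_r n (h t : R) (y : 'rV[R]_n) j :
  (h *: delta_mx ord0 (lift ord0 j) + cons_rV (t, y))%R =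
  cons_rV (t, (h *: delta_mx ord0 j + y)%R).
Proof.
apply/rowP => i; rewrite !mxE eqxx/=; case: unliftP => [k|] ->.
  by rewrite !mxE (inj_eq lift_inj) eqxx.
by rewrite mulr0 add0r.
Qed.

Lemma derive_slice_l n (f : 'rV[R]_n.+1 -> R) t y :
  derive1 (fun t => f (cons_rV (t, y))) t = partial ord0 f (cons_rV (t, y)).
Proof.
rewrite /derive1 /partial /derive; set d := (fun _ : R => _); set d' := (fun _ : R => _).
by suff -> : d = d' by []; apply/funext => h; rewrite /d /d' /= cons_rVD_l.
Qed.

Lemma derivable_slice_l n (f : 'rV[R]_n.+1 -> R) (t : R) y :
  derivable f (cons_rV (t, y)) (delta_mx ord0 ord0) ->
  derivable (fun t => f (cons_rV (t, y))) t 1.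
Proof.
rewrite /derivable; set d := (fun _ : R => _); set d' := (fun _ : R => _).
by suff -> : d = d' by []; apply/funext => h; rewrite /d /d' /= cons_rVD_l [(h *: 1)%R]mulr1.
Qed.

Lemma derive_slice_r n (f : 'rV[R]_n.+1 -> R) t y j :
  partial j (fun y => f (cons_rV (t, y))) y = partial (lift ord0 j) f (cons_rV (t, y)).
Proof.
rewrite /partial /derive; set d := (fun _ : R => _); set d' := (fun _ : R => _).
by suff -> : d = d' by []; apply/funext => h; rewrite /d /d' /= cons_rVD_r.
Qed.

Lemma derivable_slice_r n (f : 'rV[R]_n.+1 -> R) t y j :
  derivable f (cons_rV (t, y)) (delta_mx ord0 (lift ord0 j)) ->
  derivable (fun y => f (cons_rV (t, y))) y (delta_mx ord0 j).
Proof.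
rewrite /derivable; set d := (fun _ : R => _); set d' := (fun _ : R => _).
by suff -> : d = d' by []; apply/funext => h; rewrite /d /d' /= cons_rVD_r.
Qed.

End compactly_supported.

Section integration_by_parts_rV.
Context {R : realType}.
Implicit Types n : nat.
Local Notation mu := (@lebesgue_measure R).
Local Open Scope ereal_scope.

Lemma integral_derive1_vanishing (F : R -> R) (N : R) :
  (forall t, derivable F t 1) -> continuous (derive1 F) ->
  (forall t, (N < `|t|)%R -> F t = 0%R) ->
  \int[mu]_t (derive1 F t)%:E = 0.
Proof.
move=> dF cF FN; pose M := (`|N| + 1)%R.
have NM : (N < M)%R by rewrite ltr_pwDr// ler_norm.
have M0 : (0 < M)%R by rewrite ltr_wpDl.
have -> : \int[mu]_t (derive1 F t)%:E = \int[mu]_(t in `[(- M)%R, M]) (derive1 F t)%:E.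
  apply: integral_vanishing => //.
  move=> t /negP; rewrite /= in_itv/= -ler_norml -ltNge => Mt.
  congr _%:E; rewrite derive1E (near_eq_derive (g := cst 0%R)); first by rewrite derive_cst.
  have /cvgr_gt : (fun s : R => `|s|%R) @ t --> `|t|%R by apply: cvg_norm; exact: cvg_id.
  by move=> /(_ _ (lt_trans NM Mt)); apply: filterS => s; exact: FN.
rewrite integral_derive1//; last by lra.
by rewrite !FN ?subrr// ?normrN gtr0_norm.
Qed.

Lemma integral_partial n (f : 'rV[R]_n -> R) i N : continuous (partial i f) ->
  (forall x, derivable f x (delta_mx ord0 i)) -> vanishes_off N f ->
  \int[lebesgue_rV n]_x (partial i f x)%:E = 0.
Proof.
elim: n f i => [f [] //|n ih] f i cf df fN.
have pN : vanishes_off N (partial i f) by exact: vanishes_off_partial.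
have pint := vanishes_off_integrable measurableT cf pN.
case: (unliftP ord0 i) => [j|] ij; move: cf df pN pint; rewrite ij => cf df pN pint.
  rewrite (integral_rVS pint); under eq_integral => t _.
    under eq_integral => y _ do rewrite /= -derive_slice_r.
    rewrite (ih (fun y => f (cons_rV (t, y)))).
    - over.
    - rewrite (_ : partial j _ = (partial (lift ord0 j) f) \o (fun y => cons_rV (t, y))).
        by move=> y; apply: continuous_comp; [exact: cons_rV_continuous_r|exact: cf].
      by apply/funext => y; rewrite derive_slice_r.
    - by move=> y; exact: derivable_slice_r.
    - by move=> y k yk; apply: (fN _ (lift ord0 k)); rewrite cons_rVS.
  by rewrite integral0.
rewrite (integral_rVS_swap pint); under eq_integral => y _.
  under eq_integral => t _ do rewrite /= -derive_slice_l.
  rewrite (@integral_derive1_vanishing (fun t => f (cons_rV (t, y))) N).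
  - over.
  - by move=> t; exact: derivable_slice_l.
  - rewrite (_ : derive1 _ = (partial ord0 f) \o (fun t => cons_rV (t, y))).
      by move=> t; apply: continuous_comp; [exact: cons_rV_continuous_l|exact: cf].
    by apply/funext => t; rewrite derive_slice_l.
  - by move=> t Nt; apply: (fN _ ord0); rewrite cons_rV0.
by rewrite integral0.
Qed.

(** * The upper bound for the condenser capacity *)

Section ramp.
Variables a b : R.
Hypothesis ab : (a < b)%R.

Definition ramp (t : R) : R := ((Num.min (Num.max t a) b - a) / (b - a))%R.

Lemma ramp_continuous : continuous ramp.
Proof.
move=> t; apply: cvgMl; apply: cvgB; last exact: cvg_cst.
apply: (@continuous_min _ _ ((fun u : R => u) \max cst a) (cst b) t); last exact: cvg_cst.
by apply: continuous_max; [exact: cvg_id|exact: cvg_cst].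
Qed.

Let ba0 : (0 < b - a)%R. Proof. by rewrite subr_gt0. Qed.

Lemma ramp_le t : (t <= a)%R -> ramp t = 0%R.
Proof. by move=> ta; rewrite /ramp (max_idPr ta) (min_idPl (ltW ab)) subrr mul0r. Qed.

Lemma ramp_mid t : (a <= t)%R -> (t <= b)%R -> ramp t = ((t - a) / (b - a))%R.
Proof. by move=> at_ tb; rewrite /ramp (max_idPl at_) (min_idPl tb). Qed.

Lemma ramp_ge t : (b <= t)%R -> ramp t = 1%R.
Proof.
move=> bt; rewrite /ramp (max_idPl (le_trans (ltW ab) bt)) (min_idPr bt) divff//.
by rewrite gt_eqF.
Qed.

Lemma ramp_bound t : (`|ramp t| <= 1)%R.
Proof.
have [ta|at_] := leP t a; first by rewrite ramp_le// normr0.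
have [bt|tb] := leP b t; first by rewrite ramp_ge// normr1.
have t0 : (0 <= (t - a) / (b - a))%R by rewrite divr_ge0 ?subr_ge0 ?ltW.
by rewrite ramp_mid ?ltW// (ger0_norm t0) ltr_pdivrMr// mul1r ltrD2r.
Qed.

Definition ramp' (t : R) : R := if (a < t < b)%R then ((b - a)^-1)%R else 0%R.

Lemma measurable_ramp' : measurable_fun setT ramp'.
Proof.
rewrite (_ : ramp' = fun t => \1_(`]a, b[%classic : set R) t * (b - a)^-1)%R.
  by apply: measurable_funM => //; exact: measurable_indic.
apply/funext => t; rewrite /ramp' indicE mem_setE in_itv/=.
by case: ifP; rewrite ?mul1r ?mul0r.
Qed.

Lemma ramp_integration_by_parts (F : R -> R) (N : R) :
  (forall t, derivable F t 1) -> continuous (derive1 F) ->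
  (forall t, (N < `|t|)%R -> F t = 0%R) ->
  \int[mu]_t (ramp t * derive1 F t + ramp' t * F t)%:E = 0.
Proof.
move=> dF cF FN; pose M := (`|N| + `|b| + 1)%R.
have NM : (N < M)%R.
  by apply: le_lt_trans (ler_norm N) _; rewrite /M -addrA ltrDl ltr_wpDl.
have bM : (b < M)%R.
  by apply: le_lt_trans (ler_norm b) _; rewrite /M addrAC ltrDr ltr_wpDl.
pose Z t := (ramp t * derive1 F t + ramp' t * F t)%R.
have cF0 : continuous F.
  by move=> t; apply: differentiable_continuous; apply/derivable1_diffP.
have mZ : measurable_fun setT (EFin \o Z).
  apply/measurable_EFinP/measurable_funD; apply: measurable_funM.
  - exact: continuous_measurable_fun ramp_continuous.
  - exact: continuous_measurable_fun.
  - exact: measurable_ramp'.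
  - exact: continuous_measurable_fun.
have -> : \int[mu]_t (Z t)%:E = \int[mu]_(t in `]a, M]) (Z t)%:E.
  apply: integral_vanishing => //.
  move=> t /negP; rewrite /= in_itv/= negb_and -!leNgt -ltNge => /orP[ta|Mt].
    by rewrite /Z ramp_le// /ramp' ltNge ta/= !mul0r addr0.
  have Nt : (N < `|t|)%R by apply: lt_le_trans (ler_norm _); exact: lt_trans Mt.
  rewrite /Z (FN _ Nt) mulr0 addr0; congr _%:E.
  rewrite derive1E (near_eq_derive (g := cst 0%R)); first by rewrite derive_cst mulr0.
  have /cvgr_gt : (fun s : R => `|s|%R) @ t --> `|t|%R by apply: cvg_norm; exact: cvg_id.
  by move=> /(_ _ Nt); apply: filterS => s; exact: FN.
have split_ab : `]a, M]%classic = `]a, b[%classic `|` `[b, M]%classic.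
  by rewrite -itv_bndbnd_setU// bnd_simp ?ltW.
rewrite split_ab integral_setU//; last 2 first.
- exact: measurable_funTS.
- apply/disj_setPS => x [] /=; rewrite !in_itv/= => /andP[_ xm] /andP[mx _].
  by have := lt_le_trans xm mx; rewrite ltxx.
have -> : \int[mu]_(t in `[b, M]) (Z t)%:E = (- F b)%:E.
  transitivity (\int[mu]_(t in `[b, M]) (derive1 F t)%:E).
    apply: eq_integral.
    move=> t /set_mem; rewrite /= in_itv/= => /andP[bt _].
    by rewrite /Z ramp_ge// /ramp' [(t < b)%R]ltNge bt andbF mul0r addr0 mul1r.
  rewrite integral_derive1 ?(ltW bM)//; congr _%:E.
  rewrite FN ?sub0r// gtr0_norm//.
  by rewrite /M ltr_wpDl// addr_ge0.
pose s := ((b - a)^-1)%R; pose r := (- (s * a))%R.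
have sb : (s * b + r = 1)%R by rewrite /r -mulrBr mulVf// gt_eqF.
have sa : (s * a + r = 0)%R by rewrite /r subrr.
have mab (f : R -> R) : continuous f -> measurable_fun `]a, b[ (EFin \o f).
  by move=> cf; apply/measurable_EFinP/measurable_funTS; exact: continuous_measurable_fun.
have lab : mu `]a, b[%classic = (b - a)%:E.
  by rewrite lebesgue_measure_itv/= lte_fin ab EFinB.
have cfi (f : R -> R) : continuous f -> mu.-integrable `]a, b[ (EFin \o f).
  move=> cf; have [K fK] := continuous_segment_bounded a b cf.
  apply: measurable_bounded_integrable => //.
  - by rewrite [X in X < _]lab ltry.
  - by apply: measurable_funTS; exact: continuous_measurable_fun.
  - apply: (bounded_by (M := K)) => x; rewrite /= in_itv/= => /andP[ax xb].
    by apply: fK; rewrite in_itv/= !ltW.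
have c1 : continuous (fun t => (s * t + r) * derive1 F t)%R.
  by move=> t; apply: cvgM; [exact: (smooth1_continuous (smooth1_affine s r))|exact: cF].
have c2 : continuous (fun t => s * F t)%R by move=> t; apply: cvgMr; exact: cF0.
have -> : \int[mu]_(t in `]a, b[) (Z t)%:E = (F b)%:E.
  transitivity (\int[mu]_(t in `]a, b[) (((s * t + r) * derive1 F t)%:E + (s * F t)%:E)).
    apply: eq_integral.
    move=> t /set_mem; rewrite /= in_itv/= => tab; have /andP[at_ tb] := tab.
    by rewrite /Z ramp_mid ?ltW// /ramp' tab /r -mulrBr [(s * (_ - _))%R]mulrC EFinD.
  rewrite integralD//; [|exact: cfi..].
  rewrite -(integral_itv_bndoo true false (mab _ c1)).
  rewrite integral_affine_derive1// sa sb mul0r subr0 mul1r.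
  rewrite (integral_itv_bndoo true false (mab _ c2)) subeK//.
  exact: integrable_fin_num (cfi _ c2).
by rewrite -EFinD subrr.
Qed.

End ramp.

End integration_by_parts_rV.

Section test_functions.
Context {R : realType} {n : nat}.
Local Open Scope ereal_scope.

Lemma closureC_near (f : 'rV[R]_n -> R) x : ~ closure [set y | f y != 0%R] x ->
  \forall y \near x, f y = 0%R.
Proof.
move=> nx; apply: contrapT => nf; apply: nx => B xB; apply: contrapT => nB; apply: nf.
apply: filterS xB => y By; apply: contrapT => /eqP fy; apply: nB.
by exists y.
Qed.

Lemma test_functionP (U : set 'rV[R]_n) phi : test_function U phi ->
  [/\ continuous phi, forall i x, derivable phi x (delta_mx ord0 i),
      forall i, continuous (partial i phi),
      exists N, vanishes_off N phi &
      forall x, ~ U x -> phi x = 0%R /\ forall i, partial i phi x = 0%R].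
Proof.
move=> [sphi cK KU]; have [c0 d0] := sphi [::]; split => //.
- by move=> i; have [] := sphi [:: i].
- have /compact_bounded/bounded_set_segment_box[N N0 KN] := cK.
  exists N => x i xi; apply: contrapT => /eqP phix; move: xi.
  have /KN/(_ i) : closure [set y | phi y != 0%R] x by exact: subset_closure.
  by rewrite /= in_itv/= -ler_norml leNgt => /negP xN /xN.
- move=> x nUx; have nx : ~ closure [set y | phi y != 0%R] x by move=> /KU.
  have near0 := closureC_near nx; split; first exact: nbhs_singleton near0.
  by move=> i; rewrite /partial (near_eq_derive (g := cst 0%R)) ?derive_cst.
Qed.

End test_functions.

Section cylinder.
Context {R : realType} {n : nat}.
Implicit Types (I : set R) (D : set 'rV[R]_n).
Local Open Scope ereal_scope.

Definition product_cylinder I D : set 'rV[R]_n.+1 :=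
  [set x : 'rV[R]_n.+1 | I (x ord0 ord0) /\ D (behead_rV x)].

Lemma measurable_product_cylinder I D : measurable I -> measurable D ->
  measurable (product_cylinder I D).
Proof.
move=> mI mD; apply: (@measurableI _ _ ((fun x : 'rV[R]_n.+1 => x ord0 ord0) @^-1` I)
  (@behead_rV R n @^-1` D)); rewrite -[X in measurable X]setTI.
  exact: measurable_coord.
exact: measurable_behead_rV.
Qed.

Lemma lebesgue_rV_product_cylinder I D : measurable I -> measurable D ->
  lebesgue_rV n.+1 (product_cylinder I D) = @lebesgue_measure R I * lebesgue_rV n D.
Proof.
move=> mI mD; rewrite /= /pushforward.
rewrite (_ : _ @^-1` _ = I `*` D); first by rewrite product_measure1E.
by apply/seteqP; split => -[t y]; rewrite /product_cylinder/= cons_rV0 behead_cons_rV.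
Qed.

Lemma cylinderE L D : cylinder L D = product_cylinder `](- L)%R, L[%classic D.
Proof. by apply/seteqP; split => x []; rewrite /= ?in_itv/= => *; split; rewrite /= ?in_itv. Qed.

End cylinder.

Section ramp_competitor.
Context {R : realType} {n : nat}.
Variables a b : R.
Hypothesis ab : a < b.
Local Notation mu := (@lebesgue_measure R).
Local Open Scope ereal_scope.

Definition ramp_rV (x : 'rV[R]_n.+1) : R := ramp a b (x ord0 ord0).
Definition ramp_rV' (x : 'rV[R]_n.+1) : 'rV[R]_n.+1 :=
  ramp' a b (x ord0 ord0) *: delta_mx ord0 ord0.

Lemma ramp_rV'0 x : ramp_rV' x ord0 ord0 = ramp' a b (x ord0 ord0).
Proof. by rewrite !mxE/= mulr1. Qed.

Lemma ramp_rV_continuous : continuous ramp_rV.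
Proof.
move=> x; apply: (@continuous_comp _ _ _ (fun x : 'rV[R]_n.+1 => x ord0 ord0) (ramp a b)).
  exact: (@coord_continuous R 1 n.+1 ord0 ord0).
exact: ramp_continuous.
Qed.

Lemma measurable_ramp'_coord : measurable_fun setT (fun x : 'rV[R]_n.+1 => ramp' a b (x ord0 ord0)).
Proof.
by apply: (measurableT_comp (measurable_ramp' a b)); exact: measurable_coord.
Qed.

Lemma weak_gradient_ramp (U : set 'rV[R]_n.+1) : weak_gradient U ramp_rV ramp_rV'.
Proof.
move=> i phi /test_functionP[cphi dphi cdphi [N phiN] phiU].
rewrite -(@integral_vanishing _ _ _ (lebesgue_rV n.+1) U); last first.
  by move=> x /phiU[_ ->]; rewrite mulr0.
rewrite -(@integral_vanishing _ _ _ (lebesgue_rV n.+1) U); last first.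
  by move=> x /phiU[-> _]; rewrite mulr0.
have phii : (lebesgue_rV n.+1).-integrable setT (EFin \o phi).
  exact: vanishes_off_integrable phiN.
have dphii : (lebesgue_rV n.+1).-integrable setT (EFin \o partial i phi).
  exact: (vanishes_off_integrable measurableT (cdphi i) (vanishes_off_partial i phiN)).
have Ai : (lebesgue_rV n.+1).-integrable setT (fun x => (ramp_rV x * partial i phi x)%:E).
  rewrite (_ : (fun x => _) = (fun x => (partial i phi x * ramp_rV x)%:E)); last first.
    by apply/funext => x; rewrite mulrC.
  apply: (@integrableM_bounded _ _ _ _ _ (partial i phi) ramp_rV 1%R) => //.
    exact: continuous_measurable_rV ramp_rV_continuous.
  by move=> x _; exact: ramp_bound.
case: (unliftP ord0 i) => [j|] ij; move: dphii Ai; rewrite {i}ij => dphii Ai.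
  rewrite (integral_rVS Ai) [in RHS]integral0_eq ?oppe0; last first.
    by move=> x _; rewrite !mxE/= mulr0 mul0r.
  apply: integral0_eq => t _.
  have cs : continuous (fun y => partial (lift ord0 j) phi (cons_rV (t, y))).
    by move=> y; apply: continuous_comp; [exact: cons_rV_continuous_r|exact: cdphi].
  have vs : vanishes_off N (fun y => phi (cons_rV (t, y))).
    by move=> y k yk; apply: (phiN _ (lift ord0 k)); rewrite cons_rVS.
  have pE : (fun y => partial (lift ord0 j) phi (cons_rV (t, y))) =
      partial j (fun y => phi (cons_rV (t, y))).
    by apply/funext => y; rewrite derive_slice_r.
  have ds y : derivable (fun y => phi (cons_rV (t, y))) y (delta_mx ord0 j).
    exact: derivable_slice_r.
  have := integral_partial _ ds vs; rewrite -pE => /(_ cs) I0.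
  have si : (lebesgue_rV n).-integrable setT
      (EFin \o fun y => partial (lift ord0 j) phi (cons_rV (t, y))).
    have vp : vanishes_off N (fun y => partial (lift ord0 j) phi (cons_rV (t, y))).
      by rewrite pE; exact: vanishes_off_partial.
    exact: vanishes_off_integrable measurableT cs vp.
  transitivity (\int[lebesgue_rV n]_y ((ramp a b t)%:E *
    (partial (lift ord0 j) phi (cons_rV (t, y)))%:E)).
    by apply: eq_integral => y _; rewrite /ramp_rV cons_rV0 EFinM.
  by rewrite integralZl// I0 mule0.
have Bi : (lebesgue_rV n.+1).-integrable setT
    (fun x => (ramp_rV' x ord0 ord0 * phi x)%:E).
  rewrite (_ : (fun x => _) = (fun x => (phi x * ramp' a b (x ord0 ord0))%:E)); last first.
    by apply/funext => x; rewrite ramp_rV'0 mulrC.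
  apply: (@integrableM_bounded _ _ _ _ _ phi _ (b - a)^-1%R) => //.
    exact: measurable_ramp'_coord.
  move=> x _; rewrite /ramp'; case: ifP => _.
    by rewrite ger0_norm// invr_ge0 subr_ge0 ltW.
  by rewrite normr0 invr_ge0 subr_ge0 ltW.
have AB0 : \int[lebesgue_rV n.+1]_x ((ramp_rV x * partial ord0 phi x)%:E +
    (ramp_rV' x ord0 ord0 * phi x)%:E) = 0.
  rewrite (integral_rVS_swap (integrableD measurableT Ai Bi)).
  apply: integral0_eq => y _ /=.
  rewrite -[RHS](@ramp_integration_by_parts _ _ _ ab (fun t => phi (cons_rV (t, y))) N).
  - apply: eq_integral => t _.
    by rewrite derive_slice_l ramp_rV'0 /ramp_rV !cons_rV0 EFinD.
  - by move=> t; exact: derivable_slice_l.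
  - rewrite (_ : derive1 _ = (partial ord0 phi) \o (fun t => cons_rV (t, y))).
      by move=> t; apply: continuous_comp; [exact: cons_rV_continuous_l|exact: cdphi].
    by apply/funext => t; rewrite derive_slice_l.
  - by move=> t Nt; apply: (phiN _ ord0); rewrite cons_rV0.
rewrite integralD// in AB0.
by rewrite -[RHS]sub0e -AB0 addeK// integrable_fin_num.
Qed.

End ramp_competitor.

Section capacity_upper_bound.
Context {R : realType} {n : nat}.
Local Open Scope ereal_scope.
Implicit Types (p L a b c : R) (D : set 'rV[R]_n).

Lemma sobolev_capacity_ge0 m p (A : set 'rV[R]_m) : 0 <= sobolev_capacity p A.
Proof.
apply: le_ereal_inf_tmp => _ [u [g [G [_ _ _ _ ->]]]]; apply: integral_ge0 => x _.
by rewrite lee_fin addr_ge0 ?powR_ge0.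
Qed.

Lemma sobolev_capacity0 m p : (0 < p)%R -> sobolev_capacity p (set0 : set 'rV[R]_m) = 0.
Proof.
move=> p0; have p0' : p != 0%R by rewrite gt_eqF.
apply/eqP; rewrite eq_le sobolev_capacity_ge0 andbT.
apply: ereal_inf_lbound; exists (cst 0%R), (cst 0%R), set0; split => //.
- split.
  + split; first exact: measurable_cst.
    by apply: measurable_fun_rV => i; exact: measurable_cst.
  + by rewrite integral0_eq// => x _; rewrite normr0 powR0.
  + by rewrite integral0_eq// => x _; rewrite enorm0 powR0.
  + move=> i phi _; rewrite !integral0_eq ?oppe0// => x _; first by rewrite mxE mul0r.
    by rewrite mul0r.
- by apply: aeW.
- by rewrite integral0_eq// => x _; rewrite normr0 enorm0 powR0// addr0.
Qed.

Lemma quasi_everywhere_all m p (A : set 'rV[R]_m) P : (0 < p)%R ->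
  (forall x, A x -> P x) -> quasi_everywhere p A P.
Proof.
move=> p0 AP; rewrite /quasi_everywhere (_ : A `&` _ = set0) ?sobolev_capacity0//.
by apply/seteqP; split => // x [/AP].
Qed.

Lemma continuous_quasicontinuous m p (U : set 'rV[R]_m) u : (0 < p)%R ->
  continuous u -> quasicontinuous p U u.
Proof.
move=> p0 cu eps e0; exists set0; split; first exact: open0.
  by rewrite sobolev_capacity0 ?lte_fin.
exact: continuous_subspaceT.
Qed.

Lemma condenser_capacity_upper_bound p L a b c D : (1 < p)%R ->
  bounded_set D -> open D -> (- L < a)%R -> (a < b)%R -> (b < c)%R -> (c < L)%R ->
  condenser_capacity p (cylinder L D)
    [set x : 'rV[R]_n.+1 | cylinder L D x /\ x ord0 ord0 <= a]%R
    [set x : 'rV[R]_n.+1 | cylinder L D x /\ b <= x ord0 ord0 <= c]%R <=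
  lebesgue_rV n D * ((b - a) `^ (1 - p))%:E.
Proof.
move=> p1 bD oD La ab bc cL; have p0 : (0 < p)%R by lra.
have ba : (0 < b - a)%R by rewrite subr_gt0.
have p0' : p != 0%R by rewrite gt_eqF.
have mD : measurable D by exact: open_measurable_rV.
have Dfin : lebesgue_rV n D < +oo by exact: bounded_set_fin.
have mab : measurable `]a, b[%classic by exact: measurable_itv.
have mLL : measurable `](- L)%R, L[%classic by exact: measurable_itv.
have mOm : measurable (cylinder L D).
  by rewrite cylinderE; exact: measurable_product_cylinder.
have Omfin : lebesgue_rV n.+1 (cylinder L D) < +oo.
  have lL : (@lebesgue_measure R) `](- L)%R, L[%classic = (L - - L)%:E.
    by rewrite lebesgue_measure_itv/= lte_fin ifT ?EFinB//; lra.
  rewrite cylinderE lebesgue_rV_product_cylinder// lL.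
  by apply: lte_mul_pinfty => //; rewrite lee_fin; lra.
have enormE (x : 'rV[R]_n.+1) : enorm (ramp_rV' a b x) = ramp' a b (x ord0 ord0).
  rewrite /ramp_rV' enormZ enorm_delta mulr1 ger0_norm// /ramp'.
  by case: ifP => // _; rewrite invr_ge0 ltW.
have energy : \int[lebesgue_rV n.+1]_(x in cylinder L D)
    (enorm (ramp_rV' a b x) `^ p)%:E = lebesgue_rV n D * ((b - a) `^ (1 - p))%:E.
  transitivity (\int[lebesgue_rV n.+1]_(x in product_cylinder `]a, b[%classic D)
      ((b - a)^-1 `^ p)%:E).
    rewrite integral_mkcond [RHS]integral_mkcond; apply: eq_integral => x _.
    rewrite !patchE enormE.
    case: (boolP (x \in cylinder L D)) => [/set_mem xL|/negP xL];
      case: (boolP (x \in _)) => [/set_mem xab|/negP xab] //.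
    - by case: xab => /= + _; rewrite in_itv/= /ramp' => ->.
    - rewrite /ramp'; case: ifP => [xab'|_]; last by rewrite powR0.
      by exfalso; apply: xab; rewrite inE; split; [rewrite /= in_itv|case: xL].
    - exfalso; apply: xL; rewrite inE; case: xab => /=; rewrite in_itv/= => /andP[xa xb] Dx.
      by split => //; apply/andP; split; lra.
  have mP : measurable (product_cylinder `]a, b[%classic D).
    exact: measurable_product_cylinder.
  rewrite (@integral_cst _ _ _ (lebesgue_rV n.+1) _ mP ((b - a)^-1 `^ p)%:E).
  rewrite [X in _ * X](lebesgue_rV_product_cylinder mab mD).
  have lab : (@lebesgue_measure R) `]a, b[%classic = (b - a)%:E.
    by rewrite lebesgue_measure_itv/= lte_fin ab EFinB.
  by rewrite lab muleA -EFinM powR_inv_mul// muleC.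
rewrite -energy; apply: ereal_inf_lbound.
exists (ramp_rV a b), (ramp_rV' a b); split => //.
have cr : continuous (ramp_rV (n := n) a b) by exact: ramp_rV_continuous.
split.
- split.
  + split; first by apply: measurable_funTS; exact: continuous_measurable_rV.
    apply: measurable_funTS; apply: measurable_fun_rV => i.
    under eq_fun do rewrite mxE; apply: measurable_funM => //.
    exact: measurable_ramp'_coord.
  + apply: le_lt_trans Omfin.
    rewrite -[leRHS]mul1e -(integral_cst _ mOm 1).
    apply: ge0_le_integral => //.
    * apply/measurable_EFinP; apply: (measurableT_comp (measurable_powR p)).
      apply: measurableT_comp => //; apply: measurable_funTS.
      exact: continuous_measurable_rV.
    * move=> x _; have -> : 1 = (1 `^ p)%:E :> \bar R by rewrite powR1.
      rewrite lee_fin.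
      by rewrite ge0_ler_powR ?nnegrE ?ramp_bound// ltW.
  + by rewrite energy lte_mul_pinfty// ?ge0_fin_numE// ?measure_ge0 ?ltry.
  + exact: weak_gradient_ramp.
- exact: continuous_quasicontinuous.
- by apply: quasi_everywhere_all => // x [_ xa]; rewrite /ramp_rV ramp_le.
- by apply: quasi_everywhere_all => // x [_ /andP[xb _]]; rewrite /ramp_rV ramp_ge.
Qed.

End capacity_upper_bound.

(** * The lower bound for the condenser capacity *)

Section tensor_products.
Context {R : realType} {n : nat}.
Implicit Types (f : 'I_n -> R -> R) (x : 'rV[R]_n).
Local Open Scope ereal_scope.

Definition tensor f x : R := (\prod_(i < n) f i (x ord0 i))%R.

Definition tensor_derive f (i : 'I_n) : 'I_n -> R -> R :=
  fun j => if j == i then derive1 (f j) else f j.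

Lemma tensor_continuous f : (forall i, continuous (f i)) -> continuous (tensor f).
Proof.
move=> cf; apply: (@continuous_big R 'I_n *%R 1%R xpredT (@mul_continuous R) _
  (index_enum 'I_n) (fun i (y : 'rV[R]_n) => f i (y ord0 i))) => i _ y.
apply: (@continuous_comp _ _ _ (fun y : 'rV[R]_n => y ord0 i) (f i)).
  exact: (@coord_continuous R 1 n ord0 i).
exact: cf.
Qed.

Lemma is_derive_tensor f i x : derivable (f i) (x ord0 i) 1 ->
  is_derive x (delta_mx ord0 i) (tensor f) (tensor (tensor_derive f i) x).
Proof.
move=> df; pose c := (\prod_(j < n | j != i) f j (x ord0 j))%R.
have tE : tensor (tensor_derive f i) x = (derive1 (f i) (x ord0 i) * c)%R.
  rewrite /tensor (bigD1 i)//= /tensor_derive eqxx; congr (_ * _)%R.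
  by apply: eq_bigr => j ji; rewrite (negbTE ji).
have lim : (fun h : R => h^-1 *: ((tensor f \o shift x) (h *: delta_mx ord0 i) - tensor f x))%R
    @ 0%R^' --> (derive1 (f i) (x ord0 i) * c)%R.
  rewrite (_ : (fun h : R => _) = fun h : R =>
    (h^-1 *: ((f i \o shift (x ord0 i)) (h *: (1 : R)) - f i (x ord0 i)) * c)%R).
    by apply: cvgMl; rewrite derive1E; exact: df.
  apply/funext => h; rewrite /= /tensor (bigD1 i)//= [X in (_ - X)%R](bigD1 i)//=.
  rewrite !mxE !eqxx/= /GRing.scale/= mulr1 -mulrA mulrBl; congr (_ * (_ * _ - _))%R.
  apply: eq_bigr => j ji; rewrite !mxE (negbTE ji) andbF mulr0 add0r//.
by rewrite tE; apply: DeriveDef; [exact: cvgP lim|exact: cvg_lim lim].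
Qed.

Lemma partial_tensor f i : (forall j, smooth1 (f j)) ->
  partial i (tensor f) = tensor (tensor_derive f i).
Proof.
move=> sf; apply/funext => x.
have d : derivable (f i) (x ord0 i) 1 by exact: smooth1_derivable.
by rewrite /partial; have [_ ->] := is_derive_tensor d.
Qed.

Lemma smooth1_tensor_derive f i : (forall j, smooth1 (f j)) ->
  forall j, smooth1 (tensor_derive f i j).
Proof.
by move=> sf j; rewrite /tensor_derive; case: ifP => // _; exact: smooth1_derive.
Qed.

Lemma smooth_tensor f : (forall i, smooth1 (f i)) -> smooth (tensor f).
Proof.
move=> sf s.
have [h [sh ->]] : exists h, (forall i, smooth1 (h i)) /\ iter_partial s (tensor f) = tensor h.
  elim: s => [|i s [h [sh sE]]]; first by exists f.
  exists (tensor_derive h i); split; first exact: smooth1_tensor_derive.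
  by rewrite /= sE partial_tensor.
split; first by apply: tensor_continuous => i; exact: smooth1_continuous.
move=> i x; have d : derivable (h i) (x ord0 i) 1 by exact: smooth1_derivable.
by have [] := is_derive_tensor d.
Qed.

Lemma tensor_test_function f (l r : 'I_n -> R) (U : set 'rV[R]_n) :
  (forall i, smooth1 (f i)) ->
  (forall i t, ~~ (l i <= t <= r i)%R -> f i t = 0%R) ->
  box (fun i => `[l i, r i]%classic) `<=` U -> test_function U (tensor f).
Proof.
move=> sf f0 boxU; pose K : set 'rV[R]_n := box (fun i => `[l i, r i]%classic).
have cK : compact K by apply: rV_compact => i; exact: segment_compact.
have supp : closure [set x | tensor f x != 0%R] `<=` K.
  apply: closure_support_sub; first by apply: compact_closed => //; exact: norm_hausdorff.
  move=> x xK; have [i xi] : exists i, ~~ (l i <= x ord0 i <= r i)%R.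
    apply: contrapT => nx; apply: xK => i; rewrite /= in_itv/=.
    by apply: contrapT => /negP xi; apply: nx; exists i.
  by rewrite /tensor (bigD1 i)//= f0// mul0r.
split; [exact: smooth_tensor| |exact: subset_trans supp boxU].
by apply: subclosed_compact supp => //; exact: closed_closure.
Qed.

End tensor_products.

Section null_sets.
Context {R : realType} {n : nat}.
Local Open Scope ereal_scope.

Lemma measurable_enorm : measurable_fun setT (@enorm R n).
Proof.
apply: (measurableT_comp (f := @Num.sqrt R)).
  by apply: continuous_measurable_fun; exact: sqrt_continuous.
by apply: measurable_sum => i; apply: measurable_funX; exact: measurable_coord.
Qed.

Lemma quasi_everywhere_ae p (A : set 'rV[R]_n) P : (0 < p)%R ->
  quasi_everywhere p A P -> {ae lebesgue_rV n, forall x, A x -> P x}.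
Proof.
move=> p0 cap0.
have H k : exists G, [/\ open G, A `&` [set x | ~ P x] `<=` G &
    lebesgue_rV n G <= (k.+1%:R^-1)%:E].
  have k0 : 0 < (k.+1%:R^-1 : R)%:E by rewrite lte_fin invr_gt0.
  have : sobolev_capacity p (A `&` [set x | ~ P x]) < (k.+1%:R^-1)%:E by rewrite cap0.
  move=> /ereal_inf_lt[_ [u [g [G [[[mu mg] _ _ _] oG AG uG ->]]]] ek].
  exists G; split => //; apply: le_trans (ltW ek).
  have mG : measurable G by exact: open_measurable_rV.
  have mF : measurable_fun setT (fun x => (`|u x| `^ p + enorm (g x) `^ p)%:E).
    apply/measurable_EFinP/measurable_funD; apply: (measurableT_comp (measurable_powR p)).
      exact: measurableT_comp.
    exact: (measurableT_comp measurable_enorm).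
  have F0 x : 0 <= (`|u x| `^ p + enorm (g x) `^ p)%:E.
    by rewrite lee_fin addr_ge0 ?powR_ge0.
  rewrite -[leLHS]mul1e -(integral_cst _ mG 1).
  apply: (@le_trans _ _ (\int[lebesgue_rV n]_(x in G) (`|u x| `^ p + enorm (g x) `^ p)%:E)).
    apply: ae_ge0_le_integral => //; first exact: measurable_funTS.
    apply: filterS uG => x uG Gx; have u1 := uG Gx.
    have -> : 1 = (1 `^ p)%:E :> \bar R by rewrite powR1.
    rewrite lee_fin; apply: (@le_trans _ _ (`|u x| `^ p)%R); last by rewrite lerDl powR_ge0.
    rewrite ge0_ler_powR ?nnegrE ?(ltW p0)//.
    exact: le_trans u1 (ler_norm _).
  exact: ge0_subset_integral.
have [G GP] : {G : nat -> set 'rV[R]_n & forall k, [/\ open (G k),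
    A `&` [set x | ~ P x] `<=` G k & lebesgue_rV n (G k) <= (k.+1%:R^-1)%:E]}.
  exact: (@choice _ _ (fun k G => [/\ open G, A `&` [set x | ~ P x] `<=` G &
    lebesgue_rV n G <= (k.+1%:R^-1)%:E])).
have mG k : measurable (G k) by have [oG _ _] := GP k; exact: open_measurable_rV.
have mB : measurable (\bigcap_k G k) by exact: bigcapT_measurable.
exists (\bigcap_k G k); split => //.
- apply/eqP; rewrite eq_le measure_ge0 andbT; apply/lee_addgt0Pr => e e0.
  rewrite add0e; pose k := Num.trunc e^-1.
  have [_ _ Gk] := GP k; apply: (@le_trans _ _ (lebesgue_rV n (G k))).
    by apply: le_measure; rewrite ?inE//; exact: bigcap_inf.
  apply: le_trans Gk _; rewrite lee_fin -[leRHS]invrK lef_pV2 ?posrE ?invr_gt0//.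
  by apply/ltW; rewrite truncnS_gt.
- move=> x /= nAP k _; have [_ + _] := GP k; apply; split.
    by apply: contrapT => nA; apply: nAP.
  by move=> Px; apply: nAP.
Qed.

End null_sets.

Section tensor_integrals.
Context {R : realType} {n : nat}.
Local Notation mu := (@lebesgue_measure R).
Local Open Scope ereal_scope.

Lemma integrable_powR d (T : measurableType d) (nu : {measure set T -> \bar R})
    (A : set T) (h : T -> R) p : (1 < p)%R -> measurable A -> nu A < +oo ->
  measurable_fun A h -> \int[nu]_(x in A) (`|h x| `^ p)%:E < +oo ->
  nu.-integrable A (EFin \o h).
Proof.
move=> p1 mA Afin mh hp.
have i1 : nu.-integrable A (EFin \o (cst 1%R : T -> R)).
  by apply: measurable_bounded_integrable => //; apply: (bounded_by (M := 1%R)) => x _; rewrite normr1.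
have i2 : nu.-integrable A (fun x => (`|h x| `^ p)%:E).
  apply/integrableP; split.
    by apply/measurable_EFinP; apply: (measurableT_comp (measurable_powR p)); exact: measurableT_comp.
  by under eq_integral do rewrite abse_EFin ger0_norm ?powR_ge0//.
apply: (le_integrable mA _ _ (integrableD mA i1 i2)); first exact/measurable_EFinP.
move=> x Ax; change (`|h x|%:E <= `|1 + `|h x| `^ p|%:E); rewrite lee_fin [leRHS]ger0_norm; last first.
  by rewrite addr_ge0 ?powR_ge0.
have [h1|h1] := leP `|h x|%R 1%R; first by rewrite ler_wpDr ?powR_ge0.
rewrite ler_wpDl// -[leLHS]powRr1//; apply: ler_powR; exact: ltW.
Qed.

Lemma integral_product (f : R -> R) (eta : 'rV[R]_n -> R) (T S : R) :
  (lebesgue_rV n.+1).-integrable setT (fun x => (f (x ord0 ord0) * eta (behead_rV x))%:E) ->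
  mu.-integrable setT (EFin \o f) -> (lebesgue_rV n).-integrable setT (EFin \o eta) ->
  \int[mu]_t (f t)%:E = T%:E -> \int[lebesgue_rV n]_y (eta y)%:E = S%:E ->
  \int[lebesgue_rV n.+1]_x (f (x ord0 ord0) * eta (behead_rV x))%:E = (T * S)%:E.
Proof.
move=> pi fi ei fT eS; rewrite (integral_rVS pi).
transitivity (\int[mu]_t (S%:E * (f t)%:E)).
  apply: eq_integral => t _; rewrite muleC -eS -integralZl//.
  by apply: eq_integral => y _; rewrite cons_rV0 behead_cons_rV EFinM.
by rewrite integralZl// fT -EFinM mulrC.
Qed.

End tensor_integrals.

Lemma plateau_domain (R : realType) (e x r t : R) : 0 < e ->
  x + 2 * e - e < t < x + r - 2 * e + e -> x <= t < x + r.
Proof. by move=> e0 /andP[h1 h2]; apply/andP; split; lra. Qed.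

Lemma inner_side (R : realType) (e x r : R) : 0 < e -> 4 * e < r ->
  x + 2 * e < x + r - 2 * e.
Proof. by move=> e0 er; lra. Qed.

Lemma outer_side (R : realType) (a b e : R) : 0 < e -> a < b -> a - e < b + e.
Proof. by move=> e0 ab; lra. Qed.

Section cube_test_function.
Context {R : realType} {n : nat}.
Variables (a b e r : R) (q : 'rV[R]_n).
Hypotheses (e0 : 0 < e) (ab : a < b) (er : 4 * e < r).
Local Notation mu := (@lebesgue_measure R).
Local Open Scope ereal_scope.

Let psi := plateau a b e.
Let beta (i : 'I_n) := plateau (q ord0 i + 2 * e) (q ord0 i + r - 2 * e) e.

Definition cube_cutoff : 'rV[R]_n -> R := tensor beta.

Definition cube_test : 'rV[R]_n.+1 -> R :=
  tensor (fun j => if unlift ord0 j is Some i then beta i else psi).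

Let smooth1_psi : smooth1 psi. Proof. exact: smooth1_plateau. Qed.
Let smooth1_beta i : smooth1 (beta i). Proof. exact: smooth1_plateau. Qed.

Lemma cube_testE x : cube_test x = (psi (x ord0 ord0) * cube_cutoff (behead_rV x))%R.
Proof.
rewrite /cube_test /tensor big_ord_recl unlift_none; congr (_ * _)%R.
by apply: eq_bigr => i _; rewrite liftK mxE.
Qed.

Lemma partial_cube_test x :
  partial ord0 cube_test x = (derive1 psi (x ord0 ord0) * cube_cutoff (behead_rV x))%R.
Proof.
rewrite partial_tensor; last by move=> j; case: unlift.
rewrite /tensor big_ord_recl /tensor_derive eqxx unlift_none; congr (_ * _)%R.
by apply: eq_bigr => i _; rewrite liftK mxE.
Qed.

Lemma cube_cutoff_ge0 y : (0 <= cube_cutoff y)%R.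
Proof. by apply: prodr_ge0 => i _; exact: plateau_ge0. Qed.

Lemma cube_cutoff_le1 y : (cube_cutoff y <= 1)%R.
Proof.
by apply: prodr_ile1 => i _; rewrite plateau_ge0 plateau_le1.
Qed.

#[local] Hint Resolve cube_cutoff_ge0 cube_cutoff_le1 : core.

Let cube_cutoff_eq0 y : ~ cube q r y -> cube_cutoff y = 0%R.
Proof.
move=> yq; have [i yi] : exists i, ~~ (q ord0 i <= y ord0 i < q ord0 i + r)%R.
  apply: contrapT => ny; apply: yq => i; rewrite /= in_itv/=.
  by apply: contrapT => /negP yi; apply: ny; exists i.
rewrite /cube_cutoff /tensor (bigD1 i)//= /beta plateau_eq0 ?mul0r//.
by apply: contra yi; exact: plateau_domain.
Qed.

Let cube_cutoff_continuous : continuous cube_cutoff.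
Proof. apply: (@tensor_continuous _ _ beta) => i; exact: smooth1_continuous (smooth1_beta i). Qed.

Let cube_cutoff_measurable : measurable_fun setT cube_cutoff.
Proof. exact: continuous_measurable_rV. Qed.

Let r0 : (0 < r)%R. Proof. by apply: lt_trans er; rewrite mulr_gt0. Qed.

Let cube_fin : lebesgue_rV n (cube q r) < +oo.
Proof. by rewrite lebesgue_rV_cube ?ltry// ltW. Qed.

Let cube_cutoff_integrable : (lebesgue_rV n).-integrable setT (EFin \o cube_cutoff).
Proof.
apply: (integrable_vanishing (measurable_cube q r)).
  by move=> y yq; rewrite /= cube_cutoff_eq0.
apply: measurable_bounded_integrable => //; first exact: measurable_cube.
  exact: measurable_funTS.
by apply: (bounded_by (M := 1%R)) => y _; rewrite ger0_norm.
Qed.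

Definition cube_mass : R := fine (\int[lebesgue_rV n]_y (cube_cutoff y)%:E).

Let cube_massE : \int[lebesgue_rV n]_y (cube_cutoff y)%:E = cube_mass%:E.
Proof. by rewrite fineK// integrable_fin_num. Qed.

Lemma cube_mass_ge : ((r - 4 * e) ^+ n <= cube_mass)%R.
Proof.
rewrite -lee_fin -cube_massE.
pose Q : set 'rV[R]_n := box (fun i =>
  `[(q ord0 i + 2 * e)%R, (q ord0 i + r - 2 * e)%R]%classic).
have mQ : measurable Q by apply: measurable_box => i; exact: measurable_itv.
have -> : ((r - 4 * e) ^+ n)%:E = lebesgue_rV n Q.
  rewrite (@lebesgue_rV_box _ _ _ (fun=> (r - 4 * e)%R)) ?prodr_const ?card_ord//.
  move=> i; rewrite lebesgue_measure_itv/= lte_fin ifT; last exact: inner_side.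
  by rewrite -EFinB; congr _%:E; ring.
rewrite -[leLHS]mul1e -(integral_cst _ mQ 1).
apply: (@le_trans _ _ (\int[lebesgue_rV n]_(y in Q) (cube_cutoff y)%:E)).
  apply: ge0_le_integral => //.
    by apply/measurable_EFinP; exact: measurable_funTS.
  move=> y Qy; rewrite lee_fin /cube_cutoff /tensor big1// => i _.
  by apply: plateau_eq1 => //; have := Qy i; rewrite /= in_itv.
apply: ge0_subset_integral => //; first exact/measurable_EFinP.
by move=> y _; rewrite lee_fin.
Qed.

Section profile.
Variables (W : set 'rV[R]_n.+1) (h : R -> R) (M : R).
Hypotheses (mW : measurable W) (Wfin : lebesgue_rV n.+1 W < +oo).
Hypothesis qW : forall x : 'rV[R]_n.+1, (a - e <= x ord0 ord0 <= b + e)%R ->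
  cube q r (behead_rV x) -> W x.
Hypothesis mh : measurable_fun setT h.
Hypothesis hM : forall t, (`|h t| <= M)%R.
Hypothesis h0 : forall t, ~~ (a - e <= t <= b + e)%R -> h t = 0%R.

Lemma profile_vanish (x : 'rV[R]_n.+1) : ~ W x -> (h (x ord0 ord0) * cube_cutoff (behead_rV x) = 0)%R.
Proof.
move=> nW; have [xI|xI] := boolP (a - e <= x ord0 ord0 <= b + e)%R; last first.
  by rewrite h0// mul0r.
by rewrite cube_cutoff_eq0 ?mulr0// => qx; apply: nW; exact: qW.
Qed.

Lemma profile_measurable :
  measurable_fun setT (fun x : 'rV[R]_n.+1 => h (x ord0 ord0) * cube_cutoff (behead_rV x))%R.
Proof.
apply: measurable_funM.
  by apply: (measurableT_comp mh); exact: measurable_coord.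
by apply: (measurableT_comp cube_cutoff_measurable); exact: measurable_behead_rV.
Qed.

Lemma profile_bound (x : 'rV[R]_n.+1) : (`|h (x ord0 ord0) * cube_cutoff (behead_rV x)| <= M)%R.
Proof.
rewrite normrM -[leRHS]mulr1 ler_pM//.
by rewrite ger0_norm.
Qed.

Lemma profile_integrable : (lebesgue_rV n.+1).-integrable setT
  (fun x : 'rV[R]_n.+1 => (h (x ord0 ord0) * cube_cutoff (behead_rV x))%:E).
Proof.
apply: (integrable_vanishing mW).
  by move=> x /profile_vanish ->.
apply: (@measurable_bounded_integrable _ _ _ _
  (fun x : 'rV[R]_n.+1 => h (x ord0 ord0) * cube_cutoff (behead_rV x))%R) => //.
  by apply: measurable_funTS; exact: profile_measurable.
by apply: (bounded_by (M := M)) => x _; exact: profile_bound.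
Qed.

Lemma profile_integrable1 : mu.-integrable setT (EFin \o h).
Proof.
have mab : measurable `[(a - e)%R, (b + e)%R]%classic by exact: measurable_itv.
have lab : mu `[(a - e)%R, (b + e)%R]%classic = (b + e - (a - e))%:E.
  rewrite lebesgue_measure_itv/= lte_fin ifT ?EFinB//.
  exact: outer_side.
apply: (@integrable_vanishing _ _ _ mu _ (EFin \o h) mab).
  move=> t tab; rewrite /= h0//; apply/negP => tab'; apply: tab.
  by rewrite /= in_itv.
apply: measurable_bounded_integrable => //.
- by rewrite [ltLHS]lab ltry.
- exact: measurable_funTS.
- exact: (bounded_by (M := M)).
Qed.

Lemma profile_integral (T : R) : \int[mu]_t (h t)%:E = T%:E ->
  \int[lebesgue_rV n.+1]_(x in (setT : set 'rV[R]_n.+1)) (h (x ord0 ord0) * cube_cutoff (behead_rV x))%:E = (T * cube_mass)%:E.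
Proof.
move=> hT; apply: integral_product => //.
- exact: profile_integrable.
- exact: profile_integrable1.
Qed.

End profile.

End cube_test_function.

Lemma ae_le_integral d (T : measurableType d) (R : realType)
    (mu : {measure set T -> \bar R}) (D : set T) (f g : T -> \bar R) :
  measurable D -> mu.-integrable D f -> mu.-integrable D g ->
  {ae mu, forall x, D x -> (f x <= g x)%E} ->
  (\int[mu]_(x in D) f x <= \int[mu]_(x in D) g x)%E.
Proof.
move=> mD fi gi [N [mN N0 fgN]].
rewrite (negligible_integral mN mD fi N0) (negligible_integral mN mD gi N0).
have mDN : measurable (D `\` N) by exact: measurableD.
have DN : D `\` N `<=` D by exact: subDsetl.
apply: le_integral => //; [exact: integrableS fi|exact: integrableS gi|].
move=> x /set_mem[Dx Nx]; apply: contrapT => fgx; apply: Nx; apply: fgN => /= H.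
by apply: fgx; exact: H.
Qed.

Lemma outer_side_in (R : realType) (a b e L t : R) : - L < a - e -> b + e < L ->
  a - e <= t <= b + e -> - L < t < L.
Proof. by move=> h1 h2 /andP[h3 h4]; apply/andP; split; lra. Qed.

Lemma inner_side_in (R : realType) (e x r t : R) : 0 < e ->
  x + e <= t <= x + r - e -> x <= t < x + r.
Proof. by move=> e0 /andP[h1 h2]; apply/andP; split; lra. Qed.

Lemma plateau_off (R : realType) (a b e t : R) : 0 < e ->
  ~~ (a - e <= t <= b + e) -> plateau a b e t = 0.
Proof.
move=> e0 tab; apply: plateau_eq0 => //; apply: contra tab => /andP[h1 h2].
by rewrite !ltW.
Qed.

Lemma midpoint_between (R : realType) (a b : R) : a < b -> a < (a + b) / 2 < b.
Proof. by move=> ab; apply/andP; split; lra. Qed.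

Section half_profile.
Context {R : realType}.
Variables a b e : R.
Hypotheses (e0 : 0 < e) (ab : a < b).
Local Notation mu := (@lebesgue_measure R).
Local Open Scope ereal_scope.

Definition descent t : R :=
  (if (a + b) / 2 <= t then derive1 (plateau a b e) t else 0)%R.

Let sp : smooth1 (plateau a b e). Proof. exact: smooth1_plateau. Qed.

Let cp' : continuous (derive1 (plateau a b e)).
Proof. by apply: smooth1_continuous; exact: smooth1_derive. Qed.

Lemma derive1_plateau_bounded :
  exists2 M, (0 <= M)%R & forall t, (`|derive1 (plateau a b e) t| <= M)%R.
Proof.
have [M HM] := continuous_segment_bounded (a - e)%R (b + e)%R cp'.
exists `|M|%R => // t; have [tI|tI] := boolP (a - e <= t <= b + e)%R.
  by apply: le_trans (ler_norm M); apply: HM; rewrite in_itv.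
by rewrite plateau_derive1_eq0 ?normr0.
Qed.

Lemma measurable_derive1_plateau : measurable_fun setT (derive1 (plateau a b e)).
Proof. exact: continuous_measurable_fun. Qed.

Lemma measurable_descent : measurable_fun setT descent.
Proof.
apply: measurable_fun_if => //=.
- exact: measurable_fun_ler.
- by apply: measurable_funTS; exact: measurable_derive1_plateau.
Qed.

Lemma descent_bounded M : (0 <= M)%R ->
  (forall t, (`|derive1 (plateau a b e) t| <= M)%R) -> forall t, (`|descent t| <= M)%R.
Proof. by move=> M0 HM t; rewrite /descent; case: ifP => //; rewrite normr0. Qed.

Lemma descent_off t : ~~ (a - e <= t <= b + e)%R -> descent t = 0%R.
Proof. by move=> tI; rewrite /descent plateau_derive1_eq0//; case: ifP. Qed.

Lemma integral_descent : \int[mu]_t (descent t)%:E = (- 1)%:E.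
Proof.
have /andP[am mb] := midpoint_between ab.
pose m := ((a + b) / 2)%R; have mbe : (m <= b + e)%R.
  by apply: ltW; apply: lt_le_trans mb _; rewrite lerDl ltW.
rewrite (@integral_subset_vanishing _ _ _ mu `[m, (b + e)%R]%classic)//; last first.
  move=> t _ tI; rewrite /descent; case: ifP => // mt.
  rewrite plateau_derive1_eq0//; apply/negP => /andP[_ tb].
  by apply: tI; rewrite /= in_itv/= mt tb.
transitivity (\int[mu]_(t in `[m, (b + e)%R]) (derive1 (plateau a b e) t)%:E).
  by apply: eq_integral => t /set_mem; rewrite /= in_itv/= /descent => /andP[-> _].
have dp x : derivable (plateau a b e) x 1 by exact: smooth1_derivable.
rewrite (integral_derive1 mbe dp cp').
rewrite plateau_eq0// ?ltxx ?andbF// plateau_eq1//; first by rewrite sub0r.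
by rewrite /m !ltW.
Qed.

(* On the left of [a] the plateau increases and on the right of [b] it
   decreases, so the boundary conditions on [u] push in the same direction. *)
Lemma le_descent (c t v : R) : (b + e < c)%R -> (t <= a -> v <= 0)%R ->
  (b <= t <= c -> 1 <= v)%R ->
  (v * derive1 (plateau a b e) t <= descent t)%R.
Proof.
move=> ec va vb; rewrite /descent; have /andP[am mb] := midpoint_between ab.
have [ta|ta] := leP t a.
  rewrite ifF; last by apply/negbTE; rewrite -ltNge (le_lt_trans ta am).
  rewrite mulr_le0_ge0 ?va//.
  by apply: plateau_derive1_ge0 => //; exact: le_lt_trans ab.
have [bt|tb] := leP b t.
  rewrite (le_trans (ltW mb) bt).
  have d0 : (derive1 (plateau a b e) t <= 0)%R by exact: plateau_derive1_le0.
  have [tc|ct] := leP t c.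
    by rewrite -[leRHS]mul1r ler_wnM2r// vb// bt tc.
  rewrite plateau_derive1_eq0 ?mulr0//; apply/negP => /andP[_ h].
  by move: (lt_trans ec ct); rewrite ltNge h.
have -> : derive1 (plateau a b e) t = 0%R.
  rewrite derive1E (near_eq_derive (g := (cst 1%R : R -> R))) ?derive_cst//.
  near=> s; apply: plateau_eq1 => //; apply/andP; split; near: s.
    by apply: filterS (lt_nbhsr ta) => s /ltW.
  by apply: filterS (lt_nbhsl tb) => s /ltW.
by rewrite mulr0; case: ifP.
Unshelve. all: by end_near. Qed.

Lemma integral_plateau_le : exists2 T,
  \int[mu]_t (plateau a b e t)%:E = T%:E & (T <= b - a + 2 * e)%R.
Proof.
have mI : measurable `[(a - e)%R, (b + e)%R]%classic by exact: measurable_itv.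
have labI : mu `[(a - e)%R, (b + e)%R]%classic = (b - a + 2 * e)%:E.
  rewrite lebesgue_measure_itv/= lte_fin ifT; last exact: outer_side.
  by rewrite -EFinB; congr _%:E; ring.
have mp : measurable_fun setT (plateau a b e).
  by apply: continuous_measurable_fun; exact: smooth1_continuous.
have H : \int[mu]_t (plateau a b e t)%:E <= (b - a + 2 * e)%:E.
  rewrite (@integral_subset_vanishing _ _ _ mu `[(a - e)%R, (b + e)%R]%classic)//; last first.
    move=> t _ tI; rewrite plateau_off//; apply/negP => h; apply: tI.
    by rewrite /= in_itv.
  rewrite -labI -[leRHS]mul1e -(integral_cst mu mI 1).
  apply: ge0_le_integral => //.
  - by move=> t _; rewrite lee_fin plateau_ge0.
  - by apply/measurable_EFinP; exact: measurable_funTS.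
  - by move=> t _; rewrite lee_fin plateau_le1.
have H0 : 0 <= \int[mu]_t (plateau a b e t)%:E.
  by apply: integral_ge0 => t _; rewrite lee_fin plateau_ge0.
exists (fine (\int[mu]_t (plateau a b e t)%:E)).
  by rewrite fineK// ge0_fin_numE//; apply: le_lt_trans H _; rewrite ltry.
rewrite -lee_fin fineK// ge0_fin_numE//; apply: le_lt_trans H _; exact: ltry.
Qed.

End half_profile.

Lemma energy_test_value (R : realType) (p l e S T : R) : 1 < p -> 0 < l -> 0 <= S ->
  T <= l + 2 * e ->
  S * (l `^ (1 - p) - 2 * e * (p - 1) * l^-1 `^ p) <=
  p * l^-1 `^ (p - 1) * S - (p - 1) * l^-1 `^ p * (T * S).
Proof.
move=> p1 l0 S0 Tl; rewrite powR_inv_sub1//.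
have <- := powR_inv_mul p l0.
have : 0 <= (p - 1) * l^-1 `^ p * S * (l + 2 * e - T).
  by rewrite !mulr_ge0 ?powR_ge0//; lra.
set X := l^-1 `^ p; lra.
Qed.

Section cube_energy.
Context {R : realType} {n : nat}.
Variables (p L a b c e r : R) (D : set 'rV[R]_n) (q : 'rV[R]_n).
Variables (u : 'rV[R]_n.+1 -> R) (g : 'rV[R]_n.+1 -> 'rV[R]_n.+1).
Local Notation U := (cylinder L D).
Local Notation W := (product_cylinder `](- L)%R, L[%classic (cube q r)).
Hypotheses (p1 : 1 < p) (bD : bounded_set D) (oD : open D) (qD : cube q r `<=` D).
Hypotheses (ab : a < b) (e0 : 0 < e) (er : 4 * e < r).
Hypotheses (La : - L < a - e) (bc : b + e < c) (cL : c < L).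
Hypothesis ug : sobolev p U u g.
Local Notation leb := (lebesgue_rV n.+1).
Local Open Scope ereal_scope.
Hypothesis uE : {ae leb, forall x : 'rV[R]_n.+1, U x /\ (x ord0 ord0 <= a)%R -> (u x <= 0)%R}.
Hypothesis uF : {ae leb, forall x : 'rV[R]_n.+1, U x /\ (b <= x ord0 ord0 <= c)%R -> (1 <= u x)%R}.

Let phi := cube_test a b e r q.
Let S := cube_mass e r q.
Let eta (x : 'rV[R]_n.+1) := cube_cutoff e r q (behead_rV x).

Let eta_ge0 x : (0 <= eta x)%R. Proof. exact: cube_cutoff_ge0. Qed.

Let eta_le1 x : (eta x <= 1)%R. Proof. exact: cube_cutoff_le1. Qed.

Let bL : (b + e < L)%R. Proof. exact: lt_trans bc cL. Qed.

Let WU : W `<=` U.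
Proof. by rewrite cylinderE => x [h1 h2]; split => //; exact: qD. Qed.

Let inW (x : 'rV[R]_n.+1) : (a - e <= x ord0 ord0 <= b + e)%R ->
  cube q r (behead_rV x) -> W x.
Proof.
by move=> xI xq; split => //; rewrite /= in_itv/=; exact: (outer_side_in La bL xI).
Qed.

Let mW : measurable W.
Proof. by apply: measurable_product_cylinder => //; exact: measurable_cube. Qed.

Let mD : measurable D. Proof. exact: open_measurable_rV. Qed.

Let mU : measurable U.
Proof. by rewrite cylinderE; exact: measurable_product_cylinder. Qed.

Let Ufin : leb U < +oo.
Proof.
rewrite cylinderE lebesgue_rV_product_cylinder//.
have Df : lebesgue_rV n D \is a fin_num.
  by rewrite ge0_fin_numE//; exact: bounded_set_fin.
rewrite lebesgue_measure_itv/=; case: ifP => _; last by rewrite mul0e ltry.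
by rewrite -(fineK Df) -EFinB -EFinM ltry.
Qed.

Let Wfin : leb W < +oo.
Proof. by apply: le_lt_trans Ufin; apply: le_measure; rewrite ?inE. Qed.

Lemma cube_test_function : test_function U phi.
Proof.
apply: (@tensor_test_function _ _ _
  (fun j => if unlift ord0 j is Some i then (q ord0 i + e)%R else (a - e)%R)
  (fun j => if unlift ord0 j is Some i then (q ord0 i + r - e)%R else (b + e)%R)).
- by move=> j; case: unlift => [i|]; exact: smooth1_plateau.
- move=> j t; case: unlift => [i|]; last exact: plateau_off.
  rewrite (_ : (q ord0 i + e = q ord0 i + 2 * e - e)%R); last by ring.
  rewrite (_ : (q ord0 i + r - e = q ord0 i + r - 2 * e + e)%R); last by ring.
  exact: plateau_off.
- move=> x xB; apply: WU; apply: inW.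
    by have := xB ord0; rewrite unlift_none /= in_itv.
  move=> i; have := xB (lift ord0 i); rewrite liftK /= !in_itv/= mxE.
  exact: inner_side_in.
Qed.

Let psi' := derive1 (plateau a b e).

Let off f (x : 'rV[R]_n.+1) : (forall t, ~~ (a - e <= t <= b + e)%R -> f t = 0%R) ->
  ~ W x -> (f (x ord0 ord0) * eta x = 0)%R.
Proof. by move=> f0; exact: (profile_vanish e0 inW f0). Qed.

Let phi_off x : ~ W x -> phi x = 0%R.
Proof. by move=> nW; rewrite /phi cube_testE; apply: off => // t; exact: plateau_off. Qed.

Let partial_phi x : partial ord0 phi x = (psi' (x ord0 ord0) * eta x)%R.
Proof. exact: partial_cube_test. Qed.

Let psi'_off t : ~~ (a - e <= t <= b + e)%R -> psi' t = 0%R.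
Proof. exact: plateau_derive1_eq0. Qed.

Let weak : \int[leb]_(x in W) (u x * (psi' (x ord0 ord0) * eta x))%:E =
  - \int[leb]_(x in W) (g x ord0 ord0 * phi x)%:E.
Proof.
have [_ _ _ /(_ ord0 phi cube_test_function) wg] := ug.
rewrite -(@integral_subset_vanishing _ _ _ leb _ U); last 2 first.
- exact: WU.
- by move=> x _ nW; rewrite off ?mulr0//.
transitivity (\int[leb]_(x in U) (u x * partial ord0 phi x)%:E).
  by apply: eq_integral => x _; rewrite partial_phi.
rewrite wg; congr (- _); apply: integral_subset_vanishing; first exact: WU.
by move=> x _ nW; rewrite phi_off ?mulr0.
Qed.

Let mg : measurable_fun U (fun x => enorm (g x)).
Proof. by have [[_ mg] _ _ _] := ug; exact: (measurableT_comp measurable_enorm). Qed.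

Let mg0 : measurable_fun U (fun x => g x ord0 ord0).
Proof. by have [[_ mg'] _ _ _] := ug; exact: (measurableT_comp (measurable_coord _)). Qed.

Let u_integrable : leb.-integrable W (EFin \o u).
Proof.
have [[mu _] up _ _] := ug; apply: (integrableS mU mW WU).
exact: (integrable_powR p1 mU Ufin mu up).
Qed.

Let g0_integrable : leb.-integrable W (fun x => (g x ord0 ord0)%:E).
Proof.
apply: (integrableS mU mW WU).
have gi : leb.-integrable U (EFin \o (fun x => enorm (g x))).
  apply: (integrable_powR p1 mU Ufin mg); have [_ _ gp _] := ug.
  by under eq_integral do rewrite ger0_norm ?enorm_ge0//.
apply: (le_integrable mU _ _ gi); first exact/measurable_EFinP.
move=> x _; rewrite /= lee_fin [leRHS]ger0_norm ?enorm_ge0//.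
exact: coord_le_enorm.
Qed.

Let W_measurable (f : R -> R) : measurable_fun setT f ->
  measurable_fun W (fun x : 'rV[R]_n.+1 => f (x ord0 ord0) * eta x)%R.
Proof. by move=> mf; apply: measurable_funTS; exact: profile_measurable. Qed.

Let W_phi : measurable_fun W phi.
Proof.
rewrite (_ : phi = fun x => plateau a b e (x ord0 ord0) * eta x)%R; last first.
  by apply/funext => x; exact: cube_testE.
apply: W_measurable; apply: continuous_measurable_fun; apply: smooth1_continuous.
exact: smooth1_plateau.
Qed.

Let phi01 x : (0 <= phi x <= 1)%R.
Proof.
rewrite /phi cube_testE -/(eta x); apply/andP; split.
  by rewrite mulr_ge0 ?plateau_ge0 ?eta_ge0.
by rewrite mulr_ile1 ?plateau_ge0 ?eta_ge0 ?plateau_le1 ?eta_le1.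
Qed.

Let S0 : (0 <= S)%R.
Proof.
apply: le_trans (cube_mass_ge q e0 er); apply: exprn_ge0.
by rewrite subr_ge0 ltW.
Qed.

Let test_lower : S%:E <= \int[leb]_(x in W) (g x ord0 ord0 * phi x)%:E.
Proof.
have [M M0 HM] := derive1_plateau_bounded a b e0.
have mp' := measurable_derive1_plateau a b e.
have md := measurable_descent a b e.
have dM := descent_bounded M0 HM.
have i1 : leb.-integrable W (fun x => (u x * (psi' (x ord0 ord0) * eta x))%:E).
  apply: (@integrableM_bounded _ _ _ _ _ u (fun x => psi' (x ord0 ord0) * eta x)%R M) => //.
    exact: W_measurable.
  by move=> x _; exact: (profile_bound e r q HM).
have i2 : leb.-integrable W (fun x : 'rV[R]_n.+1 => (descent a b e (x ord0 ord0) * eta x)%:E).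
  apply: (integrableS measurableT mW (@subsetT _ _)).
  exact: (profile_integrable e0 mW Wfin inW md dM (descent_off e0)).
have d1 : \int[leb]_(x in W) (descent a b e (x ord0 ord0) * eta x)%:E = (- S)%:E.
  rewrite -(@integral_subset_vanishing _ _ _ leb _ setT) => //; last first.
    by move=> x _ nW; rewrite off// => t; exact: descent_off.
  have := profile_integral e0 ab er mW Wfin inW md dM (descent_off e0)
    (integral_descent e0 ab).
  by rewrite mulN1r.
have : \int[leb]_(x in W) (u x * (psi' (x ord0 ord0) * eta x))%:E <= (- S)%:E.
  rewrite -d1; apply: ae_le_integral => //.
  apply: filterS2 uE uF => x xE xF Wx; rewrite lee_fin mulrA ler_wpM2r ?eta_ge0//.
  apply: (@le_descent _ a b e e0 ab c) => // h; first by apply: xE; split => //; exact: WU.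
  by apply: xF; split => //; exact: WU.
by rewrite weak EFinN leeN2.
Qed.

Let test_upper : exists2 T, \int[leb]_(x in W) (phi x)%:E <= (T * S)%:E &
  (T <= b - a + 2 * e)%R.
Proof.
have [T TE Tle] := integral_plateau_le e0 ab; exists T => //.
have mp : measurable_fun setT (plateau a b e).
  apply: continuous_measurable_fun; apply: smooth1_continuous; exact: smooth1_plateau.
have pM t : (`|plateau a b e t| <= 1)%R by rewrite ger0_norm ?plateau_ge0 ?plateau_le1.
have p0 t : ~~ (a - e <= t <= b + e)%R -> plateau a b e t = 0%R by exact: plateau_off.
have pE := profile_integral e0 ab er mW Wfin inW mp pM p0 TE.
rewrite le_eqVlt; apply/orP; left; apply/eqP; rewrite -pE.
rewrite (@integral_subset_vanishing _ _ _ leb W setT) => //.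
  by apply: eq_integral => x _; rewrite /phi cube_testE.
by move=> x _ nW; rewrite off.
Qed.

Lemma cube_energy : ((r - 4 * e) ^+ n *
    ((b - a) `^ (1 - p) - 2 * e * (p - 1) * (b - a)^-1 `^ p))%:E <=
  \int[leb]_(x in W) (enorm (g x) `^ p)%:E.
Proof.
set C := (_ - _ * _ `^ p)%R.
have [C0|C0] := leP C 0%R.
  apply: (@le_trans _ _ 0); last by apply: integral_ge0 => x _; rewrite lee_fin powR_ge0.
  by rewrite lee_fin mulr_ge0_le0// exprn_ge0// subr_ge0 ltW.
have l0 : (0 < b - a)%R by rewrite subr_gt0.
have [T TS Tle] := test_upper.
apply: (@le_trans _ _ (p * (b - a)^-1 `^ (p - 1) * S - (p - 1) * (b - a)^-1 `^ p * (T * S))%:E).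
  rewrite lee_fin; apply: le_trans (energy_test_value p1 l0 S0 Tle).
  by rewrite ler_wpM2r ?(ltW C0)//; exact: cube_mass_ge.
apply: (@energy_test _ _ _ leb W (fun x => enorm (g x)) (fun x => g x ord0 ord0) phi) => //.
- by rewrite invr_gt0.
- exact: measurable_funS mU WU mg.
- apply: measurable_bounded_integrable => //.
  by apply: (bounded_by (M := 1%R)) => x _; have /andP[h1 h2] := phi01 x; rewrite ger0_norm.
- apply: (@integrableM_bounded _ _ _ _ _ _ phi 1%R) => //.
  by move=> x _; have /andP[h1 h2] := phi01 x; rewrite ger0_norm.
- by move=> x _; exact: coord_le_enorm.
Qed.

End cube_energy.

Lemma polynomial_limit_le (R : realType) n (r C K s : R) :
  (\forall e \near 0^'+, (r - 4 * e) ^+ n * (C - 2 * e * K) <= s) -> r ^+ n * C <= s.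
Proof.
pose P : {poly R} := (r%:P - 4 *: 'X) ^+ n * (C%:P - (2 * K) *: 'X).
have PE e : P.[e] = (r - 4 * e) ^+ n * (C - 2 * e * K).
  by rewrite /P !hornerE; congr (_ * _); ring.
move=> H; have -> : r ^+ n * C = P.[0] by rewrite PE !(mulr0, mul0r) !subr0.
have cP : horner P e @[e --> 0^'+] --> P.[0].
  by apply: cvg_at_right_filter; exact: continuous_horner.
by apply: cvgr_to_le cP _; near=> e; rewrite PE; near: e.
Unshelve. all: by end_near. Qed.

Section capacity_lower_bound.
Context {R : realType} {n : nat}.
Variables (p L a b c : R) (D : set 'rV[R]_n).
Hypotheses (p1 : 1 < p) (bD : bounded_set D) (oD : open D).
Hypotheses (La : - L < a) (ab : a < b) (bc : b < c) (cL : c < L).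
Local Notation U := (cylinder L D).
Local Notation leb := (lebesgue_rV n.+1).
Local Open Scope ereal_scope.

Section gradient_bound.
Variables (u : 'rV[R]_n.+1 -> R) (g : 'rV[R]_n.+1 -> 'rV[R]_n.+1).
Hypothesis ug : sobolev p U u g.
Hypothesis uE : {ae leb, forall x : 'rV[R]_n.+1, U x /\ (x ord0 ord0 <= a)%R -> (u x <= 0)%R}.
Hypothesis uF : {ae leb, forall x : 'rV[R]_n.+1, U x /\ (b <= x ord0 ord0 <= c)%R -> (1 <= u x)%R}.

Lemma cube_gradient_ge q r : (0 < r)%R -> cube q r `<=` D ->
  lebesgue_rV n (cube q r) * ((b - a) `^ (1 - p))%:E <=
  \int[leb]_(x in product_cylinder `](- L)%R, L[%classic (cube q r)) (enorm (g x) `^ p)%:E.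
Proof.
move=> r0 qD; rewrite (lebesgue_rV_cube _ (ltW r0)) -EFinM.
set I := \int[_]_(_ in _) _.
have [Ioo|Ioo] := eqVneq I +oo; first by rewrite Ioo leey.
have If : I \is a fin_num.
  by rewrite ge0_fin_numE ?ltey//; apply: integral_ge0 => x _; rewrite lee_fin powR_ge0.
rewrite -(fineK If) lee_fin.
apply: (@polynomial_limit_le _ _ _ _ ((p - 1) * (b - a)^-1 `^ p)%R).
near=> e; rewrite -lee_fin (fineK If) (_ : (2 * e * ((p - 1) * (b - a)^-1 `^ p))%R =
  (2 * e * (p - 1) * (b - a)^-1 `^ p)%R); last by rewrite !mulrA.
have e0 : (0 < e)%R by near: e; exact: nbhs_right_gt.
apply: (@cube_energy _ _ _ _ _ _ c _ _ D _ u) => //.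
- rewrite -ltr_pdivlMl//; near: e; apply: nbhs_right_lt; rewrite mulr_gt0// invr_gt0//.
- rewrite ltrBrDl -ltrBrDr; near: e; apply: nbhs_right_lt; rewrite subr_gt0//.
- rewrite -ltrBrDl; near: e; apply: nbhs_right_lt; rewrite subr_gt0//.
Unshelve. all: by end_near. Qed.

Lemma gradient_energy_ge :
  lebesgue_rV n D * ((b - a) `^ (1 - p))%:E <= \int[leb]_(x in U) (enorm (g x) `^ p)%:E.
Proof.
have [A [tA DE Ac]] := open_dyadic_partition oD.
have mA m : measurable (A m).
  by have [->|[q [r [_ ->]]]] := Ac m; [exact: measurable0|exact: measurable_cube].
pose V m := product_cylinder `](- L)%R, L[%classic (A m).
have UE : U = \bigcup_m V m.
  rewrite cylinderE DE; apply/seteqP; split=> [x [xI [m _ Am]]|x [m _ [xI Am]]].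
    by exists m.
  by split => //; exists m.
have mV m : measurable (V m) by exact: measurable_product_cylinder.
have tV : trivIset setT V.
  move=> i j _ _ [x [[_ xi] [_ xj]]]; apply: tA => //.
  by exists (behead_rV x).
have mg : measurable_fun U (fun x => (enorm (g x) `^ p)%:E).
  have [[_ mg] _ _ _] := ug.
  apply/measurable_EFinP; apply: (measurableT_comp (measurable_powR p)).
  exact: (measurableT_comp measurable_enorm).
have -> : lebesgue_rV n D = \sum_(m <oo) lebesgue_rV n (A m).
  by rewrite DE measure_semi_bigcup// -DE; exact: open_measurable_rV.
rewrite muleC -nneseriesZl; last by move=> m _; exact: measure_ge0.
rewrite [in leRHS]UE ge0_integral_bigcup//; last first.
- by move=> x _; rewrite lee_fin powR_ge0.
- by rewrite -UE.
apply: lee_nneseries => [m *|m _]; first by apply: mule_ge0 => //; rewrite lee_fin powR_ge0.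
rewrite muleC /V; have [->|[q [r [r0 E]]]] := Ac m.
  by rewrite measure0 mul0e; apply: integral_ge0 => x _; rewrite lee_fin powR_ge0.
by rewrite E; apply: cube_gradient_ge => //; rewrite -E DE; exact: bigcup_sup.
Qed.

End gradient_bound.

Lemma condenser_capacity_lower_bound :
  lebesgue_rV n D * ((b - a) `^ (1 - p))%:E <=
  condenser_capacity p U
    [set x : 'rV[R]_n.+1 | U x /\ x ord0 ord0 <= a]%R
    [set x : 'rV[R]_n.+1 | U x /\ b <= x ord0 ord0 <= c]%R.
Proof.
have p0 : (0 < p)%R by exact: lt_trans p1.
apply: le_ereal_inf_tmp => _ [u [g [[ug _ uE uF] ->]]].
apply: (@gradient_energy_ge u g ug).
  exact: (quasi_everywhere_ae p0 uE).
exact: (quasi_everywhere_ae p0 uF).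
Qed.

End capacity_lower_bound.

Unset Implicit Arguments.

(* The dimension written n in the source is d.+1 here. *)
Theorem proposition6p3 (R : realType) (d : nat) (p L a b c : R)
    (D : set 'rV[R]_d) :
  1 < p -> 0 < L -> bounded_set D -> open D ->
  - L < a -> a < b -> b < c -> c < L ->
  let Omega : set 'rV[R]_d.+1 := cylinder L D in
  let theta : 'rV[R]_d.+1 -> R := fun x => x ord0 ord0 in
  let E := [set x | Omega x /\ x ord0 ord0 <= a] in
  let F := [set x | Omega x /\ b <= x ord0 ord0 <= c] in
  (condenser_capacity p Omega E F = hausdorff d D * ((b - a) `^ (1 - p))%:E /\
   hausdorff d D * ((b - a) `^ (1 - p))%:E =
     weighted_capacity p Omega theta a b)%E.

Proof.
move=> p1 L0 bD oD La ab bc cL Omega theta E F.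
have Dfin : (lebesgue_rV d D < +oo)%E by apply: bounded_set_fin => //; exact: open_measurable_rV.
have DE : lebesgue_rV d D = (fine (lebesgue_rV d D))%:E by rewrite fineK// ge0_fin_numE.
rewrite (hausdorff_open oD); split.
  apply/eqP; rewrite eq_le condenser_capacity_upper_bound//=.
  exact: condenser_capacity_lower_bound.
rewrite (@weighted_capacityE _ _ _ _ _ _ _ (fine (lebesgue_rV d D)) p1 ab) -?DE//.
  by rewrite fine_ge0.
move=> t /andP[at_ tb]; rewrite -(hausdorff_open oD); apply: energy_weight_cylinder => //.
by rewrite (lt_trans La at_)/= (lt_trans tb) // (lt_trans bc).
Qed.
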